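(* Consider the model problem with constant reaction coefficient $b(x)\equiv b>0$ and $f\in H^2(I)$, and let $0<\delta<1$ be fixed. There exist constants $C,C_\delta,\tilde C_\delta>0$ independent of $\varepsilon$ and $\tau$ such that for every accuracy $\tau\in(0,1]$ and every $\varepsilon\in(0,1]$ there is a strict ReLU feedforward network $\Phi^\tau_\varepsilon$ with width $\bar W(\Phi^\tau_\varepsilon)\le C|\log_2\tau|^2$ (for $\tau$ small), depth $\bar L(\Phi^\tau_\varepsilon)\le C\tau^{-1/[2(1-\delta)]}$, and size $M(\Phi^\tau_\varepsilon)\le C_\delta\tau^{-1/[2(1-\delta)]}$, such that $$\|u_\varepsilon-\mathrm R(\Phi^\tau_\varepsilon)\|_{1,\varepsilon,I}\le\tau\le\tilde C_\delta M^{-2(1-\delta)},\qquad \|u_\varepsilon-\mathrm R(\Phi^\tau_\varepsilon)\|_{L^2(I)}\le\tau^2\le\tilde C_\delta^2M^{-4(1-\delta)},$$ where $M=M(\Phi^\tau_\varepsilon)$.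
   Context: $I=(-1,1)$, $\varepsilon\in(0,1]$; $u_\varepsilon\in H^1_0(I)$ is the weak solution of $-\varepsilon^2u''+bu=f$ in $I$, $u(\pm1)=0$. Energy norm $\|w\|_{1,\varepsilon,I}^2=\int_I(\varepsilon^2(w')^2+bw^2)dx$. A feedforward network $\Phi=((A_1,b_1),\dots,(A_L,b_L))$ has realization $\mathrm R(\Phi)$: $x_0=x$, $x_\ell=\max\{0,A_\ell x_{\ell-1}+b_\ell\}$ (componentwise) for $\ell<L$, $\mathrm R(\Phi)(x)=A_Lx_{L-1}+b_L$. Depth $\bar L=L$, width $\bar W=\max_\ell N_\ell$ (number of rows of $A_\ell$), size $M(\Phi)$ = total number of nonzero entries of all $A_\ell,b_\ell$. *)

(* Defs.v *)
From HB Require Import structures.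
From mathcomp Require Import all_boot all_order all_algebra.
From mathcomp Require Import all_classical all_reals all_analysis.
Set Implicit Arguments. Unset Strict Implicit. Unset Printing Implicit Defensive.
Import Order.TTheory GRing.Theory Num.Theory.
Import numFieldNormedType.Exports.
Local Open Scope classical_set_scope.
Local Open Scope ring_scope.

Record layer (R : numDomainType) := Layer {
  ldin : nat; ldout : nat;
  lA : 'M[R]_(ldout, ldin);
  lb : 'cV[R]_ldout }.

Definition network (R : numDomainType) := seq (layer R).

Section Networks.
Variable R : numDomainType.

Definition affine (l : layer R) (x : seq R) : seq R :=
  [seq \sum_(j < ldin l) lA l i j * nth 0 x j + lb l i ord0 | i <- enum 'I_(ldout l)].

Definition relu_vec (s : seq R) : seq R := [seq Num.max 0 y | y <- s].

Fixpoint realize_aux (Phi : network R) (x : seq R) : seq R :=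
  match Phi with
  | [::] => x
  | [:: l] => affine l x
  | l :: Phi' => realize_aux Phi' (relu_vec (affine l x))
  end.

Definition realization (Phi : network R) (t : R) : R :=
  nth 0 (realize_aux Phi [:: t]) 0.

Definition net_wf (Phi : network R) : bool :=
  match Phi with
  | [::] => false
  | l :: _ => [&& ldin l == 1%N, ldout (last l Phi) == 1%N &
               sorted (fun l1 l2 => ldout l1 == ldin l2) Phi]
  end.

Definition depth (Phi : network R) : nat := size Phi.
Definition width (Phi : network R) : nat := \max_(l <- Phi) ldout l.
Definition layer_nnz (l : layer R) : nat :=
  (#|[set ij : 'I_(ldout l) * 'I_(ldin l) | lA l ij.1 ij.2 != 0%R]|
   + #|[set i : 'I_(ldout l) | lb l i ord0 != 0%R]|)%N.
Definition net_size (Phi : network R) : nat := \sum_(l <- Phi) layer_nnz l.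
End Networks.

Section Sobolev.
Variable R : realType.
Local Notation mu := (@lebesgue_measure R).
Definition I : set R := `[-1, 1].

(* g is (a representative of) the weak derivative of u on I and u, g
   are in L^2(I): u is the indefinite integral of the L^2 function g,
   i.e. u is absolutely continuous with u' = g a.e. *)
Definition has_weak_deriv (u g : R -> R) : Prop :=
  [/\ mu.-integrable I (fun x => (u x)%:E),
      mu.-integrable I (fun x => (u x ^+ 2)%:E),
      mu.-integrable I (fun x => (g x)%:E),
      mu.-integrable I (fun x => (g x ^+ 2)%:E) &
      forall x, -1 <= x <= 1 -> u x = u (-1) + \int[mu]_(y in `[-1, x]) g y].

Definition in_H2 (f : R -> R) : Prop :=
  exists f1 f2, has_weak_deriv f f1 /\ has_weak_deriv f1 f2.

Definition in_H10 (u g : R -> R) : Prop :=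
  has_weak_deriv u g /\ u (-1) = 0 /\ u 1 = 0.

(* u is the weak solution in H^1_0(I) of -eps^2 u'' + b u = f, u(+-1)=0 *)
Definition weak_solution (eps b : R) (f u : R -> R) : Prop :=
  exists g, in_H10 u g /\
    forall v gv, in_H10 v gv ->
      \int[mu]_(x in I) (eps ^+ 2 * g x * gv x + b * u x * v x)
      = \int[mu]_(x in I) (f x * v x).

Definition energy_norm_le (eps b : R) (w : R -> R) (tau : R) : Prop :=
  exists g, has_weak_deriv w g /\
    Num.sqrt (\int[mu]_(x in I) (eps ^+ 2 * g x ^+ 2 + b * w x ^+ 2)) <= tau.

Definition L2_norm_le (w : R -> R) (tau : R) : Prop :=
  mu.-integrable I (fun x => (w x ^+ 2)%:E) /\
  Num.sqrt (\int[mu]_(x in I) (w x ^+ 2)) <= tau.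

Definition log2 (x : R) : R := ln x / ln 2.
End Sobolev.

(* Main.v *)
Require Import Defs.
From HB Require Import structures.
From mathcomp Require Import all_boot all_order all_algebra.
From mathcomp Require Import all_classical all_reals all_analysis.
From mathcomp Require Import measurable_realfun ring lra zify.
Import Order.TTheory GRing.Theory Num.Theory.
Import numFieldNormedType.Exports.
Local Open Scope classical_set_scope.
Local Open Scope ring_scope.
Set Implicit Arguments. Unset Strict Implicit. Unset Printing Implicit Defensive.

(** The network realizes exactly the piecewise linear function that interpolates
    quantized nodal values on a Shishkin mesh: [K] equal cells in each of the two
    layer regions, of width [sigma ~ eps (1 + ln (1/tau))], and [K] equal cells in
    between, with [K ~ 1 / tau] up to logarithms.

    Such a function, with [O(K)] nodes carrying [B = O(1 + ln (1/tau))] bits each,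
    is computed by a network of bounded width and depth [O(sqrt K * B)]: the nodes
    are grouped into [O(sqrt K)] blocks, the bits of a block are packed into one
    integer, the integer of the block containing the input is selected by a sum of
    trapezoids, and its bits are extracted one after the other.  The logarithmic
    factors are absorbed by [tau^(-delta')], where
    [(2 (1 - delta))^-1 = 1/2 + delta'].

    Interpolation on a cell of length [h] costs [h^2 |u''|] in [L^2] and [h |u''|]
    for the derivative.  In the layers the bound [eps^2 |u''|_{L^2} <= C]
    suffices.  If [eps >= rho tau^4], then [u''] is bounded in [L^2] between the
    layers by an exponentially weighted energy estimate for its equation
    [- eps^2 (u'')'' + b u'' = f''].  If [eps < rho tau^4], then the layers have
    energy norm [O(sqrt eps) = O(tau^2)] and [f / b] is interpolated instead. *)

(** * ReLU networks computing piecewise linear interpolants *)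

(** With [K ~ 1 / tau] nodes, a network that stores every nodal value in a weight of its own has
    size of order [1 / tau]. A size close to [tau^(-1/2)] leaves far fewer weights than nodes, so
    each weight has to carry a whole block of values. ReLU networks are continuous, so neither a
    block nor a bit can be selected by a jump: codes are integers, on which ramps act as exact
    tests, and the switching between blocks takes place in gaps. Neighbouring blocks leave no gap,
    hence even and odd blocks are treated in two passes.

    The threshold [tau^4] has two origins. The squared [L^2] error may be at most [tau^4], and a
    neglected layer costs [O(eps)]. In the opposite case the boundary terms of the weighted estimate
    grow like [eps^-4], hence at most like [tau^-16], and a layer region of width a constant times
    [eps (1 + ln (1/tau))] makes the weight at the end points smaller than the inverse of that.
    There the solution is also bounded by a power of [1 / tau], so [O(1 + ln (1/tau))] bits per
    value suffice. *)

Section NetworkPrograms.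
Variable R : realType.
Implicit Types (x : seq R) (ls : seq (layer R)).

(** It stops at the end of the shorter list, so that the rows of a layer can be written without
    their trailing zeros. *)
Fixpoint dot (r x : seq R) : R :=
  match r, x with
  | a :: r', y :: x' => a * y + dot r' x'
  | _, _ => 0
  end.

Definition relu (y : R) : R := Num.max 0 y.

Lemma relu_id y : 0 <= y -> relu y = y.
Proof. by move=> y0; apply/max_idPr. Qed.

Lemma relu_le0 y : y <= 0 -> relu y = 0.
Proof. by move=> y0; apply/max_idPl. Qed.

Lemma relu_ge0 y : 0 <= relu y.
Proof. by rewrite le_max lexx. Qed.

Definition mk_layer (din : nat) (rows : seq (seq R * R)) : layer R :=
  @Layer R din (size rows)
    (\matrix_(i, j) nth 0 (nth ([::], 0) rows i).1 j)
    (\col_i (nth ([::], 0) rows i).2).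

Lemma dotE (r x : seq R) :
  \sum_(j < size x) nth 0 r j * nth 0 x j = dot r x.
Proof.
elim: x r => [|y x IH] [|a r] //=; rewrite ?big_ord0 //.
  by apply: big1 => i _; rewrite nth_nil mul0r.
by rewrite big_ord_recl /= -IH.
Qed.

Lemma affine_mk_layer din rows x : size x = din ->
  affine (mk_layer din rows) x = [seq dot r.1 x + r.2 | r <- rows].
Proof.
move=> sx; subst din; rewrite /affine /=.
rewrite -[in RHS](mkseq_nth ([::], 0) rows) /mkseq -val_enum_ord.
rewrite -[in RHS]map_comp -[in RHS]map_comp; apply: eq_map => i /=; rewrite mxE; congr (_ + _).
by rewrite -dotE; apply: eq_bigr => j _; rewrite mxE.
Qed.

Definition run ls x : seq R := foldl (fun y l => relu_vec (affine l y)) x ls.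

Lemma realize_rcons ls l x : realize_aux (rcons ls l) x = affine l (run ls x).
Proof.
elim: ls x => [//|k ls IH] x /=.
by case E : (rcons ls l) => [|l' ls']; [case: ls E {IH} | rewrite -E IH].
Qed.

(** Unlike [net_wf], it makes sense for the empty list and for any input and output dimension, so
    that pieces of networks can be concatenated. *)
Fixpoint chain (a : nat) ls (b : nat) : bool :=
  match ls with
  | [::] => a == b
  | l :: ls' => (ldin l == a) && chain (ldout l) ls' b
  end.

Lemma chain_cat a b c ls1 ls2 :
  chain a ls1 b -> chain b ls2 c -> chain a (ls1 ++ ls2) c.
Proof.
by elim: ls1 a => [a /= /eqP -> //|l ls1 IH a /= /andP[-> /IH h] /h].
Qed.

(* 9 is the number of neurons needed to extract a bit, see [prog_item]. *)
Definition narrow (l : layer R) : bool := (ldin l <= 9)%N && (ldout l <= 9)%N.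

Variable D : R -> Prop.

(** A specification of [d] hidden layers. The states before and after are functions of the network
    input [t], so a later state may refer to quantities that the layers no longer carry. Every layer
    ends with ReLU, hence only nonnegative quantities pass through unchanged. *)
Definition prog (a b d : nat) (f g : R -> seq R) : Prop :=
  exists ls, [/\ chain a ls b, size ls = d, all narrow ls &
    forall t, D t -> run ls (f t) = g t].

Lemma prog_layer (a : nat) rows (f g : R -> seq R) :
  (a <= 9)%N -> (size rows <= 9)%N ->
  (forall t, D t -> size (f t) = a /\
     g t = [seq relu (dot r.1 (f t) + r.2) | r <- rows]) ->
  prog a (size rows) 1 f g.
Proof.
move=> a9 r9 h; exists [:: mk_layer a rows]; split => //=.
- by rewrite !eqxx.
- by rewrite /narrow /= a9 r9.
- move=> t /h[sf ->]; rewrite affine_mk_layer // /relu_vec -map_comp.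
  exact: eq_map.
Qed.

Lemma prog_trans b a c d e f g h :
  prog a b d f g -> prog b c e g h -> prog a c (d + e) f h.
Proof.
move=> [l1 [c1 s1 n1 r1]] [l2 [c2 s2 n2 r2]]; exists (l1 ++ l2); split.
- exact: chain_cat c1 c2.
- by rewrite size_cat s1 s2.
- by rewrite all_cat n1 n2.
- by move=> t Dt; rewrite /run foldl_cat -/(run l1 (f t)) r1 //; apply: r2.
Qed.

Lemma prog_iter a d n (f : nat -> R -> seq R) :
  (forall i, (i < n)%N -> prog a a d (f i) (f i.+1)) ->
  prog a a (n * d) (f 0%N) (f n).
Proof.
elim: n => [|n IH] h.
  by exists [::]; split => //=; rewrite eqxx.
rewrite mulSn addnC; apply: prog_trans (h n (ltnSn _)).
by apply: IH => i ilt; apply: h; apply: ltnW.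
Qed.

End NetworkPrograms.

(** * Extraction of the binary digits of an integer *)

Section BitExtraction.
Variable R : realType.
Implicit Types (c s t : R) (bits : nat -> bool).

(** The hat function with peak 1 at [p] and support [[p - 1, p + 1]], as a second difference of
    ReLUs. *)
Definition bump_at (s p : R) : R :=
  relu (s - p + 1) - 2 * relu (s - p) + relu (s - p - 1).

Lemma bump_at_out s p : s <= p - 1 \/ p + 1 <= s -> bump_at s p = 0.
Proof.
rewrite /bump_at => -[h|h].
  rewrite !relu_le0; lra.
rewrite !relu_id; lra.
Qed.

Lemma bump_at_l s p : p - 1 <= s <= p -> bump_at s p = s - p + 1.
Proof.
move=> h; rewrite /bump_at (relu_id (y := s - p + 1)); last lra.
rewrite !relu_le0; lra.
Qed.

Lemma bump_at_r s p : p <= s <= p + 1 -> bump_at s p = p + 1 - s.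
Proof.
move=> h; rewrite /bump_at (relu_le0 (y := s - p - 1)); last lra.
rewrite !relu_id; lra.
Qed.

Lemma bump_at_itv s p : 0 <= bump_at s p <= 1.
Proof.
have [h|h] := leP s (p - 1); first by rewrite bump_at_out ?lexx ?ler01 //; left.
have [h'|h'] := leP (p + 1) s; first by rewrite bump_at_out ?lexx ?ler01 //; right.
have [h2|h2] := leP s p; [rewrite bump_at_l|rewrite bump_at_r]; lra.
Qed.

Lemma bump_at_shift s p d : bump_at (s - d) p = bump_at s (p + d).
Proof. by rewrite /bump_at; have -> : s - d - p = s - (p + d) by ring. Qed.

(** A continuous substitute for the test [th <= c]: it rises from 0 to 1 between [th - 1] and [th],
    and for an integer [th] no integer lies strictly in between. *)
Definition top_bit (th c : R) : R := relu (c - th + 1) - relu (c - th).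

Lemma top_bit_itv th c : 0 <= top_bit th c <= 1.
Proof.
rewrite /top_bit; have [h|h] := leP c (th - 1).
  rewrite !relu_le0; lra.
have [h'|h'] := leP th c; first by rewrite !relu_id; lra.
rewrite relu_id ?relu_le0; lra.
Qed.

Lemma top_bit_lo th c : c <= th - 1 -> top_bit th c = 0.
Proof. by move=> h; rewrite /top_bit !relu_le0; lra. Qed.

Lemma top_bit_hi th c : th <= c -> top_bit th c = 1.
Proof. by move=> h; rewrite /top_bit !relu_id; lra. Qed.

Variables (Q : nat).

Definition thr (q : nat) : R := 2 ^+ (Q - 1 - q).

(** The code without its [q] leading digits, the most significant digit being number 0. The outer
    ReLU is the one that the layer applies; it changes nothing on the values of [code], and keeps
    the result nonnegative on other arguments. *)
Fixpoint rest (c : R) (q : nat) : R :=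
  if q is q'.+1 then relu (rest c q' - thr q' * top_bit (thr q') (rest c q'))
  else c.

Definition bit_at (c : R) (q : nat) : R := top_bit (thr q) (rest c q).

Lemma rest_ge0 c q : 0 <= c -> 0 <= rest c q.
Proof. by case: q => [//|q] _; apply: relu_ge0. Qed.

Definition code (bits : nat -> bool) : R :=
  \sum_(0 <= k < Q) (bits k)%:R * thr k.

Lemma code_ge0 bits : 0 <= code bits.
Proof. by apply: sumr_ge0 => k _; rewrite mulr_ge0 // exprn_ge0. Qed.

(** A geometric sum: the digits that follow one of weight [2 ^+ (Q - q)] total at most that weight
    minus 1, so [top_bit] is never evaluated inside its ramp. *)
Lemma code_tail_le bits q : (q <= Q)%N ->
  \sum_(q <= k < Q) (bits k)%:R * thr k <= 2 ^+ (Q - q) - 1.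
Proof.
(* The induction is on the number [Q - q] of remaining digits. *)
move=> qQ; rewrite -[in X in X <= _](subKn qQ).
have : (Q - q <= Q)%N by rewrite leq_subr.
elim: (Q - q)%N => [|r IH] rQ; first by rewrite subn0 big_geq // expr0 subrr.
have lt : (Q - r.+1 < Q)%N by lia.
rewrite big_ltn //; have -> : (Q - r.+1).+1 = (Q - r)%N by lia.
rewrite exprS; have := IH (ltnW rQ).
have -> : thr (Q - r.+1) = 2 ^+ r by rewrite /thr; congr (_ ^+ _); lia.
have p0 : 0 <= 2 ^+ r :> R by rewrite exprn_ge0.
by case: (bits _) => /=; rewrite ?mul1r ?mul0r; lra.
Qed.

Lemma rest_code bits q : (q <= Q)%N ->
  rest (code bits) q = \sum_(q <= k < Q) (bits k)%:R * thr k.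
Proof.
elim: q => [//|q IH] qQ /=; rewrite IH ?(ltnW qQ) //.
have tl := @code_tail_le bits q.+1 qQ.
have t0 : 0 <= \sum_(q.+1 <= k < Q) (bits k)%:R * thr k.
  by apply: sumr_ge0 => k _; rewrite mulr_ge0 // exprn_ge0.
have eth : thr q = 2 ^+ (Q - q.+1) by rewrite /thr; congr (_ ^+ _); lia.
rewrite (big_ltn qQ); case: (bits q) => /=; rewrite ?mul1r ?mul0r ?add0r.
  rewrite top_bit_hi; last by rewrite lerDl.
  by rewrite mulr1 addrC addKr relu_id.
rewrite top_bit_lo; last by rewrite eth.
by rewrite mulr0 subr0 relu_id.
Qed.

Lemma bit_at_code bits q : (q < Q)%N -> bit_at (code bits) q = (bits q)%:R.
Proof.
move=> qQ; rewrite /bit_at rest_code ?(ltnW qQ) //.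
have tl := @code_tail_le bits q.+1 qQ.
have t0 : 0 <= \sum_(q.+1 <= k < Q) (bits k)%:R * thr k.
  by apply: sumr_ge0 => k _; rewrite mulr_ge0 // exprn_ge0.
have eth : thr q = 2 ^+ (Q - q.+1) by rewrite /thr; congr (_ ^+ _); lia.
rewrite (big_ltn qQ); case: (bits q) => /=; rewrite ?mul1r ?mul0r ?add0r.
  by rewrite top_bit_hi ?lerDl.
by rewrite top_bit_lo // eth.
Qed.

Lemma bit_at0 q : (q < Q)%N -> bit_at 0 q = 0.
Proof.
move=> qQ; have e : code (fun=> false) = 0.
  by rewrite /code big1 // => k _; rewrite mul0r.
by rewrite -{1}e bit_at_code.
Qed.

End BitExtraction.

(** * Decoding one block of nodal values *)

Section Decoder.
Variables (R : realType) (m B : nat).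

(** For [x] in [[0, 1]] and a digit [d], the product [x d] is [relu (x + d - 1)]; this is how a
    digit multiplies a hat function. Item [k] is digit [k %% B] of node [k %/ B]. Node [j] sits at
    position [j + 1], so that positions up to 0 meet no hat. *)
Definition item_val (c s : R) (k : nat) : R :=
  2 ^- (k %% B).+1 *
  relu (bump_at s (k %/ B)%N.+1%:R + bit_at (m * B) c k - 1).

Definition decoded (c s : R) (q : nat) : R := \sum_(0 <= k < q) item_val c s k.

Lemma item_val_ge0 c s k : 0 <= item_val c s k.
Proof. by rewrite mulr_ge0 ?relu_ge0 // invr_ge0 exprn_ge0. Qed.

Lemma decoded_ge0 c s q : 0 <= decoded c s q.
Proof. by apply: sumr_ge0 => k _; apply: item_val_ge0. Qed.

Lemma item_val_out c s k : bump_at s (k %/ B)%N.+1%:R = 0 -> item_val c s k = 0.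
Proof.
move=> h; rewrite /item_val h relu_le0 ?mulr0 //.
by have /andP[_] := top_bit_itv (thr R (m * B) k) (rest (m * B) c k); rewrite -/(bit_at _ _ _); lra.
Qed.

Lemma decoded_code0 s : decoded 0 s (m * B) = 0.
Proof.
rewrite /decoded big_nat big1 // => k /andP[_ kQ].
rewrite /item_val bit_at0 // relu_le0 ?mulr0 //.
by have /andP[_ ] := bump_at_itv s (k %/ B)%N.+1%:R; lra.
Qed.

(** Holds for every real [c], also for a code that is only partly switched on. With [decoded_code0],
    a block is silent as soon as its position or its code is off, and the two may switch at
    different places. *)
Lemma decoded_out c s : s <= 0 \/ m%:R + 1 <= s -> decoded c s (m * B) = 0.
Proof.
move=> h; rewrite /decoded big_nat big1 // => k /andP[_ kQ].
have kB : (k %/ B < m)%N by rewrite ltn_divLR //; case: (B) kQ => [|//]; rewrite muln0.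
apply: item_val_out; apply: bump_at_out.
have e1 : (k %/ B)%N.+1%:R <= m%:R :> R by rewrite ler_nat.
have e2 : 1 <= (k %/ B)%N.+1%:R :> R by rewrite ler1n.
by case: h => h; [left|right]; lra.
Qed.

Lemma sum_nat_mul (F : nat -> R) :
  \sum_(0 <= k < m * B) F k = \sum_(0 <= j < m) \sum_(0 <= b < B) F (j * B + b)%N.
Proof.
elim: m => [|p IH]; first by rewrite mul0n !big_geq.
rewrite big_nat_recr //= -IH mulSnr.
rewrite (@big_cat_nat _ _ _ (p * B)) ?leq_addr //=; congr (_ + _).
rewrite -{1}[(p * B)%N]add0n big_addn addKn.
by apply: eq_bigr => b _; rewrite addnC.
Qed.

Lemma decoded_code bits s : decoded (code R (m * B) bits) s (m * B) =
  \sum_(0 <= j < m) (\sum_(0 <= b < B) 2 ^- b.+1 * (bits (j * B + b)%N)%:R)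
     * bump_at s j.+1%:R.
Proof.
rewrite /decoded sum_nat_mul big_nat [RHS]big_nat.
apply: eq_bigr => j /andP[_ jm]; rewrite mulr_suml big_nat [RHS]big_nat.
apply: eq_bigr => b /andP[_ bB]; rewrite /item_val.
have B0 : (0 < B)%N by apply: leq_ltn_trans bB.
rewrite divnMDl // modnMDl divn_small // addn0 modn_small //.
rewrite bit_at_code; last first.
  by apply: (@leq_trans (j.+1 * B)); rewrite ?leq_pmul2r // mulSn addnC ltn_add2r.
have /andP[h0 h1] := bump_at_itv s j.+1%:R; rewrite -mulrA.
case: (bits _) => /=; first by rewrite addrK mul1r relu_id.
by rewrite addr0 mul0r relu_le0 // subr_le0.
Qed.

Variable D : R -> Prop.

(** The nine neurons of the first layer carry the four state variables, the two ReLUs of [top_bit]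
    and the three of [bump_at]. The second layer forms the next remainder and the gated hat, the
    third adds the latter to the accumulator. [T] is kept for a later pass, and [O] is what was
    accumulated before. *)
Lemma prog_item (T O C S : R -> R) q : (q < m * B)%N ->
  (forall x, D x -> [/\ 0 <= T x, 0 <= O x, 0 <= C x & 0 <= S x]) ->
  prog D 4 4 3
    (fun x => [:: T x; O x + decoded (C x) (S x) q; rest (m * B) (C x) q; S x])
    (fun x => [:: T x; O x + decoded (C x) (S x) q.+1; rest (m * B) (C x) q.+1; S x]).
Proof.
move=> qQ nn; set th := thr R (m * B) q; set p : R := (q %/ B)%N.+1%:R.
pose o x := O x + decoded (C x) (S x) q.
pose c x := rest (m * B) (C x) q.
have onn x : D x -> 0 <= o x.
  by move=> /nn[_ ? _ _]; rewrite addr_ge0 // decoded_ge0.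
have cnn x : D x -> 0 <= c x by move=> /nn[_ _ ? _]; apply: rest_ge0.
pose f1 x := [:: T x; o x; c x; S x; relu (c x - th + 1); relu (c x - th);
   relu (S x - p + 1); relu (S x - p); relu (S x - p - 1)].
pose f2 x := [:: T x; o x; relu (c x - th * top_bit th (c x)); S x;
   relu (bump_at (S x) p + top_bit th (c x) - 1)].
apply: (@prog_trans _ _ 9 _ _ 1 2 _ f1).
  apply: (@prog_layer _ _ 4 [:: ([:: 1], 0); ([:: 0; 1], 0); ([:: 0; 0; 1], 0);
    ([:: 0; 0; 0; 1], 0); ([:: 0; 0; 1], 1 - th); ([:: 0; 0; 1], - th);
    ([:: 0; 0; 0; 1], 1 - p); ([:: 0; 0; 0; 1], - p); ([:: 0; 0; 0; 1], - p - 1)]) => // x Dx.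
  split=> //=; have [? ? ? ?] := nn x Dx; have ? := onn x Dx; have ? := cnn x Dx.
  rewrite !mul0r !mul1r !add0r !addr0 (relu_id (y := T x)) // (relu_id (y := o x)) //.
  rewrite (relu_id (y := S x)) // (relu_id (y := c x)) // /f1.
  by congr [:: _; _; _; _; _; _; _; _; _]; congr relu; rewrite /c; ring.
apply: (@prog_trans _ _ 5 _ _ 1 1 _ f2).
  apply: (@prog_layer _ _ 9 [:: ([:: 1], 0); ([:: 0; 1], 0);
    ([:: 0; 0; 1; 0; - th; th], 0); ([:: 0; 0; 0; 1], 0);
    ([:: 0; 0; 0; 0; 1; -1; 1; -2; 1], -1)]) => // x Dx.
  split=> //=; have [? ? ? ?] := nn x Dx; have ? := onn x Dx; have ? := cnn x Dx.
  rewrite !mul0r !mul1r !add0r !addr0 (relu_id (y := T x)) // (relu_id (y := o x)) //.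
  rewrite (relu_id (y := S x)) // /f2 /bump_at /top_bit.
  by congr [:: _; _; _; _; _]; congr relu; rewrite /c; ring.
apply: (@prog_layer _ _ 5 [:: ([:: 1], 0); ([:: 0; 1; 0; 0; 2 ^- (q %% B).+1], 0);
    ([:: 0; 0; 1], 0); ([:: 0; 0; 0; 1], 0)]) => // x Dx.
split=> //=; have [? ? ? ?] := nn x Dx; have ? := onn x Dx; have ? := cnn x Dx.
have e : o x + 2 ^- (q %% B).+1 * relu (bump_at (S x) p + top_bit th (c x) - 1) =
   O x + decoded (C x) (S x) q.+1.
  by rewrite /o -addrA; congr (_ + _); rewrite [RHS]/decoded big_nat_recr.
rewrite !mul0r !mul1r !add0r !addr0 (relu_id (y := T x)) // (relu_id (y := S x)) // e.
rewrite (relu_id (y := O x + _)) ?(relu_id (y := relu _)) ?relu_ge0 //.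
by rewrite addr_ge0 // decoded_ge0.
Qed.

Lemma prog_decode (T O C S : R -> R) :
  (forall x, D x -> [/\ 0 <= T x, 0 <= O x, 0 <= C x & 0 <= S x]) ->
  prog D 4 2 (m * B * 3 + 1)
    (fun x => [:: T x; O x; C x; S x])
    (fun x => [:: T x; O x + decoded (C x) (S x) (m * B)]).
Proof.
move=> nn.
have h := @prog_iter _ D 4 3 (m * B) (fun q x =>
  [:: T x; O x + decoded (C x) (S x) q; rest (m * B) (C x) q; S x])
  (fun q qQ => prog_item qQ nn).
apply: (prog_trans (b := 4) (g := fun x => [:: T x; O x + decoded (C x) (S x) (m * B);
   rest (m * B) (C x) (m * B); S x])).
  have [ls [h1 h2 h3 h4]] := h; exists ls; split => // x /h4 <- /=.
  by rewrite /decoded big_geq // addr0.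
apply: (@prog_layer _ _ 4 [:: ([:: 1], 0); ([:: 0; 1], 0)]) => // x Dx.
have [? ? ? ?] := nn x Dx; split => //=.
rewrite !mul0r !mul1r !add0r !addr0 !relu_id // addr_ge0 // decoded_ge0 //.
Qed.

End Decoder.

(** * Selecting the block that contains the input *)

Section Pass.
Variables (R : realType) (m B a0 P : nat) (bits : nat -> nat -> bool).
Hypothesis mP : (m + 4 <= P)%N.

Definition start (i : nat) : R := (a0 + i * P)%:R.

(* Where [gate] is strictly between 0 and 1 the position lies outside [(0, m + 1)],
   so the meaningless code is not seen by the decoder; the position is moved to the
   next block by [ramp] where the code is 0. *)
Definition gate (i : nat) (t : R) : R :=
  relu (1 - relu (start i - 1 - t) - relu (t - start i - m%:R)).

Definition ramp (i : nat) (t : R) : R :=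
  relu (t - start i - m%:R - 1) - relu (t - start i - m%:R - 2).

Fixpoint block_code (i : nat) (t : R) : R :=
  if i is i'.+1 then block_code i' t + code R (m * B) (bits i') * gate i' t
  else 0.

(** Scaled so that node 0 of the current block has position 1; each block that lies entirely to the
    left of [t] shifts the position by the period [P]. *)
Fixpoint block_pos (i : nat) (t : R) : R :=
  if i is i'.+1 then relu (block_pos i' t - P%:R * ramp i' t)
  else relu (t - start 0 + 1).

Lemma block_pos_ge0 i t : 0 <= block_pos i t.
Proof. by case: i => [|i]; apply: relu_ge0. Qed.

Lemma block_code_ge0 i t : 0 <= block_code i t.
Proof.
elim: i => [//|i IH] /=.
by rewrite addr_ge0 // mulr_ge0 ?code_ge0 ?relu_ge0.
Qed.

Definition node_val (i j : nat) : R :=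
  \sum_(0 <= b < B) 2 ^- b.+1 * (bits i (j * B + b)%N)%:R.

Definition block_sum (i : nat) (t : R) : R :=
  \sum_(0 <= j < m) node_val i j * bump_at t (start i + j%:R).

Definition pass_sum (n : nat) (t : R) : R := \sum_(0 <= i < n) block_sum i t.

Lemma startS i : start i.+1 = start i + P%:R.
Proof. by rewrite /start mulSnr addnA natrD. Qed.

Lemma block_sum_out i t : t <= start i - 1 \/ start i + m%:R <= t ->
  block_sum i t = 0.
Proof.
move=> h; rewrite /block_sum big_nat big1 // => j /andP[_ jm].
rewrite bump_at_out ?mulr0 //.
have j1 : j%:R + 1 <= m%:R :> R by rewrite natr1 ler_nat.
have j0 : 0 <= j%:R :> R by [].
by case: h => h; [left|right]; lra.
Qed.

(** The invariant of the selection. Right of [start i - 2], where [gate i] begins to rise, the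
    processed blocks have left no trace; left of it, what the decoder sees is final. The last
    switching of block [i] ends at [start i + m + 2], where [ramp i] reaches 1, and [m + 4 <= P]
    puts this at or before [start i.+1 - 2]. *)
Lemma block_state i t :
  (start i - 2 <= t -> [/\ block_code i t = 0,
     block_pos i t = relu (t - start i + 1) & pass_sum i t = 0]) /\
  (t < start i - 2 -> decoded m B (block_code i t) (block_pos i t) (m * B) =
     pass_sum i t).
Proof.
have mPR : m%:R + 4 <= P%:R :> R by rewrite -natrD ler_nat.
have m0 : 0 <= m%:R :> R by [].
elim: i => [|i [IH1 IH2]] /=.
  rewrite /pass_sum; split => _; rewrite !big_geq //; exact: decoded_code0.
have psS : pass_sum i.+1 t = pass_sum i t + block_sum i t.
  by rewrite /pass_sum big_nat_recr.
rewrite startS psS.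
have [lt|ge] := ltP t (start i - 2).
  split => [h|_]; first by lra.
  rewrite /gate (relu_le0 (y := t - start i - m%:R)); last lra.
  rewrite (relu_id (y := start i - 1 - t)); last lra.
  rewrite (relu_le0 (y := 1 - _ - _)); last lra.
  rewrite /ramp !(relu_le0 (y := t - start i - m%:R - _)); try lra.
  rewrite subr0 !mulr0 addr0 subr0 relu_id ?block_pos_ge0 // IH2 //.
  by rewrite block_sum_out ?addr0 //; left; lra.
have {IH1 IH2}[-> -> ->] := IH1 ge; rewrite !add0r.
have [t1|t1] := ltP t (start i + m%:R + 1).
  split => [h|_]; first by lra.
  rewrite /ramp !(relu_le0 (y := t - start i - m%:R - _)); try lra.
  rewrite subr0 mulr0 subr0 (relu_id (y := relu _)) ?relu_ge0 //.
  have [t2|t2] := ltP t (start i - 1).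
    rewrite (relu_le0 (y := t - start i + 1)); last lra.
    by rewrite decoded_out ?block_sum_out //; left; lra.
  rewrite (relu_id (y := t - start i + 1)); last lra.
  have [t3|t3] := leP (start i + m%:R) t.
    by rewrite decoded_out ?block_sum_out //; right; lra.
  (* Only for [start i - 1 <= t < start i + m] can the decoder answer with a nonzero value, and
     there the gate equals 1, so the code is exact. *)
  rewrite /gate (relu_le0 (y := start i - 1 - t)); last lra.
  rewrite (relu_le0 (y := t - start i - m%:R)); last lra.
  rewrite !subr0 relu_id ?ler01 // mulr1 decoded_code.
  apply: eq_bigr => j _; congr (_ * _).
  have -> : t - start i + 1 = t - (start i - 1) by ring.
  by rewrite bump_at_shift -natr1; congr bump_at; ring.
have g0 : gate i t = 0.
  rewrite /gate (relu_le0 (y := start i - 1 - t)); last lra.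
  rewrite (relu_id (y := t - start i - m%:R)); last lra.
  by rewrite relu_le0; last lra.
rewrite g0 mulr0 block_sum_out; last by right; lra.
split => [h|h]; last exact: decoded_code0.
split => //; rewrite /ramp !(relu_id (y := t - start i - m%:R - _)); try lra.
rewrite (relu_id (y := t - start i + 1)); last lra.
by congr relu; ring.
Qed.

Lemma decoded_pass n t :
  decoded m B (block_code n t) (block_pos n t) (m * B) = pass_sum n t.
Proof.
have [h1 h2] := block_state n t.
have [/h2 //|/h1[-> _ ->]] := ltP t (start n - 2).
exact: decoded_code0.
Qed.

Variable D : R -> Prop.

Lemma prog_block (T O : R -> R) i :
  (forall x, D x -> 0 <= T x /\ 0 <= O x) ->
  prog D 4 4 3
    (fun x => [:: T x; O x; block_code i (T x); block_pos i (T x)])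
    (fun x => [:: T x; O x; block_code i.+1 (T x); block_pos i.+1 (T x)]).
Proof.
move=> nn; pose c x := block_code i (T x); pose s x := block_pos i (T x).
have cn x : 0 <= c x by apply: block_code_ge0.
have sn x : 0 <= s x by apply: block_pos_ge0.
pose a := start i.
pose f1 x := [:: T x; O x; c x; s x; relu (a - 1 - T x); relu (T x - a - m%:R);
  relu (T x - a - m%:R - 1); relu (T x - a - m%:R - 2)].
pose f2 x := [:: T x; O x; c x; block_pos i.+1 (T x); gate i (T x)].
apply: (@prog_trans _ _ 8 _ _ 1 2 _ f1).
  apply: (@prog_layer _ _ 4 [:: ([:: 1], 0); ([:: 0; 1], 0); ([:: 0; 0; 1], 0);
    ([:: 0; 0; 0; 1], 0); ([:: -1], a - 1); ([:: 1], - a - m%:R);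
    ([:: 1], - a - m%:R - 1); ([:: 1], - a - m%:R - 2)]) => // x Dx.
  have [? ?] := nn x Dx; split=> //=.
  rewrite !mul0r !mul1r !add0r !addr0 -/(c x) -/(s x) (relu_id (y := T x)) //.
  rewrite (relu_id (y := O x)) // (relu_id (y := s x)) // (relu_id (y := c x)) //.
  by congr [:: _; _; _; _; _; _; _; _]; congr relu; ring.
apply: (@prog_trans _ _ 5 _ _ 1 1 _ f2).
  apply: (@prog_layer _ _ 8 [:: ([:: 1], 0); ([:: 0; 1], 0); ([:: 0; 0; 1], 0);
    ([:: 0; 0; 0; 1; 0; 0; - P%:R; P%:R], 0); ([:: 0; 0; 0; 0; -1; -1], 1)]) => // x Dx.
  have [? ?] := nn x Dx; split=> //=.
  rewrite !mul0r !mul1r !add0r !addr0 (relu_id (y := T x)) //.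
  rewrite (relu_id (y := O x)) // (relu_id (y := c x)) // /f2 /gate /= /ramp -/(s x) -/a.
  by congr [:: _; _; _; _; _]; congr relu; ring.
apply: (@prog_layer _ _ 5 [:: ([:: 1], 0); ([:: 0; 1], 0);
  ([:: 0; 0; 1; 0; code R (m * B) (bits i)], 0); ([:: 0; 0; 0; 1], 0)]) => // x Dx.
have [? ?] := nn x Dx; split=> //=.
rewrite !mul0r !mul1r !add0r !addr0 (relu_id (y := T x)) // (relu_id (y := O x)) //.
rewrite (relu_id (y := relu _)) ?relu_ge0 // (relu_id (y := c x + _)) //.
exact: (block_code_ge0 i.+1).
Qed.

(** All blocks are scanned before any digit is extracted, so the cost is [n] selections plus a
    single decoding: of order [n + m * B] layers rather than [n * m * B]. This is small when [n] and
    [m] are both of order [sqrt K]. *)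
Lemma prog_pass (T O : R -> R) n :
  (forall x, D x -> 0 <= T x /\ 0 <= O x) ->
  prog D 2 2 (1 + (n * 3 + (m * B * 3 + 1)))
    (fun x => [:: T x; O x]) (fun x => [:: T x; O x + pass_sum n (T x)]).
Proof.
move=> nn.
apply: (@prog_trans _ _ 4 _ _ _ _ _
  (fun x => [:: T x; O x; block_code 0 (T x); block_pos 0 (T x)])).
  apply: (@prog_layer _ _ 2 [:: ([:: 1], 0); ([:: 0; 1], 0); ([::], 0);
    ([:: 1], 1 - start 0)]) => // x Dx.
  have [? ?] := nn x Dx; split=> //=.
  rewrite !mul0r !mul1r !add0r !addr0 (relu_id (y := T x)) // (relu_id (y := O x)) //.
  by rewrite (relu_id (y := 0)) //; congr [:: _; _; _; _]; congr relu; ring.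
apply: (@prog_trans _ _ 4 _ _ _ _ _
  (fun x => [:: T x; O x; block_code n (T x); block_pos n (T x)])).
  by apply: (@prog_iter _ D 4 3 n
    (fun i x => [:: T x; O x; block_code i (T x); block_pos i (T x)])) => i _;
    apply: prog_block.
have [ls [h1 h2 h3 h4]] := @prog_decode _ m B D T O
  (fun x => block_code n (T x)) (fun x => block_pos n (T x))
  (fun x Dx => let: conj t0 o0 := nn x Dx in
     And4 t0 o0 (block_code_ge0 n (T x)) (block_pos_ge0 n (T x))).
by exists ls; split => // x Dx; rewrite h4 // decoded_pass.
Qed.

End Pass.

(** * The network that computes a quantized interpolant *)

Section InterpolationNetwork.
Variables (R : realType) (B : nat) (nb : nat -> nat -> bool).

Definition nodal (k : nat) : R := \sum_(0 <= b < B) 2 ^- b.+1 * (nb k b)%:R.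

Definition interp (N : nat) (t : R) : R :=
  \sum_(0 <= k < N) nodal k * bump_at t k%:R.

Lemma interpE N k t : (k.+1 < N)%N -> k%:R <= t <= k.+1%:R ->
  interp N t = nodal k * (k%:R + 1 - t) + nodal k.+1 * (t - k%:R).
Proof.
move=> kN /andP[kt tk]; rewrite -natr1 in tk.
have dj (A A' : nat) : (A < A')%N -> A%:R + 1 <= A'%:R :> R.
  by move=> ?; rewrite natr1 ler_nat.
rewrite /interp (@big_cat_nat _ _ _ k) //=; last by rewrite ltnW // ltnW.
rewrite big_nat big1 ?add0r; last first.
  move=> i /andP[_ ik]; rewrite bump_at_out ?mulr0 //; right.
  by have := dj _ _ ik; lra.
rewrite big_ltn ?(ltnW kN) // big_ltn // big_nat big1 ?addr0; last first.
  move=> i /andP[ik _]; rewrite bump_at_out ?mulr0 //; left.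
  by have := dj _ _ ik; rewrite -natr1; lra.
rewrite bump_at_r; last lra.
by rewrite bump_at_l -?natr1; last lra; congr (_ + _ * _); ring.
Qed.

(** Neighbouring blocks touch, while a pass requires [m + 4 <= P]. Taking every second block gives
    the period [2 * m], which is large enough for [4 <= m]; the even ([q = 0]) and the odd ([q = 1])
    blocks together give the whole interpolant. *)
Lemma pass_split m n t : (0 < B)%N ->
  let r (q : nat) i k := nb ((2 * i + q) * m + k %/ B)%N (k %% B)%N in
  pass_sum m B 0 (2 * m) (r 0%N) n t + pass_sum m B m (2 * m) (r 1%N) n t =
  interp (2 * n * m) t.
Proof.
move=> B0 r; rewrite /interp sum_nat_mul (mulnC 2 n) sum_nat_mul.
rewrite /pass_sum -big_split /=; apply: eq_bigr => i _.
rewrite big_nat_recr // big_nat1 /=.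
have H q : (q < 2)%N -> block_sum m B (q * m) (2 * m) (r q) i t =
  \sum_(0 <= j < m) nodal ((i * 2 + q) * m + j) *
         bump_at t ((i * 2 + q) * m + j)%:R.
  move=> q2; apply: eq_bigr => j _; congr (_ * bump_at _ _).
    rewrite /node_val /nodal big_nat [RHS]big_nat.
    apply: eq_bigr => b /andP[_ bB]; rewrite /r divnMDl // modnMDl.
    by rewrite divn_small // addn0 modn_small // (mulnC 2 i).
  by rewrite /start -natrD; congr _%:R; lia.
by rewrite -H // -H // mul0n mul1n.
Qed.

Lemma layer_nnz_narrow (l : layer R) : narrow l -> (layer_nnz l <= 90)%N.
Proof.
move=> /andP[h1 h2]; rewrite /layer_nnz.
apply: (@leq_trans (ldout l * ldin l + ldout l)); last by nia.
apply: leq_add.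
  by apply: leq_trans (max_card _) _; rewrite card_prod !card_ord.
by apply: leq_trans (max_card _) _; rewrite card_ord.
Qed.

(** A piecewise linear change of variables with kinks at [o1], [o2], [o3], later chosen to send the
    nodes of the mesh to the integers. *)
Definition warp (c1 c2 c3 o1 o2 o3 x : R) : R :=
  c1 * relu (x - o1) + c2 * relu (x - o2) + c3 * relu (x - o3).

Lemma interp_network m c1 c2 c3 o1 o2 o3 (scale shift : R) :
  (0 < B)%N -> (4 <= m)%N -> scale != 0 ->
  exists Phi : network R,
    [/\ net_wf Phi, (width Phi <= 9)%N, (depth Phi <= 18 * (m * B))%N,
        (0 < net_size Phi <= 90 * (18 * (m * B)))%N &
     forall x, 0 <= warp c1 c2 c3 o1 o2 o3 x ->
       realization Phi x =
         scale * interp (2 * m * m) (warp c1 c2 c3 o1 o2 o3 x) + shift].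
Proof.
move=> B0 m4 sc0; set T := warp c1 c2 c3 o1 o2 o3.
pose D x := 0 <= T x.
pose r (q : nat) i k := nb ((2 * i + q) * m + k %/ B)%N (k %% B)%N.
have mP : (m + 4 <= 2 * m)%N by lia.
pose O1 x := pass_sum m B 0 (2 * m) (r 0%N) m (T x) : R.
have ps0 q t : 0 <= pass_sum m B q (2 * m) (r 0%N) m t :> R.
  apply: sumr_ge0 => i _; apply: sumr_ge0 => j _; rewrite mulr_ge0 //.
    by apply: sumr_ge0 => b _; rewrite mulr_ge0 // invr_ge0 exprn_ge0.
  by have /andP[] := bump_at_itv t (start R q (2 * m) i + j%:R).
have P1 : prog D 1 2 2 (fun x => [:: x]) (fun x => [:: T x; 0]).
  apply: (@prog_trans _ _ 3 _ _ 1 1 _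
    (fun x => [:: relu (x - o1); relu (x - o2); relu (x - o3)])).
    apply: (@prog_layer _ _ 1 [:: ([:: 1], - o1); ([:: 1], - o2); ([:: 1], - o3)]) => // x Dx.
    by split => //=; rewrite !mul1r !addr0.
  apply: (@prog_layer _ _ 3 [:: ([:: c1; c2; c3], 0); ([::], 0)]) => // x Dx.
  split => //=; rewrite !addr0 addrA -[c1 * _ + _ + _]/(T x).
  by rewrite (relu_id (y := T x)) // (relu_id (y := 0)).
have P2 := @prog_pass R m B 0 (2 * m) (r 0%N) mP D T (fun=> 0) m (fun x Dx => conj Dx (lexx 0)).
have P3 := @prog_pass R m B m (2 * m) (r 1%N) mP D T (fun x => 0 + O1 x) m
  (fun x Dx => conj Dx (eq_ind_r (fun z => 0 <= z) (ps0 0%N (T x)) (add0r _))).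
have [ls [ch sz nw rn]] := prog_trans P1 (prog_trans P2 P3).
(* The output layer undoes the normalization of the nodal values to [[0, 1]]. Its nonzero entry
   [scale] makes the size positive, as [size_rate] requires. *)
pose l := mk_layer 2 [:: ([:: 0; scale], shift)].
have nwl : all (@narrow R) (rcons ls l) by rewrite all_rcons nw.
(* The depth is [7 + 6 * m + 6 * m * B]: two layers for the warp, two passes and the output
   layer. *)
have dle : (size (rcons ls l) <= 18 * (m * B))%N.
  by rewrite size_rcons sz; nia.
exists (rcons ls l); split => //.
- have e : chain 1 (rcons ls l) 1.
    by rewrite -cats1; apply: chain_cat ch _; rewrite /= !eqxx.
  have sorted_chain a (k : seq (layer R)) b : chain a k b -> (0 < size k)%N ->
     [&& ldin (head l k) == a, ldout (last l k) == b &
       sorted (fun l1 l2 : layer R => ldout l1 == ldin l2) k].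
    elim: k a => [//|k0 k IH] a /= /andP[/eqP <- hk] _; rewrite eqxx /=.
    case: k IH hk => [|k1 k] IH hk; first by move: hk => /= ->.
    have /and3P[h1 h2 h3] := IH _ hk isT.
    by move: h1 h2 h3 => /= /eqP -> -> ->; rewrite eqxx.
  have := sorted_chain _ _ _ e; rewrite size_rcons /= => /(_ isT).
  rewrite /net_wf; case: (rcons ls l) => [//|k0 k] /=.
  by [].
- rewrite /width; elim: (rcons ls l) nwl => [|k0 k IH] /=; first by rewrite big_nil.
  by move=> /andP[/andP[_ h1] h2]; rewrite big_cons geq_max h1 IH.
- apply/andP; split.
    rewrite /net_size -cats1 big_cat big_seq1 /= addnC ltn_addr //.
    rewrite /layer_nnz ltn_addr //; apply/card_gt0P.
    by exists (ord0, lift ord0 ord0); rewrite inE /= mxE.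
  apply: leq_trans (leq_mul (leqnn 90) dle).
  rewrite /net_size; elim: (rcons ls l) nwl => [|k0 k IH] /=; first by rewrite big_nil.
  by move=> /andP[h1 h2]; rewrite big_cons mulnS leq_add ?IH // layer_nnz_narrow.
- move=> x Dx; rewrite /realization realize_rcons rn // affine_mk_layer //=.
  by rewrite mul0r add0r addr0 -pass_split // add0r.
Qed.

End InterpolationNetwork.

(** * Absolutely continuous functions on an interval *)

Section IntervalIntegrals.
Variable R : realType.
Implicit Types (a b c x : R) (f g u v : R -> R).
Local Notation mu := (@lebesgue_measure R).

Definition L1 a b f : Prop := mu.-integrable `[a, b] (EFin \o f).
Definition itg a b f : R := \int[mu]_(x in `[a, b]) f x.
Definition meas a b f : Prop := measurable_fun (`[a, b] : set R) f.

Lemma L1_meas a b f : L1 a b f -> meas a b f.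
Proof. by move=> /integrableP[h _]; exact/measurable_EFinP. Qed.

Lemma L1_dom a b f g : meas a b f ->
  (forall x, a <= x <= b -> `|f x| <= g x) -> L1 a b g -> L1 a b f.
Proof.
move=> mf fg ig; apply: (le_integrable _ _ _ ig) => //.
  exact/measurable_EFinP.
by move=> x /= xab; rewrite lee_fin (le_trans (fg x _)) ?ler_norm.
Qed.

Lemma L1_ext a b f g : (forall x, a <= x <= b -> f x = g x) ->
  L1 a b f -> L1 a b g.
Proof.
move=> fg; apply: eq_integrable => // x; rewrite inE /= in_itv /= => h.
by rewrite /= fg.
Qed.

Lemma L1_sub a b c d f : a <= c -> d <= b -> L1 a b f -> L1 c d f.
Proof.
move=> ac db; apply: integrableS => // x /=; rewrite !in_itv /=.
by move=> /andP[h1 h2]; rewrite (le_trans ac) // (le_trans h2).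
Qed.

Lemma L1D a b f g : L1 a b f -> L1 a b g -> L1 a b (fun x => f x + g x).
Proof. by move=> hf hg; exact: (integrableD _ hf hg). Qed.

Lemma L1Z a b k f : L1 a b f -> L1 a b (fun x => k * f x).
Proof. by move=> hf; exact: (integrableZl _ k hf). Qed.

Lemma L1B a b f g : L1 a b f -> L1 a b g -> L1 a b (fun x => f x - g x).
Proof. by move=> hf hg; exact: (integrableB _ hf hg). Qed.

Lemma L1_norm a b f : L1 a b f -> L1 a b (fun x => `|f x|).
Proof. exact: integrable_norm. Qed.

Lemma L1_cst a b k : L1 a b (fun=> k).
Proof.
apply: continuous_compact_integrable; first exact: segment_compact.
by apply: continuous_subspaceT => x; exact: cvg_cst.
Qed.

Lemma itg_eq a b f g : (forall x, a <= x <= b -> f x = g x) ->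
  itg a b f = itg a b g.
Proof.
by move=> fg; apply: eq_Rintegral => x; rewrite inE /= in_itv /= => /fg.
Qed.

Lemma itgD a b f g : L1 a b f -> L1 a b g ->
  itg a b (fun x => f x + g x) = itg a b f + itg a b g.
Proof. by move=> hf hg; apply: RintegralD. Qed.

Lemma itgB a b f g : L1 a b f -> L1 a b g ->
  itg a b (fun x => f x - g x) = itg a b f - itg a b g.
Proof. by move=> hf hg; apply: RintegralB. Qed.

Lemma itgZ a b k f : L1 a b f -> itg a b (fun x => k * f x) = k * itg a b f.
Proof. by move=> hf; apply: RintegralZl. Qed.

Lemma itg_le a b f g : L1 a b f -> L1 a b g ->
  (forall x, a <= x <= b -> f x <= g x) -> itg a b f <= itg a b g.
Proof.
by move=> hf hg fg; apply: le_Rintegral => // x /=; rewrite in_itv /= => /fg.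
Qed.

Lemma itg_ge0 a b f : (forall x, a <= x <= b -> 0 <= f x) -> 0 <= itg a b f.
Proof. by move=> f0; apply: Rintegral_ge0 => x /=; rewrite in_itv /= => /f0. Qed.

Lemma itg_norm a b f : L1 a b f -> `|itg a b f| <= itg a b (fun x => `|f x|).
Proof. by move=> hf; apply: le_normr_Rintegral. Qed.

Lemma itg_cst a b k : a <= b -> itg a b (fun=> k) = k * (b - a).
Proof.
move=> ab; rewrite /itg Rintegral_cst //= lebesgue_measure_itv /= lte_fin.
case: ltP => [_|ba] //=.
by have -> : b = a; [apply/eqP; rewrite eq_le ba ab|rewrite subrr].
Qed.

Lemma itg_cat a b c f : a <= c -> c <= b -> L1 a b f ->
  itg a b f = itg a c f + itg c b f.
Proof.
move=> ac cb hf; rewrite /itg; have /= h := @Rintegral_itvB R f (BLeft a) (BRight b) c hf.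
rewrite -[X in _ = _ + X]Rintegral_itv_obnd_cbnd; last first.
  by apply: integrableS hf => // x /=; rewrite !in_itv /= => /andP[/ltW/(le_trans ac) -> ->].
by rewrite -h ?bnd_simp // addrC subrK.
Qed.

Lemma itg_pt a f : itg a a f = 0.
Proof. by rewrite /itg set_itv1 Rintegral_set1. Qed.

Lemma meas_D a b f g : meas a b f -> meas a b g -> meas a b (fun x => f x + g x).
Proof. exact: measurable_funD. Qed.

Lemma meas_M a b f g : meas a b f -> meas a b g -> meas a b (fun x => f x * g x).
Proof. exact: measurable_funM. Qed.

Lemma meas_cst a b k : meas a b (fun=> k).
Proof. exact: measurable_cst. Qed.

Lemma meas_sub a b c d f : a <= c -> d <= b -> meas a b f -> meas c d f.
Proof.
move=> ac db; apply: measurable_funS => // x /=; rewrite !in_itv /=.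
by move=> /andP[h1 h2]; rewrite (le_trans ac) // (le_trans h2).
Qed.

Definition L2 a b f : Prop := meas a b f /\ L1 a b (fun x => f x ^+ 2).

Lemma L2_sub a b c d f : a <= c -> d <= b -> L2 a b f -> L2 c d f.
Proof. by move=> ac db [h1 h2]; split; [apply: meas_sub h1|apply: L1_sub h2]. Qed.

Lemma L2M a b f g : L2 a b f -> L2 a b g -> L1 a b (fun x => f x * g x).
Proof.
move=> [mf hf] [mg hg]; apply: (L1_dom _ _ (L1D hf hg)); first exact: meas_M.
move=> x _; rewrite normrM -(real_normK (num_real (f x))) -(real_normK (num_real (g x))).
nra.
Qed.

Lemma L2_cst a b k : L2 a b (fun=> k).
Proof. by split; [exact: meas_cst|exact: L1_cst]. Qed.

Lemma L2_L1 a b f : L2 a b f -> L1 a b f.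
Proof.
move=> hf; apply: L1_ext (L2M hf (L2_cst a b 1)) => x _; exact: mulr1.
Qed.

Lemma L2Z a b k f : L2 a b f -> L2 a b (fun x => k * f x).
Proof.
move=> [mf hf]; split; first by apply: meas_M => //; exact: meas_cst.
by apply: L1_ext (L1Z (k ^+ 2) hf) => x _; rewrite exprMn.
Qed.

Lemma L2D a b f g : L2 a b f -> L2 a b g -> L2 a b (fun x => f x + g x).
Proof.
move=> hf hg; split; first by apply: meas_D; [case: hf|case: hg].
apply: L1_ext (L1D (L1D hf.2 (L1Z 2 (L2M hf hg))) hg.2) => x _; ring.
Qed.

Lemma L2_ext a b f g : (forall x, a <= x <= b -> f x = g x) ->
  L2 a b f -> L2 a b g.
Proof.
move=> fg [mf hf]; split; last by apply: L1_ext hf => x /fg ->.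
by apply: eq_measurable_fun mf => x; rewrite inE /= in_itv /= => /fg.
Qed.

Lemma L2B a b f g : L2 a b f -> L2 a b g -> L2 a b (fun x => f x - g x).
Proof.
move=> hf hg; apply: L2_ext (L2D hf (L2Z (-1) hg)) => x _; ring.
Qed.

Lemma L2_bnd a b M f : meas a b f -> (forall x, a <= x <= b -> `|f x| <= M) ->
  L2 a b f.
Proof.
move=> mf fM; split=> //; apply: (L1_dom _ _ (L1_cst a b (M ^+ 2))).
  by apply: (meas_M mf mf).
move=> x /fM h; rewrite normrX ler_pXn2r // nnegrE //.
exact: le_trans h.
Qed.

Lemma L2_bndM a b M f g : meas a b f -> (forall x, a <= x <= b -> `|f x| <= M) ->
  L2 a b g -> L2 a b (fun x => f x * g x).
Proof.
move=> mf fM [mg hg]; split; first exact: meas_M.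
apply: (L1_dom _ _ (L1Z (M ^+ 2) hg)).
  exact: meas_M (meas_M mf mg) (meas_M mf mg).
move=> x /fM h; rewrite normrX normrM exprMn [X in _ * X]real_normK ?num_real //.
apply: ler_wpM2r; first exact: sqr_ge0.
rewrite ler_pXn2r // nnegrE //; exact: le_trans h.
Qed.

(** Expand the nonnegative integral of [(|f| - k)^2], where [k] is the mean of [|f|]. The degenerate
    interval is separate because the mean divides by the length. *)
Lemma cauchy_schwarz1 a b f : a <= b -> L2 a b f ->
  itg a b (fun x => `|f x|) ^+ 2 <= (b - a) * itg a b (fun x => f x ^+ 2).
Proof.
move=> ab hf; have hf1 := L1_norm (L2_L1 hf).
move: ab; rewrite le_eqVlt => /predU1P[<-|ab].
  by rewrite !itg_pt mulr0 expr0n.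
set A := itg a b (fun x => `|f x|); pose k := A / (b - a).
have h0 : 0 <= itg a b (fun x => (`|f x| - k) ^+ 2).
  by apply: itg_ge0 => x _; apply: sqr_ge0.
have e : itg a b (fun x => (`|f x| - k) ^+ 2) =
   itg a b (fun x => f x ^+ 2) + (- (2 * k) * A + k ^+ 2 * (b - a)).
  rewrite -(itg_cst _ (ltW ab)) -itgZ // -itgD; [|exact: L1Z|exact: L1_cst].
  rewrite -itgD; [|exact: hf.2|by apply: L1D; [exact: L1Z|exact: L1_cst]].
  by apply: itg_eq => x _; rewrite -[f x ^+ 2]real_normK ?num_real //; ring.
have ba : 0 < b - a by rewrite subr_gt0.
have eA : A = k * (b - a) by rewrite /k divfK // gt_eqF.
rewrite e in h0; nra.
Qed.

(** The derivative is an argument because it is determined only almost everywhere. Requiring [u] to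
    be its primitive at every point selects the continuous representative, so that nodal and
    boundary values make sense; [u] itself is then in [L2] by [H1_L2]. *)
Definition H1 a b u g : Prop :=
  L2 a b g /\ forall x, a <= x <= b -> u x = u a + itg a x g.

Lemma H1_inc a b u g x y : H1 a b u g -> a <= x -> x <= y -> y <= b ->
  u y - u x = itg x y g.
Proof.
move=> [hg hu] ax xy yb.
rewrite hu ?yb ?(le_trans ax) // [u x]hu ?ax ?(le_trans xy) //.
rewrite (@itg_cat a y x) //; first by ring.
exact: L1_sub (L2_L1 hg).
Qed.

Lemma H1_sub a b c d u g : a <= c -> d <= b -> H1 a b u g -> H1 c d u g.
Proof.
move=> ac db hu; split; first by apply: L2_sub hu.1.
move=> x /andP[cx xd]; rewrite -(H1_inc hu ac cx) 1?addrC ?subrK //.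
exact: le_trans db.
Qed.

Lemma H1_holder a b u g x y : H1 a b u g -> a <= x -> x <= y -> y <= b ->
  (u y - u x) ^+ 2 <= (y - x) * itg x y (fun t => g t ^+ 2).
Proof.
move=> hu ax xy yb; have hg := L2_sub ax yb hu.1.
rewrite (H1_inc hu) //; apply: le_trans (cauchy_schwarz1 xy hg).
rewrite -[leLHS]real_normK ?num_real // ler_pXn2r ?nnegrE //.
  exact/itg_norm/L2_L1.
by apply: itg_ge0.
Qed.

Lemma itg_sub_le a b x y f : a <= x -> x <= y -> y <= b -> L1 a b f ->
  (forall t, a <= t <= b -> 0 <= f t) -> itg x y f <= itg a b f.
Proof.
move=> ax xy yb hf f0; rewrite (@itg_cat a b x) // ?(le_trans xy) //.
rewrite (@itg_cat x b y) //; last by apply: L1_sub hf.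
have h1 : 0 <= itg a x f.
  by apply: itg_ge0 => t /andP[h h']; apply: f0; rewrite h /= (le_trans h') // (le_trans xy).
have h2 : 0 <= itg y b f.
  by apply: itg_ge0 => t /andP[h h']; apply: f0; rewrite h' (le_trans ax) // (le_trans xy).
lra.
Qed.

Lemma H1_bound a b u g : a <= b -> H1 a b u g ->
  exists M, forall x, a <= x <= b -> `|u x| <= M.
Proof.
move=> ab hu; have ig := L2_L1 hu.1.
exists (`|u a| + itg a b (fun t => `|g t|)) => x /andP[ax xb].
rewrite hu.2 ?ax // (le_trans (ler_normD _ _)) // lerD2l.
apply: le_trans (itg_norm (L1_sub (lexx a) xb ig)) _.
by apply: itg_sub_le => //; exact: L1_norm.
Qed.

Lemma H1_cts a b u g : a <= b -> H1 a b u g ->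
  {within `[a, b], continuous u}.
Proof.
move=> ab hu.
have h := @parameterized_integral_continuous R a b g ab (L2_L1 hu.1).
have h2 : {within `[a, b], continuous (fun x => u a + itg a x g)}.
  by move=> x; apply: cvgD; [exact: cvg_cst|exact: h].
apply: (subspace_eq_continuous _ h2) => x; rewrite inE /= in_itv /= => xab.
exact/esym/(hu.2 x xab).
Qed.

Lemma H1_meas a b u g : a <= b -> H1 a b u g -> meas a b u.
Proof.
by move=> ab hu; apply: subspace_continuous_measurable_fun => //; exact: H1_cts hu.
Qed.

Lemma H1_L2 a b u g : a <= b -> H1 a b u g -> L2 a b u.
Proof.
by move=> ab hu; have [M hM] := H1_bound ab hu; apply: L2_bnd hM; exact: H1_meas hu.
Qed.

Lemma H1D a b u v g h : H1 a b u g -> H1 a b v h ->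
  H1 a b (fun x => u x + v x) (fun x => g x + h x).
Proof.
move=> hu hv; split; first exact: L2D hu.1 hv.1.
move=> x /andP[ax xb]; rewrite itgD; [|by apply: L1_sub (L2_L1 hu.1)|by apply: L1_sub (L2_L1 hv.1)].
by rewrite hu.2 ?ax // hv.2 ?ax //; ring.
Qed.

Lemma H1Z a b k u g : H1 a b u g -> H1 a b (fun x => k * u x) (fun x => k * g x).
Proof.
move=> hu; split; first exact: L2Z hu.1.
move=> x /andP[ax xb]; rewrite itgZ; last by apply: L1_sub (L2_L1 hu.1).
by rewrite hu.2 ?ax //; ring.
Qed.

Lemma H1B a b u v g h : H1 a b u g -> H1 a b v h ->
  H1 a b (fun x => u x - v x) (fun x => g x - h x).
Proof.
move=> hu hv; split; first exact: L2B hu.1 hv.1.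
move=> x /andP[ax xb]; rewrite itgB; [|by apply: L1_sub (L2_L1 hu.1)|by apply: L1_sub (L2_L1 hv.1)].
by rewrite hu.2 ?ax // hv.2 ?ax //; ring.
Qed.

Lemma H1_itg a b k g : L2 a b g -> H1 a b (fun x => k + itg a x g) g.
Proof. by move=> hg; split => // x _; rewrite itg_pt addr0. Qed.

Lemma H1_ext a b u v g h : (forall x, a <= x <= b -> u x = v x) ->
  (forall x, a <= x <= b -> g x = h x) -> H1 a b u g -> H1 a b v h.
Proof.
move=> uv gh [hg hu]; split; first exact: L2_ext hg.
move=> x /andP[ax xb]; rewrite -uv ?ax // hu ?ax // uv ?lexx ?(le_trans ax) //.
congr (_ + _); apply: itg_eq => t /andP[h1 h2]; apply: gh.
by rewrite h1 (le_trans h2).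
Qed.

Lemma H1_deriv a b (u g : R -> R) : (forall x, is_derive x 1 u (g x)) ->
  continuous g -> H1 a b u g.
Proof.
move=> du cg.
have cu : continuous u by move=> x; apply/differentiable_continuous/derivable1_diffP; case: (du x).
split.
  split; first by apply: measurable_funTS; exact: continuous_measurable_fun.
  apply: continuous_compact_integrable; first exact: segment_compact.
  by apply: continuous_subspaceT => x; apply: continuousM; exact: cg.
move=> x /andP[ax xb]; move: ax; rewrite le_eqVlt => /predU1P[<-|ax].
  by rewrite itg_pt addr0.
rewrite /itg /Rintegral (@continuous_FTC2 R g u) //=.
- by ring.
- exact: continuous_subspaceT.
- split; first by move=> t _; case: (du t).
  + by apply: cvg_at_right_filter; exact: cu.
  + by apply: cvg_at_left_filter; exact: cu.
- by move=> t _; rewrite derive1E; case: (du t).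
Qed.

End IntervalIntegrals.

(** * Product rule and integration by parts *)

Section ProductRule.
Variable R : realType.
Implicit Types (a b c x : R) (f g h u v : R -> R).

Lemma norm_le_sqr (z w : R) : 0 <= w -> z ^+ 2 <= w ^+ 2 -> `|z| <= w.
Proof.
move=> w0; rewrite -[z ^+ 2]real_normK ?num_real // ler_pXn2r ?nnegrE //.
Qed.

(* The product rule is obtained by summing this bound over the cells of a uniform
   partition, for which [w] tends to 0. *)
Lemma H1_prod_cell a b u v g h w : a <= b -> H1 a b u g -> H1 a b v h ->
  0 <= w -> (b - a) * (itg a b (fun t => g t ^+ 2) + itg a b (fun t => h t ^+ 2)) <= w ^+ 2 ->
  `|u b * v b - u a * v a - itg a b (fun t => u t * h t + v t * g t)|
    <= w * itg a b (fun t => `|g t| + `|h t|).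
Proof.
move=> ab hu hv w0 hw.
have [Mu hMu] := H1_bound ab hu; have [Mv hMv] := H1_bound ab hv.
have iuh : L1 a b (fun t => u t * h t) by apply/L2_L1/(L2_bndM (H1_meas ab hu) hMu hv.1).
have ivg : L1 a b (fun t => v t * g t) by apply/L2_L1/(L2_bndM (H1_meas ab hv) hMv hu.1).
have ig := L2_L1 hu.1; have ih := L2_L1 hv.1.
have g2 : 0 <= itg a b (fun t => g t ^+ 2) by apply: itg_ge0 => t _; apply: sqr_ge0.
have h2 : 0 <= itg a b (fun t => h t ^+ 2) by apply: itg_ge0 => t _; apply: sqr_ge0.
(* The increment of [u v] is split at mixed end points, as [v b (u b - u a) + u a (v b - v a)].
   After the subtraction each derivative is multiplied by an increment over a part of the cell,
   which [H1_holder] bounds by [w]. *)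
have e : u b * v b - u a * v a - itg a b (fun t => u t * h t + v t * g t) =
  itg a b (fun t => (v b * g t + u a * h t) - (u t * h t + v t * g t)).
  rewrite itgB; [|by apply: L1D; apply: L1Z|exact: L1D].
  rewrite (@itgD _ _ _ (fun t => v b * g t)); [|exact: L1Z|exact: L1Z].
  rewrite !itgZ // -(H1_inc hu) // -(H1_inc hv) //; ring.
rewrite e; apply: le_trans (itg_norm _) _.
  by apply: L1B; apply: L1D => //; apply: L1Z.
have iS : L1 a b (fun t => `|g t| + `|h t|) by apply: L1D; apply: L1_norm.
rewrite -itgZ //; apply: itg_le; [|exact: L1Z|].
  by apply/L1_norm/L1B; apply: L1D => //; apply: L1Z.
move=> t /andP[at_ tb].
have -> : v b * g t + u a * h t - (u t * h t + v t * g t) =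
  (v b - v t) * g t + (u a - u t) * h t by ring.
rewrite (le_trans (ler_normD _ _)) // mulrDr !normrM.
have tbba : b - t <= b - a by lra.
apply: lerD; apply: ler_wpM2r => //; apply: norm_le_sqr => //.
  apply: le_trans (H1_holder hv at_ tb (lexx b)) _; apply: le_trans hw.
  have k1 : itg t b (fun s => h s ^+ 2) <= itg a b (fun s => h s ^+ 2).
    by apply: itg_sub_le => //; [exact: hv.1.2|move=> *; apply: sqr_ge0].
  have k0 : 0 <= itg t b (fun s => h s ^+ 2) by apply: itg_ge0 => *; apply: sqr_ge0.
  apply: ler_pM => //; lra.
rewrite -sqrrN opprB.
apply: le_trans (H1_holder hu (lexx a) at_ tb) _; apply: le_trans hw.
have k1 : itg a t (fun s => g s ^+ 2) <= itg a b (fun s => g s ^+ 2).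
  by apply: itg_sub_le => //; [exact: hu.1.2|move=> *; apply: sqr_ge0].
have k0 : 0 <= itg a t (fun s => g s ^+ 2) by apply: itg_ge0 => *; apply: sqr_ge0.
apply: ler_pM => //; lra.
Qed.

Lemma H1_prod_inc a b u v g h : a <= b -> H1 a b u g -> H1 a b v h ->
  u b * v b - u a * v a = itg a b (fun t => u t * h t + v t * g t).
Proof.
move=> ab hu hv; set k := fun t => _.
set S := fun t => `|g t| + `|h t|.
have [Mu hMu] := H1_bound ab hu; have [Mv hMv] := H1_bound ab hv.
have ik : L1 a b k.
  apply: L1D; apply: L2_L1.
    exact: L2_bndM (H1_meas ab hu) hMu hv.1.
  exact: L2_bndM (H1_meas ab hv) hMv hu.1.
have iS : L1 a b (fun t => `|g t| + `|h t|) by apply: L1D; apply/L1_norm/L2_L1; [exact: hu.1|exact: hv.1].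
set G := itg a b (fun t => g t ^+ 2) + itg a b (fun t => h t ^+ 2).
have G0 : 0 <= G by apply: addr_ge0; apply: itg_ge0 => t _; apply: sqr_ge0.
have S0 : 0 <= itg a b S by apply: itg_ge0 => t _; apply: addr_ge0.
apply/eqP; rewrite -subr_eq0; apply: contraT => ne0; exfalso.
set X := _ - itg a b k in ne0.
have X0 : 0 < `|X| by rewrite normr_gt0.
(* This makes [w * itg a b S] smaller than half of the absolute value of [X], against the bound
   summed over the cells. The number [n] of cells below is large enough for their length [d] to
   satisfy [d * G <= w ^+ 2]. *)
pose w := `|X| / (2 * (itg a b S + 1)).
have w0 : 0 < w by rewrite divr_gt0 // mulr_gt0 //; lra.
suff : `|X| <= w * itg a b S.
  have : w * (2 * (itg a b S + 1)) = `|X| by rewrite divfK // gt_eqF // mulr_gt0 //; lra.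
  nra.
pose n := (Num.truncn ((b - a) * G / w ^+ 2)).+1.
have n0 : 0 < n%:R :> R by rewrite ltr0n.
pose d := (b - a) / n%:R.
have d0 : 0 <= d by rewrite divr_ge0 ?subr_ge0 // ltW.
have dG : d * G <= w ^+ 2.
  have := truncnS_gt ((b - a) * G / w ^+ 2); rewrite -/n.
  have w2 : 0 < w ^+ 2 by rewrite exprn_gt0.
  rewrite ltr_pdivrMr // /d mulrAC => hn.
  by rewrite ler_pdivrMr // [leRHS]mulrC ltW.
have H i : (i <= n)%N -> let x := a + i%:R * d in
   `|u x * v x - u a * v a - itg a x k| <= w * itg a x S.
  elim: i => [|i IH] lin /=.
    by rewrite mul0r addr0 subrr !itg_pt mulr0 subr0 normr0.
  have := IH (ltnW lin) => /=; set x := a + i%:R * d; set y := a + _.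
  have xy : y = x + d by rewrite /x /y -natr1; ring.
  have ax : a <= x by rewrite lerDl mulr_ge0.
  have xy' : x <= y by rewrite xy lerDl.
  have yb : y <= b.
    have -> : b = a + n%:R * d by rewrite /d mulrC divfK ?gt_eqF //; ring.
    by rewrite lerD2l ler_wpM2r // ler_nat.
  have hu' := H1_sub ax yb hu; have hv' := H1_sub ax yb hv.
  move=> IHi; have := @H1_prod_cell x y u v g h w xy' hu' hv' (ltW w0).
  rewrite -/k -/S (@itg_cat _ a y x) //; last by apply: L1_sub ik.
  rewrite (@itg_cat _ a y x S) //; last by apply: L1_sub iS.
  have hd : (y - x) * (itg x y (fun t : R => g t ^+ 2) + itg x y (fun t : R => h t ^+ 2)) <= w ^+ 2.
    apply: le_trans dG; have -> : y - x = d by rewrite xy; ring.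
    apply: ler_wpM2l => //; apply: lerD; apply: itg_sub_le => //.
    + exact: hu.1.2.
    + by move=> *; apply: sqr_ge0.
    + exact: hv.1.2.
    + by move=> *; apply: sqr_ge0.
  move=> /(_ hd) hc; rewrite mulrDr.
  have -> : u y * v y - u a * v a - (itg a x k + itg x y k) =
    (u x * v x - u a * v a - itg a x k) + (u y * v y - u x * v x - itg x y k) by ring.
  by apply: le_trans (ler_normD _ _) _; apply: lerD.
have := H n (leqnn n) => /=.
by have -> : a + n%:R * d = b by rewrite /d mulrC divfK ?gt_eqF //; ring.
Qed.

Lemma H1M a b u v g h : a <= b -> H1 a b u g -> H1 a b v h ->
  H1 a b (fun x => u x * v x) (fun x => u x * h x + v x * g x).
Proof.
move=> ab hu hv.
have [Mu hMu] := H1_bound ab hu; have [Mv hMv] := H1_bound ab hv.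
split.
  apply: L2D.
    exact: L2_bndM (H1_meas ab hu) hMu hv.1.
  exact: L2_bndM (H1_meas ab hv) hMv hu.1.
move=> x /andP[ax xb]; rewrite -(@H1_prod_inc a x) //; first by ring.
  exact: H1_sub hu.
exact: H1_sub hv.
Qed.

End ProductRule.

(** * Regularity of the weak solution *)

Section WeakSolutions.
Variable R : realType.
Implicit Types (f g u v : R -> R) (eps b : R).

Let m11 : (-1 : R) <= 1. Proof. lra. Qed.

Lemma has_weak_deriv_H1 u g : has_weak_deriv u g -> H1 (-1) 1 u g.
Proof.
move=> [_ _ h3 h4 h5]; split; last by move=> x /h5.
by split; [exact: (L1_meas (a := -1) (b := 1))|exact: h4].
Qed.

Lemma H1_has_weak_deriv u g : H1 (-1) 1 u g -> has_weak_deriv u g.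
Proof.
move=> hu; have lu := H1_L2 m11 hu; split.
- exact: L2_L1 lu.
- exact: lu.2.
- exact: L2_L1 hu.1.
- exact: hu.1.2.
- exact: hu.2.
Qed.

Lemma weak_solutionP eps b f u : weak_solution eps b f u ->
  exists g, [/\ H1 (-1) 1 u g, u (-1) = 0, u 1 = 0 &
    forall v gv, H1 (-1) 1 v gv -> v (-1) = 0 -> v 1 = 0 ->
      itg (-1) 1 (fun x => eps ^+ 2 * g x * gv x + b * u x * v x) =
      itg (-1) 1 (fun x => f x * v x)].
Proof.
move=> [g [[hu [u0 u1]] hw]]; exists g; split => //.
  exact: has_weak_deriv_H1.
by move=> v gv hv v0 v1; apply: hw; split => //; exact: H1_has_weak_deriv.
Qed.

(* du Bois-Reymond: test with the primitive of the mean-free part of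
   [eps^2 u' - int (b u - f)]. *)
Lemma weak_solution_regular eps b f u : 0 < eps -> L2 (-1) 1 f ->
  weak_solution eps b f u ->
  exists q, H1 (-1) 1 u q /\
    H1 (-1) 1 q (fun x => (eps ^+ 2)^-1 * (b * u x - f x)).
Proof.
move=> e0 hf /weak_solutionP[g [hu u0 u1 hw]].
have lu := H1_L2 m11 hu.
pose F x := b * u x - f x.
have lF : L2 (-1) 1 F by apply: L2B hf; exact: L2Z.
pose P x := 0 + itg (-1) x F.
have hP : H1 (-1) 1 P F by apply: H1_itg.
have lP := H1_L2 m11 hP.
pose G x := eps ^+ 2 * g x - P x.
have lG : L2 (-1) 1 G by apply: L2B => //; apply: L2Z; exact: hu.1.
pose c := itg (-1) 1 G / 2.
pose k x := G x - c.
have lk : L2 (-1) 1 k by apply: L2B => //; exact: L2_cst.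
pose v x := 0 + itg (-1) x k.
have hv : H1 (-1) 1 v k by apply: H1_itg.
have v0 : v (-1) = 0 by rewrite /v itg_pt addr0.
have ik0 : itg (-1) 1 k = 0.
  rewrite /k itgB; [|exact: L2_L1|exact: L1_cst].
  by rewrite itg_cst // /c; field.
have v1 : v 1 = 0 by rewrite /v ik0 addr0.
have lv := H1_L2 m11 hv.
have := hw v k hv v0 v1.
have := H1_prod_inc m11 hP hv; rewrite v0 v1 !mulr0 subrr => pe we.
have k2 : itg (-1) 1 (fun x => k x ^+ 2) = 0.
  (* Pointwise [eps ^+ 2 * g = k + c + P] and [b * u = F + f]. Of the resulting terms, [c * k]
     integrates to 0 by the choice of [c], [P * k + v * F] does so as the derivative of [P * v], and
     [f * v] cancels against the right-hand side of the weak equation. *)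
  have E1 : itg (-1) 1 (fun x => eps ^+ 2 * g x * k x + b * u x * v x) =
    itg (-1) 1 (fun x => k x ^+ 2) + c * itg (-1) 1 k +
    itg (-1) 1 (fun x => P x * k x + v x * F x) + itg (-1) 1 (fun x => f x * v x).
    rewrite -itgZ; last exact: L2_L1.
    rewrite -itgD; [|exact: lk.2|exact/L1Z/L2_L1].
    have iPv : L1 (-1) 1 (fun x => P x * k x + v x * F x).
      by apply: L1D; exact: L2M.
    rewrite -itgD //; last by apply: L1D; [exact: lk.2|exact/L1Z/L2_L1].
    rewrite -itgD; [|apply: L1D => //; apply: L1D; [exact: lk.2|exact/L1Z/L2_L1]|exact: L2M].
    apply: itg_eq => x _; rewrite /k /F /G /=; ring.
  move: we; rewrite E1 ik0 -pe; lra.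
(* The continuous representative of [u']: as [k] has zero norm, [eps ^+ 2 * g = c + P] almost
   everywhere. *)
pose q x := (eps ^+ 2)^-1 * (c + P x).
have e2 : eps ^+ 2 != 0 by rewrite gt_eqF // exprn_gt0.
exists q; split.
  have lq : L2 (-1) 1 q by apply: L2Z; apply: L2D => //; exact: L2_cst.
  split => // x /andP[x1 x2]; rewrite hu.2 ?x1 //; congr (_ + _).
  apply/eqP; rewrite -subr_eq0 -normr_eq0 -[_ == 0]orbF.
  have ig := L1_sub (lexx (-1)) x2 (L2_L1 hu.1).
  have iq := L1_sub (lexx (-1)) x2 (L2_L1 lq).
  have lkx := L2_sub (lexx (-1)) x2 lk.
  have Z : itg (-1) x (fun t => `|k t|) = 0.
    have cs := cauchy_schwarz1 x1 lkx.
    have t1 : itg (-1) x (fun t => k t ^+ 2) <= itg (-1) 1 (fun t => k t ^+ 2).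
      by apply: itg_sub_le => //; [exact: lk.2|move=> *; exact: sqr_ge0].
    have t0 : 0 <= itg (-1) x (fun t => k t ^+ 2) by apply: itg_ge0 => *; exact: sqr_ge0.
    have t00 : itg (-1) x (fun t => k t ^+ 2) = 0 by apply/eqP; rewrite eq_le t0 -k2 t1.
    rewrite t00 mulr0 in cs.
    by apply/eqP; rewrite -sqrf_eq0 eq_le cs sqr_ge0.
  rewrite -itgB //.
  have -> : itg (-1) x (fun t => g t - q t) = itg (-1) x (fun t => (eps ^+ 2)^-1 * k t).
    by apply: itg_eq => t _; rewrite /q /k /G; field; move: e2; rewrite sqrf_eq0.
  rewrite itgZ; last exact: L2_L1.
  have : `|itg (-1) x k| <= 0 by rewrite -Z; apply/itg_norm/L2_L1.
  by rewrite normr_le0 => /eqP ->; rewrite mulr0 normr0 eqxx.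
apply: H1Z; split => // x xi; rewrite /P itg_pt; ring.
Qed.

End WeakSolutions.

(** * Powers and exponential weights *)

Section SmoothFunctions.
Variable R : realType.

Lemma is_derive_expM (l x : R) :
  is_derive x 1 (fun t : R => expR (l * t)) (l * expR (l * x)).
Proof.
have h : is_derive x 1 (fun t : R => l * t) l.
  by apply: is_derive_eq; rewrite /GRing.scale /= !mulr1.
have := @is_derive1_comp R expR (fun t => l * t) x _ _ (is_derive_expR (l * x)) h.
by move/is_derive_eq; apply; rewrite mulrC.
Qed.

Lemma continuous_expM (l : R) : continuous (fun t : R => expR (l * t)).
Proof.
move=> x; apply: continuous_comp; last exact: continuous_expR.
by apply: continuousM; [exact: cvg_cst|exact: cvg_id].
Qed.

Lemma H1_pow (k : nat) (s : R) :
  H1 (-1) 1 (fun x => ((1 + s * x) / 2) ^+ k.+1)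
    (fun x => s * (k.+1%:R / 2) * ((1 + s * x) / 2) ^+ k).
Proof.
apply: H1_deriv => [x|x].
  pose p (t : R) : R := (1 + s * t) / 2.
  have h : is_derive x 1 p (s / 2).
    by apply: is_derive_eq; rewrite /GRing.scale /=; ring.
  have -> : (fun t => ((1 + s * t) / 2) ^+ k.+1) = p ^+ k.+1.
    by rewrite exprfctE.
  by apply: is_derive_eq; rewrite /GRing.scale /= /p; ring.
apply: (@continuousM _ _ (fun=> s * (k.+1%:R / 2)) (fun x => ((1 + s * x) / 2) ^+ k)); first exact: cvg_cst.
apply: (@continuous_comp _ _ _ (fun x => (1 + s * x) / 2) (fun y => y ^+ k)); last exact: exprn_continuous.
apply: continuousM; last exact: cvg_cst.
apply: continuousD; first exact: cvg_cst.
apply: continuousM; [exact: cvg_cst|exact: cvg_id].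
Qed.

Lemma H1_weight a b (l eta : R) : 0 <= eta ->
  let psi x := 1 + eta * (expR (l * x) + expR (- l * x)) in
  H1 a b (fun x => (psi x)^-1)
    (fun x => - (eta * (l * expR (l * x) + - l * expR (- l * x))) * (psi x)^-2).
Proof.
move=> e0 psi.
have p0 x : psi x != 0.
  by rewrite gt_eqF // ltr_pwDl // mulr_ge0 // addr_ge0 // expR_ge0.
apply: H1_deriv => [x|x].
  have h : is_derive x 1 psi (eta * (l * expR (l * x) + - l * expR (- l * x))).
    have ? := is_derive_expM l x; have ? := is_derive_expM (- l) x.
    by apply: is_derive_eq; rewrite /GRing.scale /=; ring.
  have := is_deriveV (p0 x) h.
  by move/is_derive_eq; apply; rewrite /GRing.scale /=; ring.
have cE k : {for x, continuous (fun t : R => expR (k * t))} by exact: continuous_expM.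
have cp : {for x, continuous psi}.
  apply: continuousD; first exact: cvg_cst.
  apply: continuousM; first exact: cvg_cst.
  by apply: continuousD; exact: cE.
apply: (@continuousM _ _ (fun x => - (eta * (l * expR (l * x) + - l * expR (- l * x))))
  (fun x => (psi x)^-2)).
  apply: (@continuousN _ _ _ (fun x => eta * (l * expR (l * x) + - l * expR (- l * x)))).
  apply: (@continuousM _ _ (fun=> eta) (fun x => l * expR (l * x) + - l * expR (- l * x)));
    first exact: cvg_cst.
  apply: (@continuousD _ _ _ (fun x => l * expR (l * x)) (fun x => - l * expR (- l * x))).
    by apply: (@continuousM _ _ (fun=> l) (fun x => expR (l * x))); [exact: cvg_cst|exact: cE].
  by apply: (@continuousM _ _ (fun=> - l) (fun x => expR (- l * x))); [exact: cvg_cst|exact: cE].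
apply: (@continuousV _ _ (fun x => psi x ^+ 2)); first by rewrite expf_neq0.
by apply: (@continuousM _ _ psi psi).
Qed.
End SmoothFunctions.

(** * Estimates for the weak solution *)

Lemma sqrD_le (R : realType) (x y : R) : (x + y) ^+ 2 <= 2 * x ^+ 2 + 2 * y ^+ 2.
Proof. by have := sqr_ge0 (x - y); lra. Qed.

Section Estimates.
Variables (R : realType) (b : R) (f f1 : R -> R).
Hypotheses (b0 : 0 < b) (hf : H1 (-1) 1 f f1).
Implicit Types (u g : R -> R) (eps : R).

Let m11 : (-1 : R) <= 1. Proof. lra. Qed.
Let lf : L2 (-1) 1 f. Proof. exact: H1_L2 hf. Qed.

(** Test with [u] itself, drop the derivative term and absorb [f u] by Young's inequality. *)
Lemma solution_L2_le eps u : weak_solution eps b f u ->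
  b ^+ 2 * itg (-1) 1 (fun x => u x ^+ 2) <= itg (-1) 1 (fun x => f x ^+ 2).
Proof.
move=> /weak_solutionP[g [hu u0 u1 hw]].
have lu := H1_L2 m11 hu.
have e := hw u g hu u0 u1.
have i1 : L1 (-1) 1 (fun x => eps ^+ 2 * g x * g x + b * u x * u x).
  by apply: L1D; apply: L2M => //; try apply: L2Z => //; exact: hu.1.
have h1 : itg (-1) 1 (fun x => b * u x ^+ 2) <=
   itg (-1) 1 (fun x => eps ^+ 2 * g x * g x + b * u x * u x).
  apply: itg_le => //; first exact: L1Z lu.2.
  move=> x _; have : 0 <= (eps * g x) ^+ 2 by apply: sqr_ge0.
  nra.
have h2 : itg (-1) 1 (fun x => f x * u x) <=
   itg (-1) 1 (fun x => (2 * b)^-1 * f x ^+ 2 + b / 2 * u x ^+ 2).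
  apply: itg_le; [exact: L2M|by apply: L1D; apply: L1Z; [exact: lf.2|exact: lu.2]|].
  move=> x _; have : 0 <= (2 * b)^-1 * (f x - b * u x) ^+ 2.
    by rewrite mulr_ge0 ?sqr_ge0 // invr_ge0 mulr_ge0 // ltW.
  rewrite (_ : _ * _ = (2 * b)^-1 * f x ^+ 2 + b / 2 * u x ^+ 2 - f x * u x); first lra.
  by field; rewrite gt_eqF.
rewrite itgD in h2; [|exact: L1Z lf.2|exact: L1Z lu.2].
rewrite itgZ in h1; last exact: lu.2.
rewrite (itgZ _ lf.2) (itgZ _ lu.2) -e in h2.
set U := itg _ _ (fun x => u x ^+ 2) in h1 h2 *; set F := itg _ _ (fun x => f x ^+ 2) in h1 h2 *.
have h3 : b / 2 * U <= (2 * b)^-1 * F by lra.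
have e3 : F = 2 * b * ((2 * b)^-1 * F) by field; rewrite gt_eqF.
rewrite e3 expr2; have := ler_wpM2l (ltW (mulr_gt0 (ltr0n R 2) b0) : 0 <= 2 * b) h3.
lra.
Qed.

Lemma itg_pow (k : nat) (s : R) : s ^+ 2 = 1 ->
  itg (-1) 1 (fun x => ((1 + s * x) / 2) ^+ k) = 2 / k.+1%:R.
Proof.
move=> s2; have h := H1_pow k s.
have i : L1 (-1) 1 (fun x => ((1 + s * x) / 2) ^+ k).
  have k0 : k.+1%:R != 0 :> R by rewrite pnatr_eq0.
  apply: L1_ext (L1Z (2 * s / k.+1%:R) (L2_L1 h.1)) => x _.
  transitivity (s ^+ 2 * ((1 + s * x) / 2) ^+ k); last by rewrite s2 mul1r.
  by move: k0; set K := k.+1%:R => k0; field.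
have := H1_inc h (lexx _) m11 (lexx _); rewrite itgZ // => e.
have k0 : k.+1%:R != 0 :> R by rewrite pnatr_eq0.
have -> : itg (-1) 1 (fun x => ((1 + s * x) / 2) ^+ k) =
   2 * s / k.+1%:R * (s * (k.+1%:R / 2) * itg (-1) 1 (fun x => ((1 + s * x) / 2) ^+ k)).
  set A := itg _ _ _; transitivity (s ^+ 2 * A); first by rewrite s2 mul1r.
  by move: k0; set K := k.+1%:R => k0; field.
rewrite -e; have : s = 1 \/ s = -1.
  by have /eqP := s2; rewrite sqrf_eq1 => /orP[] /eqP; [left|right].
by case=> -> ; rewrite ?mulN1r ?mul1r ?opprK subrr mul0r expr0n /= ?subr0 ?sub0r divff ?pnatr_eq0 // expr1n; field.
Qed.

(* Test with [W + G], where [W = b u - f] and the powers [((1 +- x) / 2)^N],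
   [N ~ 1 / eps], lift the boundary values of [- W] with energy [O(eps)]. *)
Lemma layer_energy : exists2 C, 0 < C & forall eps u g, 0 < eps <= 1 ->
  H1 (-1) 1 u g -> u (-1) = 0 -> u 1 = 0 ->
  (forall v gv, H1 (-1) 1 v gv -> v (-1) = 0 -> v 1 = 0 ->
      itg (-1) 1 (fun x => eps ^+ 2 * g x * gv x + b * u x * v x) =
      itg (-1) 1 (fun x => f x * v x)) ->
  itg (-1) 1 (fun x => eps ^+ 2 * (b * g x - f1 x) ^+ 2 + b * (b * u x - f x) ^+ 2)
    <= C * eps.
Proof.
pose Phi := f 1 ^+ 2 + f (-1) ^+ 2; pose F1 := itg (-1) 1 (fun x => f1 x ^+ 2).
have Phi0 : 0 <= Phi by rewrite addr_ge0 // sqr_ge0.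
have F10 : 0 <= F1 by apply: itg_ge0 => *; apply: sqr_ge0.
exists (F1 + 4 * Phi + 4 * b * Phi + 1); first by rewrite ltr_wpDl // !addr_ge0 // !mulr_ge0 // ltW.
move=> eps u g /andP[e0 e1] hu u0 u1 hw.
pose N := Num.truncn eps^-1.
have Nl : eps^-1 < N.+1%:R by apply: truncnS_gt.
have Nu : N%:R <= eps^-1 by rewrite truncn_le ?invr_ge0 ?ltW // invr_ge0 ltW.
have ei : eps * eps^-1 = 1 by rewrite divff // gt_eqF.
have ei1 : 1 <= eps^-1 by rewrite invf_ge1.
pose p s x : R := ((1 + s * x) / 2) ^+ N.+1.
pose dp s x : R := s * (N.+1%:R / 2) * ((1 + s * x) / 2) ^+ N.
pose G x := f 1 * p 1 x + f (-1) * p (-1) x.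
pose dG x := f 1 * dp 1 x + f (-1) * dp (-1) x.
have hG : H1 (-1) 1 G dG by apply: H1D; apply: H1Z; exact: H1_pow.
pose W x := b * u x - f x; pose dW x := b * g x - f1 x.
have hW : H1 (-1) 1 W dW by apply: H1B => //; exact: H1Z.
have hv := H1D hW hG.
have p11 : p 1 1 = 1 by rewrite /p mul1r divff ?pnatr_eq0 // expr1n.
have p12 : p 1 (-1) = 0 by rewrite /p mul1r subrr mul0r expr0n.
have p21 : p (-1) 1 = 0 by rewrite /p mulN1r subrr mul0r expr0n.
have p22 : p (-1) (-1) = 1 by rewrite /p mulN1r opprK divff ?pnatr_eq0 // expr1n.
have v0 : W (-1) + G (-1) = 0 by rewrite /W /G u0 p12 p22; ring.
have v1 : W 1 + G 1 = 0 by rewrite /W /G u1 p11 p21; ring.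
have we := hw _ _ hv v0 v1.
have lW := H1_L2 m11 hW; have lG := H1_L2 m11 hG; have lu := H1_L2 m11 hu.
have lW' := hW.1; have lG' := hG.1; have lf1 := hf.1.
have lWG := L2D lW lG; have lWG' := L2D lW' lG'.
have I : L1 (-1) 1 (fun x => eps ^+ 2 * dW x ^+ 2 + b * W x ^+ 2).
  by apply: L1D; apply: L1Z; [exact: lW'.2|exact: lW.2].
have J : L1 (-1) 1 (fun x => eps ^+ 2 * (f1 x ^+ 2 + dG x ^+ 2) + b * G x ^+ 2).
  by apply: L1D; apply: L1Z; [apply: L1D; [exact: lf1.2|exact: lG'.2]|exact: lG.2].
have K1 : L1 (-1) 1 (fun x => eps ^+ 2 * g x * (dW x + dG x) + b * u x * (W x + G x)).
  by apply: L1D; apply: L2M => //; apply: L2Z => //; exact: hu.1.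
have K2 : L1 (-1) 1 (fun x => f x * (W x + G x)) by apply: L2M.
have e : itg (-1) 1 (fun x => eps ^+ 2 * g x * (dW x + dG x) + b * u x * (W x + G x)
   - f x * (W x + G x)) = 0 by rewrite itgB // we subrr.
have K3 := L1Z (2 * b) (L1B K1 K2).
(* The last summand on the right is [2 * b] times the difference of the two sides of the weak
   equation and integrates to 0. Since [b * g = dW + f1] and [b * u - f = W], the right side minus
   the left is exactly [eps ^+ 2 * (dW + f1 + dG) ^+ 2 + b * (W + G) ^+ 2]. *)
have le1 : itg (-1) 1 (fun x => eps ^+ 2 * dW x ^+ 2 + b * W x ^+ 2) <=
   itg (-1) 1 (fun x => (eps ^+ 2 * (f1 x ^+ 2 + dG x ^+ 2) + b * G x ^+ 2) +
     2 * b * (eps ^+ 2 * g x * (dW x + dG x) + b * u x * (W x + G x)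
   - f x * (W x + G x))).
  apply: itg_le => //; first exact: L1D.
  move=> x _.
  have -> : 2 * b * (eps ^+ 2 * g x * (dW x + dG x) + b * u x * (W x + G x) - f x * (W x + G x)) =
    2 * eps ^+ 2 * (dW x + f1 x) * (dW x + dG x) + 2 * b * W x * (W x + G x).
    by rewrite /dW /W; ring.
  have a1 : 0 <= eps ^+ 2 * (dW x + f1 x + dG x) ^+ 2 by rewrite mulr_ge0 ?sqr_ge0.
  have a2 : 0 <= b * (W x + G x) ^+ 2 by rewrite mulr_ge0 ?sqr_ge0 // ltW.
  rewrite -subr_ge0; apply: le_trans (addr_ge0 a1 a2) _.
  rewrite le_eqVlt; apply/orP; left; apply/eqP; ring.
rewrite (itgD J K3) (itgZ _ (L1B K1 K2)) in le1.
rewrite e mulr0 addr0 in le1.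
apply: le_trans le1 _.
have ig1 : L1 (-1) 1 (fun x => f1 x ^+ 2 + dG x ^+ 2) by apply: L1D; [exact: lf1.2|exact: lG'.2].
rewrite itgD; [|exact: L1Z|exact: L1Z lG.2].
rewrite !itgZ //; [|exact: lG.2].
rewrite itgD; [|exact: lf1.2|exact: lG'.2].
rewrite -/F1.
have sqp s k x : (((1 + s * x) / 2) ^+ k) ^+ 2 = ((1 + s * x) / 2 : R) ^+ (2 * k).
  by rewrite -exprM mulnC.
have Lp s k : L1 (-1) 1 (fun x => ((1 + s * x) / 2 : R) ^+ k).
  have ct : continuous (fun x : R => ((1 + s * x) / 2) ^+ k).
    move=> x; apply: (@continuous_comp _ _ _ (fun x => (1 + s * x) / 2) (fun y => y ^+ k));
      last exact: exprn_continuous.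
    apply: continuousM; last exact: cvg_cst.
    apply: continuousD; first exact: cvg_cst.
    apply: continuousM; [exact: cvg_cst|exact: cvg_id].
  apply: continuous_compact_integrable; first exact: segment_compact.
  exact: continuous_subspaceT.
have s1 : (1 : R) ^+ 2 = 1 by rewrite expr1n.
have s2 : (-1 : R) ^+ 2 = 1 by rewrite sqrrN expr1n.
have N0 : 0 <= N%:R :> R by [].
have bG : itg (-1) 1 (fun x => G x ^+ 2) <= 4 * Phi * eps.
  apply: (@le_trans _ _ (itg (-1) 1 (fun x =>
     2 * f 1 ^+ 2 * ((1 + 1 * x) / 2) ^+ (2 * N.+1) + 2 * f (-1) ^+ 2 * ((1 + -1 * x) / 2) ^+ (2 * N.+1)))).
    apply: itg_le; [exact: lG.2|by apply: L1D; apply: L1Z|].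
    move=> x _; rewrite -!sqp.
    have -> : 2 * f 1 ^+ 2 * (((1 + 1 * x) / 2) ^+ N.+1) ^+ 2 =
      2 * (f 1 * p 1 x) ^+ 2 by rewrite /p exprMn; ring.
    have -> : 2 * f (-1) ^+ 2 * (((1 + -1 * x) / 2) ^+ N.+1) ^+ 2 =
      2 * (f (-1) * p (-1) x) ^+ 2 by rewrite /p exprMn; ring.
    exact: sqrD_le.
  rewrite itgD; [|exact: L1Z|exact: L1Z].
  rewrite !itgZ // !itg_pow //.
  have -> : 2 * f 1 ^+ 2 * (2 / (2 * N.+1).+1%:R) + 2 * f (-1) ^+ 2 * (2 / (2 * N.+1).+1%:R)
    = Phi * (4 / (2 * N.+1).+1%:R) by rewrite /Phi; ring.
  (* Here [eps^-1 < N + 1] is used; for [dG] below it is [N <= eps^-1]. *)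
  have : 4 / (2 * N.+1).+1%:R <= 4 * eps.
    rewrite ler_pdivrMr // -mulrA ler_peMr // -natr1 natrM.
    have : eps * eps^-1 < eps * N.+1%:R by rewrite ltr_pM2l.
    nra.
  move=> h; have -> : 4 * Phi * eps = Phi * (4 * eps) by ring.
  exact: ler_wpM2l.
have bdG : itg (-1) 1 (fun x => dG x ^+ 2) <= 4 * Phi / eps.
  apply: (@le_trans _ _ (itg (-1) 1 (fun x =>
     (2 * f 1 ^+ 2 * (N.+1%:R / 2) ^+ 2) * ((1 + 1 * x) / 2) ^+ (2 * N)
    + (2 * f (-1) ^+ 2 * (N.+1%:R / 2) ^+ 2) * ((1 + -1 * x) / 2) ^+ (2 * N)))).
    apply: itg_le; [exact: lG'.2|by apply: L1D; apply: L1Z|].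
    move=> x _; rewrite -!sqp.
    have -> : 2 * f 1 ^+ 2 * (N.+1%:R / 2) ^+ 2 * (((1 + 1 * x) / 2) ^+ N) ^+ 2 =
      2 * (f 1 * dp 1 x) ^+ 2 by rewrite /dp; ring.
    have -> : 2 * f (-1) ^+ 2 * (N.+1%:R / 2) ^+ 2 * (((1 + -1 * x) / 2) ^+ N) ^+ 2 =
      2 * (f (-1) * dp (-1) x) ^+ 2 by rewrite /dp; ring.
    exact: sqrD_le.
  rewrite itgD; [|exact: L1Z|exact: L1Z].
  rewrite !itgZ // !itg_pow //.
  have -> : 2 * f 1 ^+ 2 * (N.+1%:R / 2) ^+ 2 * (2 / (2 * N).+1%:R) +
    2 * f (-1) ^+ 2 * (N.+1%:R / 2) ^+ 2 * (2 / (2 * N).+1%:R)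
    = Phi * (N.+1%:R ^+ 2 / (2 * N).+1%:R).
    have : (2 * N).+1%:R != 0 :> R by rewrite pnatr_eq0.
    by rewrite /Phi; set K := (2 * N).+1%:R => K0; field.
  have h : N.+1%:R ^+ 2 / (2 * N).+1%:R <= 4 / eps.
    rewrite ler_pdivrMr // -!natr1 natrM.
    have : (N%:R + 1) ^+ 2 <= (N%:R + 1) * (2 * eps^-1).
      by rewrite expr2; apply: ler_wpM2l; lra.
    nra.
  have -> : 4 * Phi / eps = Phi * (4 / eps) by ring.
  exact: ler_wpM2l.
have c1 : eps ^+ 2 * (F1 + itg (-1) 1 (fun x => dG x ^+ 2)) <= (F1 + 4 * Phi) * eps.
  have : eps ^+ 2 * (F1 + itg (-1) 1 (fun x => dG x ^+ 2)) <=
    eps ^+ 2 * (F1 + 4 * Phi / eps) by apply: ler_wpM2l; [exact: sqr_ge0|lra].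
  have -> : eps ^+ 2 * (F1 + 4 * Phi / eps) = eps * (eps * F1) + 4 * Phi * eps.
    by field; rewrite gt_eqF.
  have : eps * (eps * F1) <= eps * F1 by apply: ler_wpM2l; [exact: ltW|rewrite ler_piMl].
  lra.
have c2 : b * itg (-1) 1 (fun x => G x ^+ 2) <= b * (4 * Phi * eps).
  by apply: ler_wpM2l => //; exact: ltW.
lra.
Qed.

End Estimates.

(** * Weighted estimate away from the layers *)

Section WeightedEstimate.
Variables (R : realType).
Implicit Types (b l eps s : R) (Z Y : R -> R).

Let m11 : (-1 : R) <= 1. Proof. lra. Qed.

(* The weight [1 / (1 + eta (e^{lx} + e^{-lx}))] with [eta = e^{-l(1-s)}] is
   at least 1/3 on [-1+s, 1-s], at most [e^{-ls}] at the end points, and its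
   logarithmic derivative is bounded by [l]. *)
Lemma interior_estimate b eps l s Z Y (f2 : R -> R) : 0 < b -> 0 < eps -> 0 < l ->
  (eps * l) ^+ 2 = b -> 0 <= s <= 1 ->
  H1 (-1) 1 Z Y -> L2 (-1) 1 f2 ->
  H1 (-1) 1 Y (fun x => (eps ^+ 2)^-1 * (b * Z x - f2 x)) ->
  b / 6 * itg (-1 + s) (1 - s) (fun x => Z x ^+ 2) <=
    b^-1 * itg (-1) 1 (fun x => f2 x ^+ 2) +
    eps ^+ 2 * expR (- l * s) * (`|Y 1 * Z 1| + `|Y (-1) * Z (-1)|).
Proof.
move=> b0 e0 l0 el /andP[s0 s1] hZ lf2 hY.
pose eta := expR (- l * (1 - s)).
have eta0 : 0 < eta by exact: expR_gt0.
pose psi x := 1 + eta * (expR (l * x) + expR (- l * x)).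
pose phi x := (psi x)^-1.
pose dphi x := - (eta * (l * expR (l * x) + - l * expR (- l * x))) * (psi x)^-2.
have hphi : H1 (-1) 1 phi dphi by exact: H1_weight (ltW eta0).
have psi1 x : 1 <= psi x.
  by rewrite lerDl mulr_ge0 ?(ltW eta0) // addr_ge0 // expR_ge0.
have phi0 x : 0 < phi x by rewrite invr_gt0 (lt_le_trans ltr01).
have phi1 x : phi x <= 1 by rewrite invf_le1 // (lt_le_trans ltr01).
have dphil x : `|dphi x| <= l * phi x.
  have -> : dphi x = - l * (eta * (expR (l * x) - expR (- l * x)) * phi x) * phi x.
    by rewrite /dphi /phi; field; rewrite gt_eqF // (lt_le_trans ltr01).
  rewrite !normrM normrN (gtr0_norm l0) (gtr0_norm (phi0 x)).
  rewrite ler_wpM2r ?(ltW (phi0 x)) // ler_piMr ?(ltW l0) //.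
  rewrite ler_pdivrMr ?(lt_le_trans ltr01) // mul1r (gtr0_norm eta0) /psi.
  have E1 := expR_ge0 (l * x); have E2 := expR_ge0 (- l * x).
  have : `|expR (l * x) - expR (- l * x)| <= expR (l * x) + expR (- l * x).
    by rewrite ler_norml; apply/andP; split; lra.
  by move=> /(ler_wpM2l (ltW eta0)); lra.
have lZ := H1_L2 m11 hZ; have lY := hZ.1.
have hpZ := H1M m11 hphi hZ.
have lpZ := H1_L2 m11 hpZ.
have PI := H1_prod_inc m11 hY hpZ.
set B := Y 1 * _ - _ in PI.
have lphi := H1_L2 m11 hphi.
have [Mp hMp] := H1_bound m11 hphi.
have ipZ : L1 (-1) 1 (fun x => phi x * Z x ^+ 2).
  apply: L1_ext (L2M lpZ lZ) => x _; ring.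
have iR : L1 (-1) 1 (fun t => Y t * (phi t * Y t + Z t * dphi t) +
   phi t * Z t * ((eps ^+ 2)^-1 * (b * Z t - f2 t))).
  apply: L1D; first by apply: L2M => //; exact: hpZ.1.
  by apply: L2M => //; exact: hY.1.
have e2 : 0 < eps ^+ 2 by rewrite exprn_gt0.
(* [PI] is the equation for [Z] tested with [phi * Z]. The derivative of the weight costs at most
   [eps ^+ 2 * l * p] times the absolute value of [y * z]; as [(eps * l) ^+ 2 = b], this consumes
   [eps ^+ 2 * p * y ^+ 2] and a quarter of [b * p * z ^+ 2]. The source takes another quarter, and
   one half is left. *)
have key : b / 2 * itg (-1) 1 (fun x => phi x * Z x ^+ 2) <=
   b^-1 * itg (-1) 1 (fun x => f2 x ^+ 2) + eps ^+ 2 * B.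
  rewrite PI -!itgZ //; last exact: lf2.2.
  rewrite -itgD; [|exact: L1Z lf2.2|exact: L1Z].
  apply: itg_le; [exact: L1Z|by apply: L1D; apply: L1Z => //; exact: lf2.2|].
  move=> x _; set p := phi x; set y := Y x; set z := Z x; set h := f2 x; set d := dphi x.
  have p0 : 0 < p by exact: phi0.
  have p1 : p <= 1 by exact: phi1.
  have -> : eps ^+ 2 * (y * (p * y + z * d) + p * z * ((eps ^+ 2)^-1 * (b * z - h))) =
     eps ^+ 2 * p * y ^+ 2 + eps ^+ 2 * (d * (y * z)) + p * (b * z ^+ 2 - z * h).
    by field; rewrite gt_eqF.
  have hd : - (l * p * `|y * z|) <= d * (y * z).
    rewrite lerNl; apply: le_trans (ler_norm _) _; rewrite normrN normrM.
    by apply: ler_wpM2r => //; exact: dphil.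
  have hyz : eps ^+ 2 * (l * `|y * z|) <= eps ^+ 2 * y ^+ 2 + b / 4 * z ^+ 2.
    rewrite -el normrM -(real_normK (num_real y)) -(real_normK (num_real z)).
    have := sqr_ge0 (eps * `|y| - eps * l / 2 * `|z|); lra.
  have hzh : z * h <= b / 4 * z ^+ 2 + b^-1 * h ^+ 2.
    have : 0 <= b^-1 * (b / 2 * z - h) ^+ 2 by rewrite mulr_ge0 ?sqr_ge0 // invr_ge0 ltW.
    have -> : b^-1 * (b / 2 * z - h) ^+ 2 = b / 4 * z ^+ 2 + b^-1 * h ^+ 2 - z * h.
      by field; rewrite gt_eqF.
    lra.
  have a1 : eps ^+ 2 * (l * p * `|y * z|) <= p * (eps ^+ 2 * y ^+ 2 + b / 4 * z ^+ 2).
    by have := ler_wpM2l (ltW p0) hyz; lra.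
  have a2 := ler_wpM2l (ltW e2) hd.
  have a3 := ler_wpM2l (ltW p0) hzh.
  have a4 : p * (b^-1 * h ^+ 2) <= b^-1 * h ^+ 2.
    by rewrite ler_piMl // mulr_ge0 ?sqr_ge0 // invr_ge0 ltW.
  lra.
have phiend x : x = 1 \/ x = -1 -> phi x <= expR (- l * s).
  have pe : expR (l * s) <= psi 1 /\ expR (l * s) <= psi (-1).
    have -> : expR (l * s) = eta * expR l by rewrite /eta -expRD; congr expR; ring.
    rewrite /psi !mulr1 !mulrN1 opprK.
    have h1 : 0 < eta * expR (- l) by rewrite mulr_gt0 // expR_gt0.
    by rewrite !mulrDr; lra.
  have -> : expR (- l * s) = (expR (l * s))^-1 by rewrite mulNr expRN.
  by case=> ->; rewrite lef_pV2 ?posrE ?expR_gt0 ?(lt_le_trans ltr01) //; case: pe.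
have BB : eps ^+ 2 * B <= eps ^+ 2 * expR (- l * s) * (`|Y 1 * Z 1| + `|Y (-1) * Z (-1)|).
  rewrite -mulrA; apply: ler_wpM2l; first exact: ltW.
  apply: le_trans (ler_norm _) _; apply: le_trans (ler_normB _ _) _; rewrite mulrDr.
  have aux x : x = 1 \/ x = -1 -> `|Y x * (phi x * Z x)| <= expR (- l * s) * `|Y x * Z x|.
    move=> hx; have -> : Y x * (phi x * Z x) = phi x * (Y x * Z x) by ring.
    by rewrite normrM (gtr0_norm (phi0 x)) ler_wpM2r // phiend.
  by apply: lerD; apply: aux; [left|right].
have mid : itg (-1 + s) (1 - s) (fun x => Z x ^+ 2) <=
   3 * itg (-1) 1 (fun x => phi x * Z x ^+ 2).
  have c1 : -1 <= -1 + s by rewrite lerDl.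
  have c2 : 1 - s <= 1 by rewrite gerBl.
  have c3 : -1 + s <= 1 - s by lra.
  apply: (@le_trans _ _ (itg (-1 + s) (1 - s) (fun x => 3 * (phi x * Z x ^+ 2)))).
    apply: itg_le; [exact: L1_sub lZ.2|exact: L1Z (L1_sub c1 c2 ipZ)|].
    move=> x /andP[x1 x2]; have : 3^-1 <= phi x.
      suff p3 : psi x <= 3 by rewrite /phi lef_pV2 ?posrE // (lt_le_trans ltr01).
      rewrite /psi /eta mulrDr -!expRD.
      have E1 : expR (- l * (1 - s) + l * x) <= 1.
        by rewrite -[leRHS]expR0 ler_expR; nra.
      have E2 : expR (- l * (1 - s) + - l * x) <= 1.
        by rewrite -[leRHS]expR0 ler_expR; nra.
      lra.
    have := sqr_ge0 (Z x); nra.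
  rewrite itgZ; last exact: L1_sub ipZ.
  apply: ler_wpM2l => //; apply: itg_sub_le => // t _.
  by rewrite mulr_ge0 ?sqr_ge0 // ltW.
have := ler_wpM2l (ltW b0) mid; lra.
Qed.

End WeightedEstimate.

(** * Bounds for the second derivative *)

Section RegularBounds.
Variables (R : realType) (b : R) (f f1 f2 : R -> R).
Hypotheses (b0 : 0 < b) (hf : H1 (-1) 1 f f1) (hf1 : H1 (-1) 1 f1 f2).

Let m11 : (-1 : R) <= 1. Proof. lra. Qed.

(** As [f] has two weak derivatives, [Z = u''] is again in [H1], with derivative
    [Y = (b u' - f') / eps^2], and solves the same equation with source [f'']; [interior_estimate]
    applies to it. Its boundary term contains [eps^2 Y Z], where [Z = O(eps^-2)] and, by the crude
    bound [u' = O(eps^-2)], [Y = O(eps^-4)]. This is the origin of [eps ^+ 4] under the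
    exponential. *)
Lemma regular_bounds : exists2 C, 0 < C &
  forall eps u, 0 < eps <= 1 -> weak_solution eps b f u ->
  exists q Z, [/\ H1 (-1) 1 u q, H1 (-1) 1 q Z,
    itg (-1) 1 (fun x => Z x ^+ 2) <= C / eps ^+ 4,
    forall x, -1 <= x <= 1 -> `|u x| <= C / eps ^+ 2 &
    forall s, 0 <= s <= 1 -> itg (-1 + s) (1 - s) (fun x => Z x ^+ 2) <=
      C * (1 + expR (- (Num.sqrt b / eps) * s) / eps ^+ 4)].
Proof.
pose F := itg (-1) 1 (fun x => f x ^+ 2).
pose F2 := itg (-1) 1 (fun x => f2 x ^+ 2).
have F0 : 0 <= F by apply: itg_ge0 => *; apply: sqr_ge0.
have F20 : 0 <= F2 by apply: itg_ge0 => *; apply: sqr_ge0.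
have [Mf hMf] := H1_bound m11 hf; have [Mf1 hMf1] := H1_bound m11 hf1.
have Mf0 : 0 <= Mf by apply: le_trans (hMf 1 _); rewrite ?m11 ?lexx.
have Mf10 : 0 <= Mf1 by apply: le_trans (hMf1 1 _); rewrite ?m11 ?lexx.
(* [D / eps ^+ 2] bounds the oscillation of [q]: the interval has length 2 and the integral of
   [Z ^+ 2] is at most [4 * F / eps ^+ 4]. *)
pose D := Num.sqrt (8 * F).
have D0 : 0 <= D by exact: sqrtr_ge0.
have D2 : D ^+ 2 = 8 * F by rewrite sqr_sqrtr // mulr_ge0.
pose K := (b * D + Mf1) * Mf.
have K0 : 0 <= K by rewrite mulr_ge0 // addr_ge0 // mulr_ge0 // ltW.
have bi : 0 <= b^-1 by rewrite invr_ge0 ltW.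
pose C := 4 * F + 2 * D + 6 * b^-1 * (b^-1 * F2) + 6 * b^-1 * (2 * K) + 1.
have ct1 : 0 <= 6 * b^-1 * (b^-1 * F2) by rewrite !mulr_ge0.
have ct2 : 0 <= 6 * b^-1 * (2 * K) by apply: mulr_ge0; exact: mulr_ge0.
exists C; first by rewrite /C; lra.
move=> eps u /andP[e0 e1] ws.
have lf := H1_L2 m11 hf.
have [q [hu hq]] := weak_solution_regular e0 lf ws.
have u2 := solution_L2_le b0 hf ws.
have lu := H1_L2 m11 hu.
pose Z x := (eps ^+ 2)^-1 * (b * u x - f x).
pose Y x := (eps ^+ 2)^-1 * (b * q x - f1 x).
have hZ : H1 (-1) 1 Z Y by apply: H1Z; apply: H1B => //; exact: H1Z.
have hY : H1 (-1) 1 Y (fun x => (eps ^+ 2)^-1 * (b * Z x - f2 x)).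
  by apply: H1Z; apply: H1B => //; exact: H1Z.
have e2 : 0 < eps ^+ 2 by rewrite exprn_gt0.
have e4 : 0 < eps ^+ 4 by rewrite exprn_gt0.
have ZL : itg (-1) 1 (fun x => Z x ^+ 2) <= 4 * F / eps ^+ 4.
  apply: (@le_trans _ _ (itg (-1) 1 (fun x => (eps ^+ 4)^-1 * (2 * b ^+ 2 * u x ^+ 2 + 2 * f x ^+ 2)))).
    have ii : L1 (-1) 1 (fun x => 2 * b ^+ 2 * u x ^+ 2 + 2 * f x ^+ 2).
      by apply: L1D; apply: L1Z; [exact: lu.2|exact: lf.2].
    apply: itg_le; [exact: hq.1.2|exact: L1Z|].
    move=> x _; have -> : Z x ^+ 2 = (eps ^+ 4)^-1 * (b * u x + - f x) ^+ 2.
      by rewrite /Z; field; rewrite gt_eqF.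
    apply: ler_wpM2l; first by rewrite invr_ge0 ltW.
    have := sqrD_le (b * u x) (- f x); lra.
  rewrite itgZ; last by apply: L1D; apply: L1Z; [exact: lu.2|exact: lf.2].
  rewrite itgD; [|exact: L1Z lu.2|exact: L1Z lf.2].
  rewrite (itgZ _ lu.2) (itgZ _ lf.2) mulrC ler_wpM2r ?invr_ge0 ?(ltW e4) // -/F.
  rewrite -/F in u2; lra.
have iZ0 : 0 <= itg (-1) 1 (fun x => Z x ^+ 2) by apply: itg_ge0 => *; exact: sqr_ge0.
have qinc x y : -1 <= x -> x <= y -> y <= 1 -> `|q y - q x| <= D / eps ^+ 2.
  move=> x1 xy y1; apply: norm_le_sqr; first by rewrite divr_ge0 // ltW.
  apply: le_trans (H1_holder hq x1 xy y1) _.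
  have s1 : itg x y (fun t => Z t ^+ 2) <= itg (-1) 1 (fun t => Z t ^+ 2).
    by apply: itg_sub_le => //; [exact: hq.1.2|move=> *; exact: sqr_ge0].
  have -> : (D / eps ^+ 2) ^+ 2 = 2 * (4 * F / eps ^+ 4).
    by rewrite expr_div_n D2; field; rewrite gt_eqF.
  apply: (@le_trans _ _ (2 * itg x y (fun t => Z t ^+ 2))).
    by apply: ler_wpM2r; [apply: itg_ge0 => *; exact: sqr_ge0|lra].
  by rewrite ler_pM2l //; apply: le_trans ZL.
(* Since [u] vanishes at both ends, [q] has mean zero and is bounded by its oscillation. *)
have qmean : itg (-1) 1 q = 0.
  have [g [_ ua ub _]] := weak_solutionP ws.
  by rewrite -(H1_inc hu) // ua ub subrr.
have lq := H1_L2 m11 hq.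
have qb x : -1 <= x <= 1 -> `|q x| <= D / eps ^+ 2.
  move=> /andP[x1 x2].
  have : `|itg (-1) 1 (fun t => q x - q t)| <= itg (-1) 1 (fun=> D / eps ^+ 2).
    have ii : L1 (-1) 1 (fun t => q x - q t) by apply: L1B; [exact: L1_cst|exact: L2_L1].
    apply: le_trans (itg_norm ii) _; apply: itg_le; [exact: L1_norm|exact: L1_cst|].
    move=> t /andP[t1 t2]; have [tx|xt] := leP t x; first exact: qinc.
    by rewrite distrC; apply: qinc => //; exact: ltW.
  rewrite itgB; [|exact: L1_cst|exact: L2_L1].
  rewrite qmean !itg_cst // subr0 normrM (_ : 1 - -1 = 2); last by ring.
  by rewrite normr_nat ler_pM2r.
exists q, Z; split => //.
- apply: le_trans ZL _; apply: ler_wpM2r; first by rewrite invr_ge0 ltW.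
  rewrite /C; lra.
- move=> x /andP[x1 x2].
  have [g [_ ua ub _]] := weak_solutionP ws.
  rewrite hu.2 ?x1 // ua add0r.
  have iq := L1_sub (lexx (-1)) x2 (L2_L1 lq).
  apply: le_trans (itg_norm iq) _.
  apply: (@le_trans _ _ (itg (-1) x (fun=> D / eps ^+ 2))).
    apply: itg_le; [exact: L1_norm|exact: L1_cst|].
    by move=> t /andP[t1 t2]; apply: qb; rewrite t1 (le_trans t2).
  rewrite itg_cst //.
  have h0 : 0 <= D / eps ^+ 2 by rewrite divr_ge0 // ltW.
  apply: (@le_trans _ _ (D / eps ^+ 2 * 2)); first by apply: ler_wpM2l => //; lra.
  rewrite mulrAC; apply: ler_wpM2r; first by rewrite invr_ge0 ltW.
  rewrite /C; lra.
- move=> s s01; set l := Num.sqrt b / eps.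
  have l0 : 0 < l by rewrite divr_gt0 // sqrtr_gt0.
  have el : (eps * l) ^+ 2 = b.
    by rewrite /l mulrC divfK ?gt_eqF // sqr_sqrtr // ltW.
  have := interior_estimate b0 e0 l0 el s01 hZ hf1.1 hY.
  rewrite -/F2; set E := expR _; set X := itg _ _ _ => h.
  have E0 : 0 <= E by exact: expR_ge0.
  have YZ x : x = 1 \/ x = -1 -> `|Y x * Z x| <= K / eps ^+ 6.
    move=> hx; have xi : -1 <= x <= 1 by case: hx => ->; rewrite ?lexx ?m11.
    have ux : u x = 0.
      have [g [_ ua ub _]] := weak_solutionP ws; by case: hx => ->.
    have -> : Y x * Z x = (eps ^+ 4)^-1 * ((b * q x - f1 x) * (- f x)).
      by rewrite /Y /Z ux; field; rewrite gt_eqF.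
    rewrite !normrM normrN (gtr0_norm (_ : 0 < (eps ^+ 4)^-1)) ?invr_gt0 //.
    have -> : K / eps ^+ 6 = (eps ^+ 4)^-1 * ((b * D + Mf1) / eps ^+ 2 * Mf).
      by rewrite /K; field; rewrite gt_eqF.
    apply: ler_wpM2l; first by rewrite invr_ge0 ltW.
    apply: ler_pM => //; last exact: hMf.
    apply: le_trans (ler_normB _ _) _; rewrite mulrDl; apply: lerD.
      by rewrite normrM gtr0_norm // -mulrA; apply: ler_wpM2l; [exact: ltW|exact: qb].
    apply: le_trans (hMf1 x xi) _; rewrite ler_peMr //.
    by rewrite invf_ge1 // exprn_ile1 // ltW.
  have h2 : eps ^+ 2 * E * (`|Y 1 * Z 1| + `|Y (-1) * Z (-1)|) <= 2 * K * (E / eps ^+ 4).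
    apply: (@le_trans _ _ (eps ^+ 2 * E * (K / eps ^+ 6 + K / eps ^+ 6))).
      apply: ler_wpM2l; first by rewrite mulr_ge0 // ltW.
      by apply: lerD; apply: YZ; [left|right].
    rewrite le_eqVlt; apply/orP; left; apply/eqP.
    by field; rewrite gt_eqF.
  have G0 : 0 <= E / eps ^+ 4 by rewrite divr_ge0 // ltW.
  move: h2 h; set G := E / eps ^+ 4 in G0 * => h2 h.
  have h3 : X <= 6 * b^-1 * (b^-1 * F2) + 6 * b^-1 * (2 * K) * G.
    have : b / 6 * X <= b^-1 * F2 + 2 * K * G by apply: le_trans h _; rewrite lerD2l.
    move=> /(ler_wpM2l (_ : 0 <= 6 * b^-1)) h4.
    have -> : X = 6 * b^-1 * (b / 6 * X) by field; rewrite gt_eqF.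
    apply: le_trans (h4 _) _; first by rewrite mulr_ge0.
    by rewrite le_eqVlt; apply/orP; left; apply/eqP; ring.
  apply: le_trans h3 _; rewrite mulrDr mulr1; apply: lerD.
    rewrite /C; lra.
  by apply: ler_wpM2r => //; rewrite /C; lra.
Qed.

End RegularBounds.

(** * Interpolation error *)

Section Glue.
Variable R : realType.
Implicit Types (a b c x : R) (f g h u : R -> R).
Local Notation mu := (@lebesgue_measure R).

Definition glue c g h x : R := if x <= c then g x else h x.

Lemma glue_l c g h x : x <= c -> glue c g h x = g x.
Proof. by rewrite /glue => ->. Qed.

Lemma glue_r c g h x : c < x -> glue c g h x = h x.
Proof. by rewrite /glue leNgt => ->. Qed.

Lemma itv_split a b c : a <= c -> c <= b ->
  `[a, b]%classic = `[a, c]%classic `|` `]c, b]%classic.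
Proof. by move=> ac cb; rewrite -itv_bndbnd_setU ?bnd_simp. Qed.

Lemma itv_disj a b c : [disjoint `[a, c]%classic & `]c, b]%classic].
Proof.
apply/disj_setPS => y [/=]; rewrite !in_itv /= => /andP[_ yc] /andP[cy _].
by move: (lt_le_trans cy yc); rewrite ltxx.
Qed.

Lemma meas_glue a b c g h : a <= c -> c <= b -> meas a c g -> meas c b h ->
  meas a b (glue c g h).
Proof.
move=> ac cb mg mh; rewrite /meas (itv_split ac cb); apply/measurable_funU => //; split.
  apply: eq_measurable_fun mg => x; rewrite inE /= in_itv /= => /andP[_ xc].
  by rewrite glue_l.
have mh' : measurable_fun `]c, b]%classic h.
  apply: measurable_funS mh => // x /=; rewrite !in_itv /= => /andP[/ltW -> ->] //.
apply: eq_measurable_fun mh' => x; rewrite inE /= in_itv /= => /andP[cx _].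
by rewrite glue_r.
Qed.

Lemma L1_oc c b h : L1 c b h -> mu.-integrable `]c, b] (EFin \o h).
Proof.
by apply: integrableS => // x /=; rewrite !in_itv /= => /andP[/ltW -> ->].
Qed.

Lemma L1_glue a b c g h : a <= c -> c <= b -> L1 a c g -> L1 c b h ->
  L1 a b (glue c g h).
Proof.
move=> ac cb ig ih; apply/integrableP; split.
  by apply/measurable_EFinP; apply: meas_glue => //; exact: L1_meas.
have m : measurable_fun (`[a, c]%classic `|` `]c, b]%classic) (fun x => `|(EFin \o glue c g h) x|%E).
  apply: measurableT_comp => //; rewrite -itv_split //; apply/measurable_EFinP.
  by apply: meas_glue => //; exact: L1_meas.
rewrite (itv_split ac cb) ge0_integral_setU //; last exact: itv_disj.
apply: lte_add_pinfty.
  move/integrableP : ig => [_]; apply: le_lt_trans.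
  rewrite le_eqVlt; apply/orP; left; apply/eqP; apply: eq_integral => x.
  by rewrite inE /= in_itv /= => /andP[_ xc]; rewrite /= glue_l.
move/L1_oc/integrableP : ih => [_]; apply: le_lt_trans.
rewrite le_eqVlt; apply/orP; left; apply/eqP; apply: eq_integral => x.
by rewrite inE /= in_itv /= => /andP[cx _]; rewrite /= glue_r.
Qed.

Lemma itg_glue_r c b g h : L1 c b h -> itg c b (glue c g h) = itg c b h.
Proof.
move=> ih; rewrite /itg.
have io := L1_oc ih.
have ig : mu.-integrable `]c, b] (EFin \o glue c g h).
  apply: eq_integrable io => // x; rewrite inE /= in_itv /= => /andP[cx _].
  by rewrite /= glue_r.
rewrite -Rintegral_itv_obnd_cbnd // -[RHS]Rintegral_itv_obnd_cbnd //.
by apply: eq_Rintegral => x; rewrite inE /= in_itv /= => /andP[cx _]; rewrite glue_r.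
Qed.

Lemma itg_glue a b c g h : a <= c -> c <= b -> L1 a c g -> L1 c b h ->
  itg a b (glue c g h) = itg a c g + itg c b h.
Proof.
move=> ac cb ig ih; rewrite (@itg_cat _ a b c) //; last exact: L1_glue.
rewrite itg_glue_r //; congr (_ + _); apply: itg_eq => x /andP[_ xc].
by rewrite glue_l.
Qed.

Lemma L2_glue a b c g h : a <= c -> c <= b -> L2 a c g -> L2 c b h ->
  L2 a b (glue c g h).
Proof.
move=> ac cb [mg ig] [mh ih]; split; first exact: meas_glue.
apply: L1_ext (L1_glue ac cb ig ih) => x _; rewrite /glue; by case: ifP.
Qed.

Lemma itg_glue_sqr a b c g h : a <= c -> c <= b -> L2 a c g -> L2 c b h ->
  itg a b (fun x => glue c g h x ^+ 2) =
  itg a c (fun x => g x ^+ 2) + itg c b (fun x => h x ^+ 2).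
Proof.
move=> ac cb [mg ig] [mh ih]; rewrite -itg_glue //.
by apply: itg_eq => x _; rewrite /glue; case: ifP.
Qed.

(** Both pieces belong to the same function [u], which encodes the continuity at [c]. *)
Lemma H1_glue a b c u g h : a <= c -> c <= b -> H1 a c u g -> H1 c b u h ->
  H1 a b u (glue c g h).
Proof.
move=> ac cb hg hh; split; first exact: L2_glue hg.1 hh.1.
move=> x /andP[ax xb]; have [xc|/ltW cx] := leP x c.
  rewrite hg.2 ?ax //; congr (_ + _); apply: itg_eq => t /andP[_ tx].
  by rewrite glue_l // (le_trans tx).
have ih := L1_sub (lexx c) xb (L2_L1 hh.1).
rewrite (itg_glue ac cx (L2_L1 hg.1) ih) addrA -hg.2 ?ac ?lexx //.
by rewrite hh.2 // cx.
Qed.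

End Glue.

Section MeshError.
Variables (R : realType).
Implicit Types (a b c d e x : R) (u v w q Z N : R -> R).

(** Let [h = b - a] and let [A] be the integral of [|v''|]. Then [v'] is within [A] of its mean,
    which is within [2 e / h] of the slope of [N]; integrating from [a], where the error is at most
    [e], gives [|w| <= h A + 3 e]. These pointwise bounds are squared with [A^2 <= h * itg a b Z^2],
    which yields the factors [18 = 2 * 3^2] and [8 = 2 * 2^2]. *)
Lemma cell_error a b e v q Z N (y0 y1 : R) : a < b -> 0 <= e ->
  H1 a b v q -> H1 a b q Z ->
  `|y0 - v a| <= e -> `|y1 - v b| <= e ->
  (forall x, a <= x <= b -> N x = y0 + (y1 - y0) / (b - a) * (x - a)) ->
  let w x := v x - N x in
  exists g, [/\ H1 a b w g,
    itg a b (fun x => w x ^+ 2) <=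
      2 * (b - a) ^+ 4 * itg a b (fun x => Z x ^+ 2) + 18 * e ^+ 2 * (b - a) &
    itg a b (fun x => g x ^+ 2) <=
      2 * (b - a) ^+ 2 * itg a b (fun x => Z x ^+ 2) + 8 * e ^+ 2 / (b - a)].
Proof.
move=> ab e0 hv hq hy0 hy1 hN w; have ab' := ltW ab.
set h := b - a; have h0 : 0 < h by rewrite subr_gt0.
have hne : h != 0 by rewrite gt_eqF.
pose s := (y1 - y0) / h; pose g x := q x - s.
have lq := H1_L2 ab' hq.
have hid : H1 a b (fun x => s * (x - a)) (fun=> s).
  split; first exact: L2_cst.
  by move=> x /andP[ax _]; rewrite itg_cst //; ring.
have hw : H1 a b w g.
  apply: (H1_ext (u := fun x => v x - (s * (x - a) + y0)) (g := fun x => q x - (s + 0))).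
  - by move=> x hx; rewrite /w hN // /s /h; ring.
  - by move=> x _; rewrite addr0.
  - apply: H1B => //; apply: H1D => //.
    by split; [exact: L2_cst|move=> x /andP[ax _]; rewrite itg_cst //; ring].
pose A := itg a b (fun x => `|Z x|).
have A0 : 0 <= A by apply: itg_ge0.
have A2 : A ^+ 2 <= h * itg a b (fun x => Z x ^+ 2) by exact: cauchy_schwarz1 hq.1.
have iZ := L1_norm (L2_L1 hq.1).
have qd x t : a <= x -> x <= t -> t <= b -> `|q t - q x| <= A.
  move=> ax xt tb; rewrite (H1_inc hq) //.
  apply: le_trans (itg_norm (L1_sub ax tb (L2_L1 hq.1))) _.
  exact: itg_sub_le.
pose E := A + 2 * e / h.
have E0 : 0 <= E by rewrite addr_ge0 // divr_ge0 ?mulr_ge0 // ltW.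
have gb x : a <= x <= b -> `|g x| <= E.
  move=> /andP[ax xb].
  have k1 : `|h * q x - (v b - v a)| <= h * A.
    rewrite (H1_inc hv) //.
    have -> : h * q x - itg a b q = itg a b (fun t => q x - q t).
      by rewrite itgB; [rewrite itg_cst // mulrC|exact: L1_cst|exact: L2_L1].
    have ii : L1 a b (fun t => q x - q t) by apply: L1B; [exact: L1_cst|exact: L2_L1].
    apply: le_trans (itg_norm ii) _.
    rewrite mulrC -itg_cst //; apply: itg_le; [exact: L1_norm|exact: L1_cst|].
    move=> t /andP[at_ tb]; have [tx|/ltW xt] := leP t x; first exact: qd.
    by rewrite distrC; exact: qd.
  rewrite -(ler_pM2l h0) /E mulrDr -[h in h * `|_|](gtr0_norm h0) -normrM.
  have -> : h * g x = (h * q x - (v b - v a)) - ((y1 - v b) - (y0 - v a)).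
    by rewrite /g /s; field.
  apply: le_trans (ler_normB _ _) _; apply: lerD => //.
  have -> : h * (2 * e / h) = e + e by field.
  by apply: le_trans (ler_normB _ _) _; apply: lerD.
have wb x : a <= x <= b -> `|w x| <= h * A + 3 * e.
  move=> /andP[ax xb]; rewrite hw.2 ?ax //.
  apply: le_trans (ler_normD _ _) _.
  have w0 : `|w a| <= e.
    by rewrite /w hN ?lexx // subrr mulr0 addr0 distrC.
  have : `|itg a x g| <= E * h.
    have ig := L1_sub (lexx a) xb (L2_L1 hw.1).
    apply: le_trans (itg_norm ig) _.
    apply: (@le_trans _ _ (itg a x (fun=> E))).
      apply: itg_le; [exact: L1_norm|exact: L1_cst|].
      by move=> t /andP[t1 t2]; apply: gb; rewrite t1 (le_trans t2).
    by rewrite itg_cst //; apply: ler_wpM2l => //; rewrite /h; lra.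
  have -> : E * h = A * h + 2 * e by rewrite /E; field.
  lra.
set zeta := itg a b (fun x => Z x ^+ 2) in A2 *.
exists g; split => //.
- apply: (@le_trans _ _ (itg a b (fun=> (h * A + 3 * e) ^+ 2))).
    apply: itg_le; [exact: (H1_L2 ab' hw).2|exact: L1_cst|].
    move=> x /wb hx; rewrite -[leLHS]real_normK ?num_real // ler_pXn2r ?nnegrE //.
    by apply: le_trans hx.
  rewrite itg_cst // -/h.
  have k2 := sqrD_le (h * A) (3 * e).
  have k3 := ler_wpM2r (ltW h0) k2; apply: le_trans k3 _.
  have k4 : h ^+ 3 * A ^+ 2 <= h ^+ 3 * (h * zeta) by apply: ler_wpM2l; rewrite ?exprn_ge0 // ltW.
  have -> : (2 * (h * A) ^+ 2 + 2 * (3 * e) ^+ 2) * h = 2 * (h ^+ 3 * A ^+ 2) + 18 * e ^+ 2 * h by ring.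
  have -> : 2 * h ^+ 4 * zeta = 2 * (h ^+ 3 * (h * zeta)) by ring.
  lra.
- apply: (@le_trans _ _ (itg a b (fun=> E ^+ 2))).
    apply: itg_le; [exact: hw.1.2|exact: L1_cst|].
    by move=> x /gb hx; rewrite -[leLHS]real_normK ?num_real // ler_pXn2r ?nnegrE.
  rewrite itg_cst // -/h.
  have k3 := ler_wpM2r (ltW h0) (sqrD_le A (2 * e / h)); apply: le_trans k3 _.
  have k4 : h * A ^+ 2 <= h * (h * zeta) by apply: ler_wpM2l => //; exact: ltW.
  have -> : (2 * A ^+ 2 + 2 * (2 * e / h) ^+ 2) * h = 2 * (h * A ^+ 2) + 8 * e ^+ 2 / h by field.
  have -> : 2 * h ^+ 2 * zeta = 2 * (h * (h * zeta)) by ring.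
  lra.
Qed.

Lemma uniform_mesh_error a h e v q Z N (y : nat -> R) n : 0 < h -> 0 <= e ->
  let c := a + n%:R * h in
  H1 a c v q -> H1 a c q Z ->
  (forall k, (k <= n)%N -> `|y k - v (a + k%:R * h)| <= e) ->
  (forall k x, (k < n)%N -> a + k%:R * h <= x <= a + k.+1%:R * h ->
     N x = y k + (y k.+1 - y k) / h * (x - (a + k%:R * h))) ->
  let w x := v x - N x in
  exists g, [/\ H1 a c w g,
    itg a c (fun x => w x ^+ 2) <=
      2 * h ^+ 4 * itg a c (fun x => Z x ^+ 2) + 18 * e ^+ 2 * (n%:R * h) &
    itg a c (fun x => g x ^+ 2) <=
      2 * h ^+ 2 * itg a c (fun x => Z x ^+ 2) + 8 * e ^+ 2 * (n%:R / h)].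
Proof.
move=> h0 e0; elim: n => [|n IH] c hv hq hy hN w.
  exists (fun=> 0); rewrite /c mul0r addr0 !itg_pt !mulr0 mul0r !mulr0 addr0.
  split => //; split; first exact: L2_cst.
  by move=> x; rewrite -eq_le => /eqP <-; rewrite itg_pt addr0.
pose d := a + n%:R * h.
have cd : c = d + h by rewrite /c /d -natr1; ring.
have ad : a <= d by rewrite lerDl mulr_ge0 // ltW.
have dc : d < c by rewrite cd ltrDl.
have dc' := ltW dc.
have cdh : c - d = h by rewrite cd; ring.
have [g2 [hw2 e1 e2]] : exists g, [/\ H1 d c w g,
    itg d c (fun x => w x ^+ 2) <=
      2 * h ^+ 4 * itg d c (fun x => Z x ^+ 2) + 18 * e ^+ 2 * h &
    itg d c (fun x => g x ^+ 2) <=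
      2 * h ^+ 2 * itg d c (fun x => Z x ^+ 2) + 8 * e ^+ 2 / h].
  rewrite -[in 18 * e ^+ 2 * h]cdh -[in 8 * e ^+ 2 / h]cdh -[in h ^+ 4]cdh -[in h ^+ 2]cdh.
  apply: (@cell_error d c e v q Z N (y n) (y n.+1)) => //.
  - exact: H1_sub hv.
  - exact: H1_sub hq.
  - exact: hy.
  - exact: hy.
  - by move=> x hx; rewrite cdh; apply: hN.
have hv1 := H1_sub (lexx a) dc' hv; have hq1 := H1_sub (lexx a) dc' hq.
have [||g1 [hw1 e3 e4]] := IH hv1 hq1.
- by move=> k kn; apply: hy; apply: leq_trans kn _.
- by move=> k x kn; apply: hN; apply: leq_trans kn _.
rewrite -/d -/w in hw1 e3 e4.
exists (glue d g1 g2); split; first exact: H1_glue.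
- have iw1 := (H1_L2 ad hw1).2; have iw2 := (H1_L2 dc' hw2).2.
  have iw : L1 a c (fun x => w x ^+ 2) by apply: (H1_L2 _ (H1_glue ad dc' hw1 hw2)).2; exact: le_trans dc'.
  rewrite (itg_cat ad dc' iw) (itg_cat ad dc' hq.1.2) -(natr1 n); lra.
- rewrite (itg_glue_sqr ad dc' hw1.1 hw2.1) (itg_cat ad dc' hq.1.2) -(natr1 n) mulrDl; lra.
Qed.

End MeshError.

(** * The network on the layer-adapted mesh *)

Section NetworkApproximation.
Variable R : realType.

(** Greedy digits. The closed bound [2 ^- B] admits [t = 1], whose digits are all 1. *)
Lemma binary_expansion (B : nat) (t : R) : 0 <= t <= 1 ->
  exists bits : nat -> bool,
    0 <= t - \sum_(0 <= k < B) 2 ^- k.+1 * (bits k)%:R <= 2 ^- B.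
Proof.
move=> t01; elim: B => [|B [bits IH]].
  by exists (fun=> false); rewrite big_geq // subr0 expr0 invr1.
pose r := t - \sum_(0 <= k < B) 2 ^- k.+1 * (bits k)%:R.
pose bit := 2 ^- B.+1 <= r.
exists (fun k => if k == B then bit else bits k).
rewrite big_nat_recr //= eqxx.
have -> : \sum_(0 <= i < B) 2 ^- i.+1 * (if i == B then bit else bits i)%:R =
   \sum_(0 <= k < B) 2 ^- k.+1 * (bits k)%:R :> R.
  rewrite big_nat [RHS]big_nat; apply: eq_bigr => i /andP[_ iB].
  by rewrite ltn_eqF.
have e : 2 ^- B = 2 ^- B.+1 + 2 ^- B.+1 :> R.
  by rewrite exprS; field; rewrite expf_neq0 // pnatr_eq0.
move: IH; rewrite opprD addrA -/r e /bit; clear bit; move: r => r.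
by case: (leP (2 ^- B.+1) r) => h /=; rewrite ?mulr1 ?mulr0; lra.
Qed.

Variables (p B : nat) (sigma U : R) (v q Z : R -> R).
Hypotheses (p2 : (2 <= p)%N) (B0 : (0 < B)%N) (s0 : 0 < sigma) (s1 : sigma <= 2^-1).
Hypotheses (U0 : 0 < U) (hv : H1 (-1) 1 v q) (hq : H1 (-1) 1 q Z).
Hypothesis (vU : forall x, -1 <= x <= 1 -> `|v x| <= U).

(** The function [v] will be the solution in one regime and [f / b] in the other. [e] is the error
    of storing values from [[- U, U]] with [B] digits. [ZI] is paired with the fine step of the
    layer regions and [ZM] with the coarse step between them. *)
Lemma network_approx :
  let e := 2 * U / 2 ^+ B in
  let ZI := itg (-1) 1 (fun x => Z x ^+ 2) in
  let ZM := itg (-1 + sigma) (1 - sigma) (fun x => Z x ^+ 2) in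
  exists (Phi : network R) (g : R -> R),
    let w x := v x - realization Phi x in
    [/\ net_wf Phi, (width Phi <= 9)%N, (depth Phi <= 36 * (p * B))%N,
        (0 < net_size Phi <= 90 * (36 * (p * B)))%N &
     [/\ H1 (-1) 1 w g,
      itg (-1) 1 (fun x => w x ^+ 2) <=
        2 * (sigma / (2 * p * p)%:R) ^+ 4 * ZI + 2 * (2 / (2 * p * p)%:R) ^+ 4 * ZM + 36 * e ^+ 2 &
      itg (-1) 1 (fun x => g x ^+ 2) <=
        2 * (sigma / (2 * p * p)%:R) ^+ 2 * ZI + 2 * (2 / (2 * p * p)%:R) ^+ 2 * ZM +
        24 * e ^+ 2 * (2 * p * p)%:R ^+ 2 / sigma]].
Proof.
move=> e ZI ZM; have s2 : sigma * 2 <= 1 by rewrite -ler_pdivlMr // div1r.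
have sp := s0; have Up := U0.
have o1 : -1 <= -1 + sigma by lra.
have o2 : -1 + sigma <= 1 - sigma by lra.
have o3 : 1 - sigma <= 1 by lra.
have o12 : -1 <= 1 - sigma by lra.
have m11 : (-1 : R) <= 1 by lra.
have [K eK] : {K : nat | K = (2 * p * p)%N} by exists (2 * p * p)%N.
rewrite -eK.
have Kn0 : (0 < K)%N by rewrite eK !muln_gt0 /= (leq_trans _ p2).
have K0 : 0 < K%:R :> R by rewrite ltr0n.
pose h1 : R := sigma / K%:R; pose h2 : R := (2 - 2 * sigma) / K%:R.
have h10 : 0 < h1 by rewrite divr_gt0.
have h20 : 0 < h2 by rewrite divr_gt0 //; lra.
have Kh1 : K%:R * h1 = sigma by rewrite /h1 mulrC divfK // gt_eqF.
have Kh2 : K%:R * h2 = 2 - 2 * sigma by rewrite /h2 mulrC divfK // gt_eqF.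
(* Neighbouring regions share an end node, which belongs to the earlier branch; therefore [node2]
   and [node3] have to check [k = 0] separately. *)
pose node (k : nat) : R :=
  if (k <= K)%N then -1 + k%:R * h1
  else if (k <= 2 * K)%N then -1 + sigma + (k%:R - K%:R) * h2
  else 1 - sigma + (k%:R - 2 * K%:R) * h1.
have node1 k : (k <= K)%N -> node k = -1 + k%:R * h1 by rewrite /node => ->.
have node2 k : (k <= K)%N -> node (K + k)%N = -1 + sigma + k%:R * h2.
  move=> kK; rewrite /node; case: leqP => h; last first.
    rewrite (_ : (K + k <= 2 * K)%N); last by rewrite mul2n -addnn leq_add2l.
    by rewrite natrD; ring.
  have -> : k = 0%N by (move: h; clear; lia) || (move: h'; clear; lia).
  by rewrite addn0 Kh1; ring.
have node3 k : (k <= K)%N -> node (2 * K + k)%N = 1 - sigma + k%:R * h1.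
  move=> kK; rewrite /node; case: leqP => h; first by move: h Kn0; clear; lia.
  case: leqP => h'; last by rewrite natrD natrM; ring.
  have -> : k = 0%N by (move: h; clear; lia) || (move: h'; clear; lia).
  by rewrite addn0 natrM mul0r -[2%:R * _ - _](_ : K%:R = _) ?Kh2; ring.
have kh (k : nat) (h S : R) : 0 < h -> K%:R * h = S -> (k <= K)%N -> 0 <= k%:R * h <= S.
  by move=> hh <- kK; rewrite mulr_ge0 ?ler_wpM2r ?ler_nat // ltW.
have nodeI k : (k <= 3 * K)%N -> -1 <= node k <= 1.
  move=> k3; have [kK|kK] := leqP k K.
    by rewrite node1 //; have := kh k h1 _ h10 Kh1 kK; lra.
  have [kK2|kK2] := leqP k (2 * K).
    have -> : k = (K + (k - K))%N by rewrite subnKC // ltnW.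
    have kd : (k - K <= K)%N by move: kK2; clear; lia.
    rewrite node2 //.
    by have := kh (k - K)%N h2 _ h20 Kh2 kd; lra.
  have -> : k = (2 * K + (k - 2 * K))%N by rewrite subnKC // ltnW.
  have kd : (k - 2 * K <= K)%N by move: k3; clear; lia.
  rewrite node3 //.
  by have := kh (k - 2 * K)%N h1 _ h10 Kh1 kd; lra.
have [nb hnb] : exists nb : nat -> nat -> bool, forall k, (k <= 3 * K)%N ->
   `|2 * U * nodal R B nb k - U - v (node k)| <= e.
  have /choice[nb hnb] : forall k, exists bits : nat -> bool, (k <= 3 * K)%N ->
     `|2 * U * (\sum_(0 <= b < B) 2 ^- b.+1 * (bits b)%:R) - U - v (node k)| <= e.
    move=> k; have [k3|k3] := leqP k (3 * K); last by exists (fun=> false).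
    have := vU (nodeI k k3); rewrite ler_norml => /andP[v1 v2].
    have [|bits hb] := @binary_expansion B ((v (node k) + U) / (2 * U)).
      rewrite divr_ge0 /=; [|lra|lra].
      by rewrite ler_pdivrMr; lra.
    exists bits => _; set S := \sum_(_ <= _ < _) _ in hb *.
    have -> : 2 * U * S - U - v (node k) = - (2 * U * ((v (node k) + U) / (2 * U) - S)).
      by field; rewrite gt_eqF.
    case/andP: hb => hb1 hb2.
    rewrite normrN ger0_norm; last by rewrite mulr_ge0 //; lra.
    by rewrite /e; apply: ler_wpM2l; [lra|].
  by exists nb.
pose y k := 2 * U * nodal R B nb k - U.
(* The slopes are [h1^-1], [h2^-1], [h1^-1] on the three regions, given by their jumps, so that node
   [k] is sent to [k]. *)
pose T := warp h1^-1 (h2^-1 - h1^-1) (h1^-1 - h2^-1) (-1) (-1 + sigma) (1 - sigma).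
have sc : 2 * U != 0 by rewrite gt_eqF // mulr_gt0.
(* With [m = 2 * p] the network stores [2 * m * m = 4 * K] nodal values, enough for the [3 * K + 1]
   nodes of the mesh; the other values are arbitrary. *)
have m4 : (4 <= 2 * p)%N by rewrite (leq_mul2l 2 2).
have [Phi [wf wd dp sz rl]] := @interp_network R B nb (2 * p) h1^-1 (h2^-1 - h1^-1)
   (h1^-1 - h2^-1) (-1) (-1 + sigma) (1 - sigma) (2 * U) (- U) B0 m4 sc.
rewrite -/T in rl.
have e36 : (18 * (2 * p * B) = 36 * (p * B))%N by rewrite -(mulnA 2) mulnA.
rewrite e36 in dp sz.
have cell k x : (k < 3 * K)%N -> k%:R <= T x <= k.+1%:R ->
    realization Phi x = y k + (y k.+1 - y k) * (T x - k%:R).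
  move=> kK hT; rewrite rl; last by case/andP: hT => hT _; apply: le_trans hT.
  rewrite (@interpE R B nb _ k) //; last first.
    by apply: (leq_ltn_trans kK); rewrite eK; move: p2; clear; nia.
  by rewrite /y; ring.
have T1 x : -1 <= x <= -1 + sigma -> T x = (x + 1) / h1.
  move=> hx; rewrite /T /warp (relu_le0 (y := x - (-1 + sigma))); last lra.
  rewrite (relu_le0 (y := x - (1 - sigma))); last lra.
  by rewrite relu_id ?mulr0 ?addr0; [rewrite opprK mulrC|lra].
have i1 : K%:R = sigma / h1 by rewrite -Kh1 mulfK // gt_eqF.
have i2 : K%:R = (2 - 2 * sigma) / h2 by rewrite -Kh2 mulfK // gt_eqF.
have T2 x : -1 + sigma <= x <= 1 - sigma -> T x = K%:R + (x - (-1 + sigma)) / h2.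
  move=> hx; rewrite /T /warp (relu_le0 (y := x - (1 - sigma))); last lra.
  rewrite !relu_id; [|lra|lra].
  by rewrite i1; ring.
have T3 x : 1 - sigma <= x <= 1 -> T x = 2 * K%:R + (x - (1 - sigma)) / h1.
  move=> hx; rewrite /T /warp !relu_id; [|lra|lra|lra].
  by rewrite mulr_natl mulr2n {1}i1 i2; ring.
pose w x := v x - realization Phi x.
have region (a h S : R) (o : nat) : 0 < h -> K%:R * h = S -> -1 <= a -> a + S <= 1 ->
   (o + K <= 3 * K)%N -> (forall k, (k <= K)%N -> node (o + k)%N = a + k%:R * h) ->
   (forall x, a <= x <= a + S -> T x = o%:R + (x - a) / h) ->
   exists g, [/\ H1 a (a + S) w g,
    itg a (a + S) (fun x => w x ^+ 2) <=
      2 * h ^+ 4 * itg a (a + S) (fun x => Z x ^+ 2) + 18 * e ^+ 2 * S &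
    itg a (a + S) (fun x => g x ^+ 2) <=
      2 * h ^+ 2 * itg a (a + S) (fun x => Z x ^+ 2) + 8 * e ^+ 2 * (K%:R / h)].
  move=> hh hS a1 aS oK nd hT; rewrite -hS.
  have e0 : 0 <= e by rewrite divr_ge0 ?exprn_ge0 ?mulr_ge0 // ltW.
  apply: (@uniform_mesh_error R a h e v q Z (realization Phi) (fun k => y (o + k)%N) K) => //.
  - by rewrite hS; apply: H1_sub hv.
  - by rewrite hS; apply: H1_sub hq.
  - move=> k kK; rewrite -nd //; apply: hnb.
    by apply: leq_trans oK; rewrite leq_add2l.
  - move=> k x kK /andP[x1 x2].
    have hh' := gt_eqF hh.
    have k1 : a + k.+1%:R * h <= a + S by rewrite -hS lerD2l ler_wpM2r ?ler_nat // ltW.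
    have k0 : a <= a + k%:R * h by rewrite lerDl mulr_ge0 // ltW.
    have Tx : T x = o%:R + (x - a) / h.
      by apply: hT; rewrite (le_trans k0 x1) (le_trans x2).
    rewrite (@cell (o + k)%N).
    + rewrite addnS Tx natrD; field; exact/negbT.
    + by apply: leq_trans oK; rewrite ltn_add2l.
    + rewrite Tx -addnS !natrD !lerD2l ler_pdivlMr // ler_pdivrMr //.
      by move: x1 x2; clear -p2 B0 s0 s1 U0 hv hq vU => x1 x2; apply/andP; split; lra.
have [g1 [hw1 a1 b1]] : exists g, [/\ H1 (-1) (-1 + sigma) w g,
    itg (-1) (-1 + sigma) (fun x => w x ^+ 2) <=
      2 * h1 ^+ 4 * itg (-1) (-1 + sigma) (fun x => Z x ^+ 2) + 18 * e ^+ 2 * sigma &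
    itg (-1) (-1 + sigma) (fun x => g x ^+ 2) <=
      2 * h1 ^+ 2 * itg (-1) (-1 + sigma) (fun x => Z x ^+ 2) + 8 * e ^+ 2 * (K%:R / h1)].
  apply: (@region _ _ _ 0%N) => //; [lra|by rewrite add0n leq_pmull|].
  by move=> x hx; rewrite T1 // add0r opprK.
have [g2 [hw2 a2 b2]] : exists g, [/\ H1 (-1 + sigma) (1 - sigma) w g,
    itg (-1 + sigma) (1 - sigma) (fun x => w x ^+ 2) <=
      2 * h2 ^+ 4 * itg (-1 + sigma) (1 - sigma) (fun x => Z x ^+ 2) + 18 * e ^+ 2 * (2 - 2 * sigma) &
    itg (-1 + sigma) (1 - sigma) (fun x => g x ^+ 2) <=
      2 * h2 ^+ 2 * itg (-1 + sigma) (1 - sigma) (fun x => Z x ^+ 2) + 8 * e ^+ 2 * (K%:R / h2)].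
  have -> : 1 - sigma = -1 + sigma + (2 - 2 * sigma) by ring.
  apply: (@region _ _ _ K) => //; [lra|by rewrite addnn -mul2n leq_mul2r orbT|].
  have -> : -1 + sigma + (2 - 2 * sigma) = 1 - sigma by ring.
  exact: T2.
have [g3 [hw3 a3 b3]] : exists g, [/\ H1 (1 - sigma) 1 w g,
    itg (1 - sigma) 1 (fun x => w x ^+ 2) <=
      2 * h1 ^+ 4 * itg (1 - sigma) 1 (fun x => Z x ^+ 2) + 18 * e ^+ 2 * sigma &
    itg (1 - sigma) 1 (fun x => g x ^+ 2) <=
      2 * h1 ^+ 2 * itg (1 - sigma) 1 (fun x => Z x ^+ 2) + 8 * e ^+ 2 * (K%:R / h1)].
  rewrite -[X in H1 _ X](subrK sigma) -[X in itg _ X](subrK sigma).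
  apply: (@region _ _ _ (2 * K)%N) => //; [lra|by rewrite -mulSnr|].
  by move=> x; rewrite subrK => hx; rewrite T3 ?natrM.
have hw12 := H1_glue o1 o2 hw1 hw2.
have hw := H1_glue o12 o3 hw12 hw3.
exists Phi, (glue (1 - sigma) (glue (-1 + sigma) g1 g2) g3); split => //.
have iw := (H1_L2 m11 hw).2; have iw12 := (H1_L2 o12 hw12).2.
have iZ := hq.1.2; have iZ12 := L1_sub (lexx (-1)) o3 iZ.
have eZ : ZI = itg (-1) (-1 + sigma) (fun x => Z x ^+ 2) + ZM + itg (1 - sigma) 1 (fun x => Z x ^+ 2).
  by rewrite /ZI (itg_cat o12 o3 iZ) (itg_cat o1 o2 iZ12).
have ZM0 : 0 <= ZM by apply: itg_ge0 => *; exact: sqr_ge0.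
have h22 : h2 <= 2 / K%:R by rewrite ler_pM2r ?invr_gt0 //; move: sp; clear -p2 B0 s0 s1 U0 hv hq vU; lra.
have h24 : h2 ^+ 4 <= (2 / K%:R) ^+ 4 by rewrite ler_pXn2r // nnegrE ltW // divr_gt0.
have h23 : h2 ^+ 2 <= (2 / K%:R) ^+ 2 by rewrite ler_pXn2r // nnegrE ltW // divr_gt0.
rewrite -/h1; split => //.
- rewrite (itg_cat o12 o3 iw) (itg_cat o1 o2 iw12).
  have p1 := ler_wpM2r ZM0 h24.
  have p2' : 0 <= h1 ^+ 4 * ZM by rewrite mulr_ge0 // exprn_ge0 // ltW.
  rewrite eZ -/w; rewrite -/ZM in a2; move: a1 a2 a3 p1 p2'; clear -p2 B0 s0 s1 U0 hv hq vU; lra.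
- rewrite (itg_glue_sqr o12 o3 hw12.1 hw3.1) (itg_glue_sqr o1 o2 hw1.1 hw2.1).
  have p1 := ler_wpM2r ZM0 h23.
  have p2' : 0 <= h1 ^+ 2 * ZM by rewrite mulr_ge0 // exprn_ge0 // ltW.
  (* [h1] is the smaller step because [sigma <= 2 - 2 * sigma], so each of the three regions has a
     quantization term of at most [8 * e ^+ 2 * (K / h1)]. *)
  have Kh : K%:R / h2 <= K%:R / h1.
    rewrite ler_pM2l // lef_pV2 ?posrE // /h1 /h2 ler_pM2r ?invr_gt0 //; move: s2; clear -p2 B0 s0 s1 U0 hv hq vU; lra.
  have p3 := ler_wpM2l (sqr_ge0 e) Kh.
  have -> : 24 * e ^+ 2 * K%:R ^+ 2 / sigma = 24 * (e ^+ 2 * (K%:R / h1)).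
    by rewrite /h1; field; rewrite !gt_eqF.
  rewrite eZ; rewrite -/ZM in b2; move: b1 b2 b3 p1 p2' p3; clear -p2 B0 s0 s1 U0 hv hq vU; lra.
Qed.

End NetworkApproximation.

(** * Choice of the parameters *)

Section MeshParameters.
Variable R : realType.

Lemma pow2_ge_expR (n : nat) (x : R) : 2 * x <= n%:R -> expR x <= 2 ^+ n.
Proof.
move=> h; have e2 : expR 2^-1 <= 2 :> R.
  have := expR_ge1Dx (- 2^-1 : R); rewrite expRN => h1.
  have E0 := expR_gt0 (2^-1 : R).
  have : expR 2^-1 * (1 + - 2^-1) <= expR 2^-1 * (expR 2^-1)^-1 :> R by rewrite ler_pM2l.
  by rewrite divff ?gt_eqF //; lra.
have : expR (n%:R * 2^-1) <= 2 ^+ n :> R.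
  by rewrite expRM_natl; apply: lerXn2r; rewrite ?nnegrE ?expR_ge0.
by apply: le_trans; rewrite ler_expR; lra.
Qed.

(** Let [L = - ln tau]. [p] is of order [A (1 + L) e^{L/2}]; this exceeds the requirement on [K] by
    a factor of order [A (1 + L)] and avoids a square root. [B] is about [2 (G + 13 L)]: here
    [e^{10 L}] compensates [tau ^+ 10], [e^{3 L}] dominates the growth of [K], and [e^G] the
    constant. In [p * B] the factor [(1 + L)^2] is absorbed by [e^{2 s L}] with
    [2 s = alpha - 1/2]. *)
Lemma mesh_parameters (A H alpha : R) : 1 <= A -> 0 <= H -> 2^-1 < alpha ->
  exists2 Cn, 0 < Cn & forall tau, 0 < tau <= 1 -> exists p B : nat,
    let K : R := (2 * p * p)%:R in
    [/\ (2 <= p)%N, (0 < B)%N, A * (1 - ln tau) <= tau * K,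
        H * K <= tau ^+ 10 * 2 ^+ B & (p * B)%:R <= Cn * tau `^ (- alpha)].
Proof.
move=> A1 H0 al; pose G := 18 * H * A ^+ 2; pose s := (alpha - 2^-1) / 2.
have s0 : 0 < s by rewrite divr_gt0 // subr_gt0.
have G0 : 0 <= G by apply: mulr_ge0; [exact: mulr_ge0|exact: sqr_ge0].
have si : 0 < s^-1 by rewrite invr_gt0.
exists (3 * A * (2 * G + 27) * (1 + s^-1) ^+ 2).
  apply: mulr_gt0; last by rewrite exprn_gt0 //; lra.
  by apply: mulr_gt0; lra.
move=> tau /andP[t0 t1]; pose L := - ln tau.
have L0 : 0 <= L by rewrite oppr_ge0 ln_le0.
have tE : tau = expR (- L) by rewrite opprK lnK // posrE.
have -> : 1 - ln tau = 1 + L by [].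
pose r := A * (1 + L) * expR (L / 2).
have eL : 1 + L <= expR L by exact: expR_ge1Dx.
have eL2 : 1 <= expR (L / 2) by rewrite -[leLHS]expR0 ler_expR divr_ge0.
have r1 : 1 <= r.
  have : 1 <= A * (1 + L) by rewrite -[leLHS]mulr1 ler_pM //; lra.
  by move=> h; rewrite -[leLHS]mulr1 ler_pM.
have r0 : 0 <= r by apply: le_trans r1.
pose p := (Num.truncn r).+2.
pose B := (Num.truncn (2 * (G + 13 * L))).+1.
have pl : r <= p%:R by apply/ltW/(lt_trans (truncnS_gt r)); rewrite ltr_nat.
have pu : p%:R <= 3 * r.
  have : (Num.truncn r)%:R <= r by rewrite truncn_le.
  by rewrite /p -addn2 natrD; lra.
have y0 : 0 <= 2 * (G + 13 * L) by rewrite mulr_ge0 // addr_ge0 // mulr_ge0.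
have Bl : 2 * (G + 13 * L) <= B%:R by apply/ltW/truncnS_gt.
have Bu : B%:R <= (2 * G + 27) * (1 + L).
  have : (Num.truncn (2 * (G + 13 * L)))%:R <= 2 * (G + 13 * L) by rewrite truncn_le.
  have GL : 0 <= G * L by rewrite mulr_ge0.
  by rewrite /B -natr1; lra.
have p0 : 0 <= p%:R :> R by [].
have eE : expR (L / 2) ^+ 2 = expR L by rewrite -expRM_natl; congr expR; field.
have tL : tau * expR L = 1 by rewrite tE -expRD addNr expR0.
have K2 : (2 * p * p)%:R = 2 * p%:R ^+ 2 :> R by rewrite !natrM -mulrA.
have r2 : r ^+ 2 = A ^+ 2 * (1 + L) ^+ 2 * expR L by rewrite /r !exprMn eE.
exists p, B; rewrite /= K2; split => //.
- have h1 : r ^+ 2 <= p%:R ^+ 2 by rewrite ler_pXn2r ?nnegrE.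
  apply: (@le_trans _ _ (tau * (2 * r ^+ 2))); last first.
    by apply: ler_wpM2l; [exact: ltW|rewrite ler_pM2l].
  have -> : tau * (2 * r ^+ 2) = 2 * (A * (1 + L)) ^+ 2 * (tau * expR L).
    by rewrite r2; ring.
  rewrite tL mulr1.
  have : 1 <= A * (1 + L) by rewrite -[leLHS]mulr1 ler_pM //; lra.
  by nra.
- have h1 : p%:R ^+ 2 <= (3 * r) ^+ 2 by rewrite ler_pXn2r ?nnegrE // mulr_ge0.
  have h2 : 2 * p%:R ^+ 2 <= 18 * A ^+ 2 * expR (3 * L).
    have -> : expR (3 * L) = expR L ^+ 3 by rewrite expRM_natl.
    have h3 : (1 + L) ^+ 2 <= expR L ^+ 2 by rewrite ler_pXn2r ?nnegrE ?expR_ge0 //; lra.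
    have h4 : A ^+ 2 * (1 + L) ^+ 2 * expR L <= A ^+ 2 * expR L ^+ 2 * expR L.
      by apply: ler_wpM2r; [exact: expR_ge0|apply: ler_wpM2l => //; exact: sqr_ge0].
    have -> : 18 * A ^+ 2 * expR L ^+ 3 = 18 * (A ^+ 2 * expR L ^+ 2 * expR L) by ring.
    move: h1; rewrite exprMn r2; lra.
  have h3 : G * expR (3 * L) <= tau ^+ 10 * 2 ^+ B.
    have -> : tau ^+ 10 = expR (- (10 * L)) by rewrite tE -expRM_natl; congr expR; ring.
    have h5 := pow2_ge_expR Bl.
    apply: (@le_trans _ _ (expR (- (10 * L)) * expR (G + 13 * L))); last first.
      by rewrite ler_pM2l ?expR_gt0.
    rewrite -expRD (_ : - (10 * L) + (G + 13 * L) = G + 3 * L); last by ring.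
    rewrite expRD ler_pM2r ?expR_gt0 //.
    by apply: le_trans (expR_ge1Dx G); rewrite lerDr.
  apply: le_trans h3.
  have -> : G * expR (3 * L) = H * (18 * A ^+ 2 * expR (3 * L)) by rewrite /G; ring.
  exact: ler_wpM2l.
- rewrite natrM.
  have -> : tau `^ (- alpha) = expR (L / 2) * expR (s * L) ^+ 2.
    by rewrite /powR gt_eqF // -expRM_natl -expRD; congr expR; rewrite /s /L; field.
  have eS : 1 + L <= (1 + s^-1) * expR (s * L).
    have h := expR_ge1Dx (s * L).
    have sl : 0 <= s * L by rewrite mulr_ge0 // ltW.
    have : (1 + s^-1) * (1 + s * L) <= (1 + s^-1) * expR (s * L).
      by rewrite ler_pM2l //; lra.
    apply: le_trans.
    have -> : (1 + s^-1) * (1 + s * L) = 1 + L + s * L + s^-1 by field; rewrite gt_eqF.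
    lra.
  have h1 : (1 + L) ^+ 2 <= ((1 + s^-1) * expR (s * L)) ^+ 2.
    by rewrite ler_pXn2r ?nnegrE ?mulr_ge0 ?expR_ge0 //; lra.
  have h2 : p%:R * B%:R <= 3 * r * ((2 * G + 27) * (1 + L)) by exact: ler_pM.
  apply: le_trans h2 _.
  have -> : 3 * r * ((2 * G + 27) * (1 + L)) =
     3 * A * (2 * G + 27) * expR (L / 2) * (1 + L) ^+ 2 by rewrite /r; ring.
  have -> : 3 * A * (2 * G + 27) * (1 + s^-1) ^+ 2 * (expR (L / 2) * expR (s * L) ^+ 2)
    = 3 * A * (2 * G + 27) * expR (L / 2) * ((1 + s^-1) * expR (s * L)) ^+ 2 by ring.
  by apply: ler_wpM2l => //; rewrite !mulr_ge0 ?expR_ge0 //; lra.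
Qed.

End MeshParameters.

(** Used to absorb constants: a coefficient [Q] is paid for by one of the [n] factors [A] gained
    from a finer mesh. *)
Lemma exprM_le (R : realType) (x t A Q : R) (n : nat) : (0 < n)%N ->
  0 <= x -> 1 <= A -> x * A <= t -> Q <= A -> x ^+ n * Q <= t ^+ n.
Proof.
move=> n0 x0 A1 xA QA; have A0 : 0 <= A by apply: le_trans A1.
have xA0 : 0 <= x * A by rewrite mulr_ge0.
apply: (@le_trans _ _ ((x * A) ^+ n)); last by apply: lerXn2r; rewrite ?nnegrE // (le_trans xA0).
rewrite exprMn; apply: ler_wpM2l; first exact: exprn_ge0.
by apply: le_trans QA _; case: n n0 => // n _; rewrite exprS ler_peMr // exprn_ege1.
Qed.

(** * The two regimes of [eps] *)

Section Regimes.
Variables (R : realType) (b : R) (f f1 f2 : R -> R).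
Hypotheses (b0 : 0 < b) (hf : H1 (-1) 1 f f1) (hf1 : H1 (-1) 1 f1 f2).

Let m11 : (-1 : R) <= 1. Proof. lra. Qed.

(** A squared [L^2] error of [kappa * tau ^+ 4] contributes at most [tau ^+ 2 / 2] to the squared
    energy norm, as [kappa * b <= 1/2], and keeps the [L^2] norm below [tau ^+ 2], as
    [kappa <= 1]. *)
Definition kappa : R := (2 * (1 + b))^-1.

Lemma kappa_gt0 : 0 < kappa.
Proof. by have h := b0; rewrite invr_gt0; lra. Qed.

Definition approximates (p B : nat) (tau eps : R) (u : R -> R) : Prop :=
  exists (Phi : network R) (g : R -> R),
    let w x := u x - realization Phi x in
    [/\ net_wf Phi, (width Phi <= 9)%N, (depth Phi <= 36 * (p * B))%N,
        (0 < net_size Phi <= 90 * (36 * (p * B)))%N &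
     [/\ H1 (-1) 1 w g,
      itg (-1) 1 (fun x => w x ^+ 2) <= kappa * tau ^+ 4 &
      eps ^+ 2 * itg (-1) 1 (fun x => g x ^+ 2) <= tau ^+ 2 / 2]].

(** [A0] and [H0] are only lower bounds for [A] and [H], so that one mesh serves both regimes. The
    power [tau ^+ 10] is dictated by quantization: the a priori bound of [u] is [O(eps^-2)], here at
    most [O(tau^-8)], and the quantization error times the number of cells has to be [O(tau^2)]. *)
Lemma resolved_regime (rho : R) : 0 < rho <= 1 ->
  exists A0 H0 : R, forall A H tau eps (p B : nat),
  A0 <= A -> 1 <= A -> H0 <= H -> 0 < H -> 0 < tau <= 1 -> 0 < eps <= 1 ->
  (2 <= p)%N -> (0 < B)%N ->
  A * (1 - ln tau) <= tau * (2 * p * p)%:R ->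
  H * (2 * p * p)%:R <= tau ^+ 10 * 2 ^+ B ->
  rho * tau ^+ 4 <= eps ->
  forall u, weak_solution eps b f u -> approximates p B tau eps u.
Proof.
move=> /andP[r0 r1]; have k0 := kappa_gt0; have bp := b0.
have [Cr Cr0 hreg] := regular_bounds b0 hf hf1.
have lr : ln rho <= 0 by rewrite ln_le0.
have sb : 0 < Num.sqrt b by rewrite sqrtr_gt0.
(* For [sigma = c * eps * l] the exponential [expR (- (Num.sqrt b / eps) * sigma)] is then at most
   [(rho * tau ^+ 4) ^+ 4], because [ln rho * ln tau >= 0], and hence at most [eps ^+ 4]. *)
pose c := (16 - 4 * ln rho) / Num.sqrt b.
have c0 : 0 < c by rewrite divr_gt0 //; lra.
have hc : c * Num.sqrt b = 16 - 4 * ln rho by rewrite divfK // gt_eqF.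
clearbody c; have ci : 0 < c^-1 by rewrite invr_gt0.
(* [Q1] and [Q2] collect the interpolation constants of the function and of its derivative, [S] the
   quantization constants of both. *)
pose Q1 := 2 * c ^+ 4 * Cr + 32 * (Cr * (2 + (2 * c) ^+ 4)).
pose Q2 := 2 * c ^+ 2 * Cr + 8 * (Cr * (2 + (2 * c) ^+ 2)).
pose S := 1 + 72 / kappa + 96 * (2 + c^-1).
have Q10 : 0 <= Q1.
  have p1 : 0 <= c ^+ 4 * Cr by rewrite mulr_ge0 ?exprn_ge0 // ltW.
  have p2 : 0 <= Cr * (2 + (2 * c) ^+ 4).
    apply: mulr_ge0; first exact: ltW.
    by apply: addr_ge0 => //; apply: exprn_ge0; apply: mulr_ge0 => //; exact: ltW.
  by rewrite /Q1; lra.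
have Q20 : 0 <= Q2.
  have p1 : 0 <= c ^+ 2 * Cr by rewrite mulr_ge0 ?exprn_ge0 // ltW.
  have p2 : 0 <= Cr * (2 + (2 * c) ^+ 2).
    apply: mulr_ge0; first exact: ltW.
    by apply: addr_ge0 => //; apply: exprn_ge0; apply: mulr_ge0 => //; exact: ltW.
  by rewrite /Q2; lra.
have ki : 0 < kappa^-1 by rewrite invr_gt0.
exists (Q1 * (2 / kappa) + Q2 * 4), (2 * Cr / rho ^+ 2 * S).
move=> A H tau eps p B QA A1 QH H0 /andP[t0 t1] e01 p2 B0 hA hH re u ws.
have /andP[e0 e1] := e01.
have [q [Z [hu hq ZIe uU ZMe]]] := hreg eps u e01 ws.
set l := 1 - ln tau in hA.
have lt0 : ln tau <= 0 by rewrite ln_le0.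
have l1 : 1 <= l by rewrite lerBrDr gerDl.
have lp : 0 < l by exact: lt_le_trans l1.
pose sigma := Num.min 2^-1 (c * eps * l).
have cel : 0 < c * eps * l by rewrite !mulr_gt0.
have s0 : 0 < sigma by rewrite lt_min cel invr_gt0 ltr0n.
have s1 : sigma <= 2^-1 by rewrite ge_min lexx.
have s2 : sigma <= c * eps * l by rewrite ge_min lexx orbT.
have e2 : 0 < eps ^+ 2 by rewrite exprn_gt0.
have e4 : 0 < eps ^+ 4 by rewrite exprn_gt0.
have U0 : 0 < Cr / eps ^+ 2 by rewrite divr_gt0.
have := @network_approx R p B sigma _ u q Z p2 B0 s0 s1 U0 hu hq uU.
set e := 2 * (Cr / eps ^+ 2) / 2 ^+ B; set ZI := itg (-1) 1 (fun x => Z x ^+ 2) in ZIe *.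
set ZM := itg _ _ _; set k : R := (2 * p * p)%:R in hA hH *.
move=> /= [Phi [g [wf wd dp sz [hw nw ng]]]].
have K1 : 1 <= k by rewrite ler1n !muln_gt0 /= (leq_trans _ p2).
have kp : 0 < k by apply: lt_le_trans K1.
have kn : k != 0 by rewrite gt_eqF.
have en : eps != 0 by rewrite gt_eqF.
have ZM0 : 0 <= ZM by apply: itg_ge0 => *; exact: sqr_ge0.
have [ZMb ZMb2] : ZM <= Cr * (2 + (2 * c * l) ^+ 4) /\
    eps ^+ 2 * ZM <= Cr * (2 + (2 * c * l) ^+ 2).
  have cl0 : 0 <= 2 * c * l by rewrite !mulr_ge0 // ltW.
  (* If the cap 1/2 is active, then [eps^-1 <= 2 * c * l], and the global bound [Cr / eps ^+ 4] is
     already of logarithmic size. *)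
  have [small|big] := leP (c * eps * l) 2^-1.
    have es : sigma = c * eps * l by apply/min_idPr.
    have sI : 0 <= sigma <= 1.
      by rewrite (ltW s0) (le_trans s1) // invf_le1 ?ler1n.
    have hE : expR (- (Num.sqrt b / eps) * sigma) / eps ^+ 4 <= 1.
      rewrite ler_pdivrMr // mul1r.
      have -> : - (Num.sqrt b / eps) * sigma = - (16 - 4 * ln rho) * l.
        by rewrite es -hc; field.
      have rt0 : 0 < rho * tau ^+ 4 by rewrite mulr_gt0 // exprn_gt0.
      apply: (@le_trans _ _ ((rho * tau ^+ 4) ^+ 4)); last first.
        by apply: lerXn2r => //; rewrite nnegrE ltW.
      rewrite -[leRHS]lnK; last by rewrite posrE exprn_gt0.
      rewrite ler_expR lnXn // lnM ?posrE ?exprn_gt0 // lnXn // /l.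
      have : 0 <= ln rho * ln tau by rewrite mulr_le0.
      by move: lr; clear -b0 hf hf1 m11; lra.
    have hM : ZM <= Cr * 2.
      apply: le_trans (ZMe sigma sI) _; rewrite ler_pM2l //.
      by rewrite (_ : 2 = 1 + 1) ?lerD2l //; ring.
    split.
      apply: le_trans hM _; rewrite ler_pM2l // lerDl exprn_ge0 //.
    have h1 : eps ^+ 2 * ZM <= ZM by rewrite ler_piMl // exprn_ile1 // ltW.
    apply: le_trans h1 _; apply: le_trans hM _; rewrite ler_pM2l // lerDl exprn_ge0 //.
  have ei : eps^-1 <= 2 * c * l.
    have h : 2^-1 * 2 * eps^-1 <= c * eps * l * 2 * eps^-1.
      by rewrite ler_pM2r ?invr_gt0 // ler_pM2r // ltW.
    move: h; rewrite mulVf ?pnatr_eq0 // mul1r => h; apply: le_trans h _.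
    by rewrite le_eqVlt; apply/orP; left; apply/eqP; field.
  have eip : 0 <= eps^-1 by rewrite invr_ge0 ltW.
  have hM : ZM <= Cr / eps ^+ 4.
    apply: le_trans ZIe; apply: itg_sub_le.
    - by rewrite lerDl ltW.
    - by move: s1; rewrite -div1r ler_pdivlMr //; clear -b0 hf hf1 m11; lra.
    - by rewrite gerBl ltW.
    - exact: hq.1.2.
    - by move=> *; exact: sqr_ge0.
  split.
    apply: le_trans hM _; rewrite ler_pM2l // -exprVn.
    apply: le_trans (_ : _ <= (2 * c * l) ^+ 4) _; first by apply: lerXn2r.
    by rewrite lerDr.
  apply: le_trans (ler_wpM2l (ltW e2) hM) _.
  have -> : eps ^+ 2 * (Cr / eps ^+ 4) = Cr * eps^-1 ^+ 2 by field.
  rewrite ler_pM2l //.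
  apply: le_trans (_ : _ <= (2 * c * l) ^+ 2) _; first by apply: lerXn2r.
  by rewrite lerDr.
(* [x] is the mesh size up to the logarithm [l], and [x * A <= tau]. [y] below is the quantization
   error divided by [1 / k], and [y * S <= tau ^+ 2]. *)
pose x := l / k.
have x0 : 0 <= x by apply: divr_ge0; exact: ltW.
have xA : x * A <= tau by rewrite /x mulrAC ler_pdivrMr // mulrC.
have p1 : x ^+ 4 * (Q1 * (2 / kappa)) <= tau ^+ 4.
  apply: exprM_le A1 xA _ => //; apply: le_trans QA; rewrite lerDl mulr_ge0 //.
have p2' : x ^+ 2 * (Q2 * 4) <= tau ^+ 2.
  apply: exprM_le A1 xA _ => //; apply: le_trans QA.
  by rewrite lerDr mulr_ge0 // mulr_ge0 // ltW.
have B2 : 0 < 2 ^+ B :> R by rewrite exprn_gt0.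
have ee0 : 0 <= e by apply: divr_ge0; [apply: mulr_ge0 => //|]; exact: ltW.
pose y := e * k.
have y0 : 0 <= y by rewrite mulr_ge0 // ltW.
have S1 : 1 <= S.
  have q1 : 0 <= 72 / kappa by apply: mulr_ge0 => //; exact: ltW.
  have q2 : 0 <= 96 * (2 + c^-1) by apply: mulr_ge0 => //; apply: addr_ge0 => //; exact: ltW.
  by rewrite /S -addrA lerDl addr_ge0.
have yS : y * S <= tau ^+ 2.
  have h1 : y * H <= 2 * Cr / rho ^+ 2 * tau ^+ 2.
    have -> : y * H = 2 * Cr / eps ^+ 2 * ((H * k) / 2 ^+ B).
      by rewrite /y /e; field; rewrite en gt_eqF.
    have h2 : (H * k) / 2 ^+ B <= tau ^+ 10 by rewrite ler_pdivrMr.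
    have h3 : 2 * Cr / eps ^+ 2 <= 2 * Cr / (rho * tau ^+ 4) ^+ 2.
      have rt0 : 0 < rho * tau ^+ 4 by rewrite mulr_gt0 // exprn_gt0.
      rewrite ler_pM2l ?mulr_gt0 // lef_pV2 ?posrE ?exprn_gt0 //.
      by apply: lerXn2r; rewrite ?nnegrE // ltW.
    apply: le_trans (ler_pM _ _ h3 h2) _.
    - by apply: divr_ge0; [apply: mulr_ge0 => //|]; exact: ltW.
    - by apply: divr_ge0; [apply: mulr_ge0|]; exact: ltW.
    - rewrite le_eqVlt; apply/orP; left; apply/eqP; field.
      by rewrite (gt_eqF r0) (gt_eqF t0).
  have W0 : 0 < 2 * Cr / rho ^+ 2 by rewrite divr_gt0 ?mulr_gt0 ?exprn_gt0.
  rewrite -(ler_pM2l W0); apply: le_trans h1.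
  have -> : 2 * Cr / rho ^+ 2 * (y * S) = y * (2 * Cr / rho ^+ 2 * S) by ring.
  exact: ler_wpM2l.
have p3 : y ^+ 2 * (72 / kappa) <= tau ^+ 4.
  rewrite (_ : tau ^+ 4 = (tau ^+ 2) ^+ 2); last by rewrite -exprM.
  apply: exprM_le S1 yS _ => //; rewrite /S.
  have : 0 <= 96 * (2 + c^-1) by rewrite mulr_ge0 // addr_ge0 // ltW.
  clear -b0 hf hf1 m11; lra.
have p4 : y ^+ 2 * (96 * (2 + c^-1)) <= tau ^+ 4.
  rewrite (_ : tau ^+ 4 = (tau ^+ 2) ^+ 2); last by rewrite -exprM.
  apply: exprM_le S1 yS _ => //; rewrite /S.
  have : 0 <= 72 / kappa by rewrite mulr_ge0 // ltW.
  clear -b0 hf hf1 m11; lra.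
have t42 : tau ^+ 4 <= tau ^+ 2.
  by apply: ler_wiXn2l => //; exact: ltW.
have ey : e ^+ 2 <= y ^+ 2.
  by apply: lerXn2r; rewrite ?nnegrE // /y ler_peMr.
have x1k : (2 / k) <= 2 * x by rewrite /x mulrA ler_pM2r ?invr_gt0 // ler_peMr.
have kx : k^-1 <= x by rewrite /x ler_peMl // invr_ge0 ltW.
have ki0 : 0 <= k^-1 by rewrite invr_ge0 ltW.
have sk : sigma / k <= c * eps * x.
  by rewrite /x mulrA ler_pM2r ?invr_gt0.
have sk0 : 0 <= sigma / k by apply: divr_ge0; exact: ltW.
have ZI0 : 0 <= ZI by apply: itg_ge0 => *; exact: sqr_ge0.
exists Phi, g; split => //; split => //.
- apply: le_trans nw _.
  have a1 : (sigma / k) ^+ 4 * ZI <= c ^+ 4 * Cr * x ^+ 4.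
    have h1 : (sigma / k) ^+ 4 <= (c * eps * x) ^+ 4.
      by apply: lerXn2r; rewrite ?nnegrE // (le_trans sk0).
    apply: le_trans (ler_pM (exprn_ge0 _ sk0) ZI0 h1 ZIe) _.
    by rewrite le_eqVlt; apply/orP; left; apply/eqP; field.
  have a2 : (2 / k) ^+ 4 * ZM <= 16 * (Cr * (2 + (2 * c) ^+ 4)) * x ^+ 4.
    have h1 : 2 + (2 * c * l) ^+ 4 <= (2 + (2 * c) ^+ 4) * l ^+ 4.
      have -> : (2 + (2 * c) ^+ 4) * l ^+ 4 = 2 * l ^+ 4 + (2 * c * l) ^+ 4 by ring.
      by rewrite lerD2r ler_peMr // exprn_ege1.
    have h2 : ZM <= Cr * ((2 + (2 * c) ^+ 4) * l ^+ 4).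
      by apply: le_trans ZMb _; rewrite ler_pM2l.
    apply: le_trans (ler_wpM2l _ h2) _; first by rewrite exprn_ge0 // divr_ge0 // ltW.
    by rewrite /x le_eqVlt; apply/orP; left; apply/eqP; ring.
  have -> : kappa * tau ^+ 4 = kappa / 2 * tau ^+ 4 + kappa / 2 * tau ^+ 4 by field.
  apply: lerD; last first.
    have h := ler_wpM2l (ltW (divr_gt0 k0 (ltr0n R 2))) p3.
    apply: le_trans h; have -> : kappa / 2 * (y ^+ 2 * (72 / kappa)) = 36 * y ^+ 2.
      by field; rewrite gt_eqF.
    by rewrite ler_pM2l.
  have h := ler_wpM2l (ltW (divr_gt0 k0 (ltr0n R 2))) p1.
  apply: le_trans h; have -> : kappa / 2 * (x ^+ 4 * (Q1 * (2 / kappa))) = x ^+ 4 * Q1.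
    by field; rewrite gt_eqF.
  rewrite /Q1; move: a1 a2; clear -b0 hf hf1 m11; lra.
- apply: le_trans (ler_wpM2l (ltW e2) ng) _.
  have a1 : eps ^+ 2 * ((sigma / k) ^+ 2 * ZI) <= c ^+ 2 * Cr * x ^+ 2.
    have h1 : (sigma / k) ^+ 2 <= (c * eps * x) ^+ 2.
      by apply: lerXn2r; rewrite ?nnegrE // (le_trans sk0).
    apply: le_trans (ler_wpM2l (ltW e2) (ler_pM (exprn_ge0 _ sk0) ZI0 h1 ZIe)) _.
    by rewrite le_eqVlt; apply/orP; left; apply/eqP; field.
  have a2 : eps ^+ 2 * ((2 / k) ^+ 2 * ZM) <= 4 * (Cr * (2 + (2 * c) ^+ 2)) * x ^+ 2.
    have h1 : 2 + (2 * c * l) ^+ 2 <= (2 + (2 * c) ^+ 2) * l ^+ 2.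
      have -> : (2 + (2 * c) ^+ 2) * l ^+ 2 = 2 * l ^+ 2 + (2 * c * l) ^+ 2 by ring.
      by rewrite lerD2r ler_peMr // exprn_ege1.
    have h2 : eps ^+ 2 * ZM <= Cr * ((2 + (2 * c) ^+ 2) * l ^+ 2).
      by apply: le_trans ZMb2 _; rewrite ler_pM2l.
    have -> : eps ^+ 2 * ((2 / k) ^+ 2 * ZM) = (2 / k) ^+ 2 * (eps ^+ 2 * ZM) by ring.
    apply: le_trans (ler_wpM2l _ h2) _; first by rewrite exprn_ge0 // divr_ge0 // ltW.
    by rewrite /x le_eqVlt; apply/orP; left; apply/eqP; ring.
  (* The quantization error of the derivative carries the factor [1 / sigma], which the weight
     [eps ^+ 2] of the energy norm compensates in both cases of the minimum. *)
  have es : eps ^+ 2 / sigma <= 2 + c^-1.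
    rewrite ler_pdivrMr //.
    have [small|big] := leP (c * eps * l) 2^-1.
      have -> : sigma = c * eps * l by apply/min_idPr.
      have -> : (2 + c^-1) * (c * eps * l) = (2 * c * eps + eps) * l.
        by field; rewrite gt_eqF.
      have ce : 0 <= 2 * c * eps by rewrite !mulr_ge0 // ltW.
      have h1 : eps ^+ 2 <= eps by rewrite expr2 ler_piMl // ltW.
      have h2 : 2 * c * eps + eps <= (2 * c * eps + eps) * l by rewrite ler_peMr // addr_ge0 // ltW.
      move: ce h1 h2; clear -b0 hf hf1 m11; lra.
    have -> : sigma = 2^-1 by apply/min_idPl; exact: ltW.
    have h1 : eps ^+ 2 <= 1 by rewrite exprn_ile1 // ltW.
    have : 0 <= c^-1 * 2^-1 by rewrite mulr_ge0 // ?invr_ge0 // ltW.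
    by rewrite mulrDl divff ?pnatr_eq0 //; move: h1; clear -b0 hf hf1 m11; lra.
  have a3 : eps ^+ 2 * (24 * e ^+ 2 * k ^+ 2 / sigma) <= 24 * (y ^+ 2 * (2 + c^-1)).
    have -> : eps ^+ 2 * (24 * e ^+ 2 * k ^+ 2 / sigma) = 24 * (y ^+ 2 * (eps ^+ 2 / sigma)).
      by rewrite /y; field; rewrite gt_eqF.
    by rewrite ler_pM2l //; apply: ler_wpM2l => //; exact: sqr_ge0.
  have -> : eps ^+ 2 * (2 * (sigma / k) ^+ 2 * ZI + 2 * (2 / k) ^+ 2 * ZM + 24 * e ^+ 2 * k ^+ 2 / sigma)
   = 2 * (eps ^+ 2 * ((sigma / k) ^+ 2 * ZI)) + 2 * (eps ^+ 2 * ((2 / k) ^+ 2 * ZM))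
     + eps ^+ 2 * (24 * e ^+ 2 * k ^+ 2 / sigma) by ring.
  move: a1 a2 a3 p2' p4 t42; rewrite /Q2; clear -b0 hf hf1 m11; lra.
Qed.
(* Here the boundary layers are negligible in both norms, and [f / b] is
   approximated in place of [u]. *)
Lemma unresolved_regime : exists rho A0 H0 : R, 0 < rho <= 1 /\
  forall A H tau eps (p B : nat),
  A0 <= A -> 1 <= A -> H0 <= H -> 0 < tau <= 1 -> 0 < eps <= 1 ->
  (2 <= p)%N -> (0 < B)%N ->
  A * (1 - ln tau) <= tau * (2 * p * p)%:R ->
  H * (2 * p * p)%:R <= tau ^+ 10 * 2 ^+ B ->
  eps <= rho * tau ^+ 4 ->
  forall u, weak_solution eps b f u -> approximates p B tau eps u.
Proof.
have k0 := kappa_gt0; have bp := b0.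
have ki : 0 < (kappa)^-1 by rewrite invr_gt0.
have bi : 0 < b^-1 by rewrite invr_gt0.
have [Ce Ce0 hlay] := layer_energy b0 hf.
have [Mf hMf] := H1_bound m11 hf.
have Mf0 : 0 <= Mf by apply: le_trans (hMf 1 _); rewrite ?m11 ?lexx.
pose U := b^-1 * (Mf + 1).
have U0 : 0 < U by apply: mulr_gt0 => //; lra.
pose v x := b^-1 * f x; pose q x := b^-1 * f1 x; pose Z x := b^-1 * f2 x.
have hv : H1 (-1) 1 v q by exact: H1Z.
have hq : H1 (-1) 1 q Z by exact: H1Z.
have vU x : -1 <= x <= 1 -> `|v x| <= U.
  move=> /hMf h; rewrite /v normrM gtr0_norm // ler_pM2l //; lra.
clearbody U.
pose FB := itg (-1) 1 (fun x => Z x ^+ 2).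
have FB0 : 0 <= FB by apply: itg_ge0 => *; exact: sqr_ge0.
pose g1 := 4 * Ce * b^-1 ^+ 3 / kappa; pose g2 := 8 * Ce * b^-1 ^+ 2.
have g10 : 0 <= g1.
  apply: mulr_ge0; last exact: ltW.
  by apply: mulr_ge0; [apply: mulr_ge0 => //|apply: exprn_ge0]; exact: ltW.
have g20 : 0 <= g2.
  by apply: mulr_ge0; [apply: mulr_ge0 => //|apply: exprn_ge0]; exact: ltW.
have g1E : g1 * kappa = 4 * Ce * b^-1 ^+ 3 by rewrite divfK // gt_eqF.
(* [rho * g1 <= 1] and [rho * g2 <= 1] make the layer energy, at most [Ce * eps], fit into half of
   the budget [kappa * tau ^+ 4] and half of the budget [tau ^+ 2 / 2]. *)
pose rho := (1 + g1 + g2)^-1.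
have gp : 0 < 1 + g1 + g2 by lra.
have rp : 0 < rho by rewrite invr_gt0.
have rE : rho * (1 + g1 + g2) = 1 by rewrite mulVf // gt_eqF.
have r1 : rho <= 1 by rewrite invf_le1 //; lra.
(* [288 = 8 * 36] and [272 = 8 * 34] belong to the [L^2] bound, [768 = 16 * 48] and [160 = 16 * 10]
   to the derivative bound; 36, 34, 48 and 10 are the coefficients met below. *)
have [S3 S30 S3E] : exists2 z : R, 0 <= z & z * kappa = 288.
  exists (288 / kappa); last by rewrite divfK // gt_eqF.
  by apply: divr_ge0; [exact: ler0n|exact: ltW].
have [S4 S4E] : exists z : R, z = 768 by exists 768.
have [A3 A30 A3E] : exists2 z : R, 0 <= z & z * kappa = 272 * FB.
  exists (272 * FB / kappa); last by rewrite divfK // gt_eqF.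
  by apply: divr_ge0; [exact: (mulr_ge0 (ler0n R 272) FB0)|exact: ltW].
have [A4 A40 A4E] : exists2 z : R, 0 <= z & z = 160 * FB.
  by exists (160 * FB); first exact: (mulr_ge0 (ler0n R 160) FB0).
pose S := S3 + S4.
have S1 : 1 <= S by rewrite /S; lra.
have S40 : 0 <= S4 by rewrite S4E ler0n.
exists rho, (A3 + A4), (2 * U * S); split; first by rewrite rp r1.
have g2E : g2 = 8 * Ce * b^-1 ^+ 2 by [].
clearbody rho g1 g2.
move=> A H tau eps p B QA A1 QH /andP[t0 t1] /andP[e0 e1] p2 B0 hA hH re u ws.
set l := 1 - ln tau in hA.
have lt0 : ln tau <= 0 by rewrite ln_le0.
have l1 : 1 <= l by rewrite lerBrDr gerDl.
have lp : 0 < l by exact: lt_le_trans l1.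
have s0 : 0 < 2^-1 :> R by rewrite invr_gt0.
(* [f / b] has no layers, so the largest admissible [sigma] is taken; [ZI] and [ZM] are bounded
   independently of [eps]. *)
have := @network_approx R p B 2^-1 U v q Z p2 B0 s0 (lexx _) U0 hv hq vU.
set e := 2 * U / 2 ^+ B; rewrite -/FB; set ZM := itg (-1 + 2^-1) _ _.
set k : R := (2 * p * p)%:R in hA hH *.
move=> /= [Phi [g [wf wd dp sz [hw nw ng]]]].
have K1 : 1 <= k by rewrite ler1n !muln_gt0 /= (leq_trans _ p2).
have kp : 0 < k by apply: lt_le_trans K1.
have kn : k != 0 by rewrite gt_eqF.
have ZMF : ZM <= FB.
  have h2 : 2^-1 <= 1 :> R by rewrite invf_le1 ?ler1n.
  apply: itg_sub_le.
  - by rewrite lerDl ltW.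
  - have -> : 1 - 2^-1 = 2^-1 :> R by field.
    by rewrite gerDr lerN10.
  - by rewrite gerBl ltW.
  - exact: hq.1.2.
  - by move=> *; exact: sqr_ge0.
have ZM0 : 0 <= ZM by apply: itg_ge0 => *; exact: sqr_ge0.
pose x := l / k.
have x0 : 0 <= x by apply: divr_ge0; exact: ltW.
have xA : x * A <= tau by rewrite /x mulrAC ler_pdivrMr // mulrC.
have p1 : x ^+ 4 * A3 <= tau ^+ 4.
  by apply: exprM_le A1 xA _ => //; apply: le_trans QA; rewrite lerDl.
have p2' : x ^+ 2 * A4 <= tau ^+ 2.
  by apply: exprM_le A1 xA _ => //; apply: le_trans QA; rewrite lerDr.
have B2 : 0 < 2 ^+ B :> R by rewrite exprn_gt0.
have ee0 : 0 <= e by apply: divr_ge0; [apply: mulr_ge0 => //|]; exact: ltW.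
pose y := e * k.
have y0 : 0 <= y by apply: mulr_ge0 => //; exact: ltW.
have t10 : tau ^+ 10 <= tau ^+ 2 by apply: ler_wiXn2l => //; exact: ltW.
have yS : y * S <= tau ^+ 2.
  apply: le_trans t10.
  have h2 : (H * k) / 2 ^+ B <= tau ^+ 10 by rewrite ler_pdivrMr.
  apply: le_trans h2.
  have -> : y * S = (2 * U * S) * (k / 2 ^+ B) by rewrite /y /e; ring.
  rewrite -(mulrA H); apply: ler_wpM2r => //.
  by apply: divr_ge0; exact: ltW.
have p3 : y ^+ 2 * S3 <= tau ^+ 4.
  rewrite (_ : tau ^+ 4 = (tau ^+ 2) ^+ 2); last by rewrite -exprM.
  by apply: exprM_le S1 yS _ => //; rewrite /S lerDl.
have p4 : y ^+ 2 * S4 <= tau ^+ 4.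
  rewrite (_ : tau ^+ 4 = (tau ^+ 2) ^+ 2); last by rewrite -exprM.
  by apply: exprM_le S1 yS _ => //; rewrite /S lerDr.
have t42 : tau ^+ 4 <= tau ^+ 2 by apply: ler_wiXn2l => //; exact: ltW.
have ey : e ^+ 2 <= y ^+ 2 by apply: lerXn2r; rewrite ?nnegrE // /y ler_peMr.
have kx : k^-1 <= x by rewrite /x ler_peMl // invr_ge0 ltW.
have ki0 : 0 <= k^-1 by rewrite invr_ge0 ltW.
have kx4 : k^-1 ^+ 4 <= x ^+ 4 by apply: lerXn2r.
have kx2 : k^-1 ^+ 2 <= x ^+ 2 by apply: lerXn2r.
have W0 : itg (-1) 1 (fun x => (v x - realization Phi x) ^+ 2) <= kappa / 4 * tau ^+ 4.
  apply: le_trans nw _.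
  have a1 : 2 * (2^-1 / k) ^+ 4 * FB + 2 * (2 / k) ^+ 4 * ZM <= 34 * (x ^+ 4 * FB).
    have b1 : k^-1 ^+ 4 * ZM <= k^-1 ^+ 4 * FB by apply: ler_wpM2l => //; exact: exprn_ge0.
    have b2 : k^-1 ^+ 4 * FB <= x ^+ 4 * FB by apply: ler_wpM2r.
    have b3 : 0 <= k^-1 ^+ 4 * FB by apply: mulr_ge0 => //; exact: exprn_ge0.
    have -> : 2 * (2^-1 / k) ^+ 4 * FB = 8^-1 * (k^-1 ^+ 4 * FB).
      by move: (k^-1) => z; field.
    have -> : 2 * (2 / k) ^+ 4 * ZM = 32 * (k^-1 ^+ 4 * ZM) by ring.
    move: b1 b2 b3; clear -b0 hf hf1 m11; lra.
  have c1 : 34 * (x ^+ 4 * FB) = kappa / 8 * (x ^+ 4 * A3).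
    have -> : kappa / 8 * (x ^+ 4 * A3) = x ^+ 4 / 8 * (A3 * kappa) by ring.
    by rewrite A3E; field.
  have c2 : 36 * y ^+ 2 = kappa / 8 * (y ^+ 2 * S3).
    have -> : kappa / 8 * (y ^+ 2 * S3) = y ^+ 2 / 8 * (S3 * kappa) by ring.
    by rewrite S3E; field.
  have k8 : 0 <= kappa / 8 by apply: divr_ge0 => //; exact: ltW.
  have d1 := ler_wpM2l k8 p1; have d2 := ler_wpM2l k8 p3.
  rewrite -c1 in d1; rewrite -c2 in d2.
  have -> : kappa / 4 * tau ^+ 4 = kappa / 8 * tau ^+ 4 + kappa / 8 * tau ^+ 4 by field.
  move: a1 d1 d2 ey; clear -b0 hf hf1 m11; lra.
have G0 : itg (-1) 1 (fun x => g x ^+ 2) <= tau ^+ 2 / 8.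
  apply: le_trans ng _.
  have a1 : 2 * (2^-1 / k) ^+ 2 * FB + 2 * (2 / k) ^+ 2 * ZM <= 10 * (x ^+ 2 * FB).
    have b1 : k^-1 ^+ 2 * ZM <= k^-1 ^+ 2 * FB by apply: ler_wpM2l => //; exact: exprn_ge0.
    have b2 : k^-1 ^+ 2 * FB <= x ^+ 2 * FB by apply: ler_wpM2r.
    have b3 : 0 <= k^-1 ^+ 2 * FB by apply: mulr_ge0 => //; exact: exprn_ge0.
    have -> : 2 * (2^-1 / k) ^+ 2 * FB = 2^-1 * (k^-1 ^+ 2 * FB).
      by move: (k^-1) => z; field.
    have -> : 2 * (2 / k) ^+ 2 * ZM = 8 * (k^-1 ^+ 2 * ZM) by ring.
    move: b1 b2 b3; clear -b0 hf hf1 m11; lra.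
  have -> : 24 * e ^+ 2 * k ^+ 2 / 2^-1 = 48 * y ^+ 2 by rewrite /y invrK; ring.
  rewrite S4E in p4; rewrite A4E in p2'; move: a1 p2' p4 t42; clear -b0 hf hf1 m11; lra.
have [gu [hu u0 u1 hweak]] := weak_solutionP ws.
have e01 : 0 < eps <= 1 by rewrite e0.
have := hlay eps u gu e01 hu u0 u1 hweak.
pose W t := b * u t - f t; pose dW t := b * gu t - f1 t.
have hW : H1 (-1) 1 W dW by apply: H1B => //; exact: H1Z.
have lW := (H1_L2 m11 hW).2; have ldW := hW.1.2.
rewrite itgD; [|exact: L1Z|exact: L1Z].
rewrite !itgZ // => he.
set w0 := fun t => v t - realization Phi t in hw W0.
(* The error is [u - f / b = b^-1 * W], the layer part, plus the approximation error of [f / b]. *)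
have hww : H1 (-1) 1 (fun t => u t - realization Phi t) (fun t => b^-1 * dW t + g t).
  apply: H1_ext (H1D (H1Z b^-1 hW) hw) => // t _.
  by rewrite /W /w0 /v; field; rewrite gt_eqF.
have lw0 := (H1_L2 m11 hw).2; have lg := hw.1.2.
have bb : 0 <= b^-1 ^+ 2 by exact: sqr_ge0.
have I1 : 0 <= itg (-1) 1 (fun t => W t ^+ 2) by apply: itg_ge0 => *; exact: sqr_ge0.
have I2 : 0 <= itg (-1) 1 (fun t => dW t ^+ 2) by apply: itg_ge0 => *; exact: sqr_ge0.
have I3 : 0 <= itg (-1) 1 (fun t => g t ^+ 2) by apply: itg_ge0 => *; exact: sqr_ge0.
have T4 : 0 <= tau ^+ 4 by apply: exprn_ge0; exact: ltW.
have he' : Ce * eps <= Ce * (rho * tau ^+ 4) by rewrite ler_pM2l.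
exists Phi, (fun t => b^-1 * dW t + g t); split => //; split => //.
- have -> : itg (-1) 1 (fun t => (u t - realization Phi t) ^+ 2) =
     itg (-1) 1 (fun t => (b^-1 * W t + w0 t) ^+ 2).
    by apply: itg_eq => t _; rewrite /W /w0 /v; congr (_ ^+ 2); field; rewrite gt_eqF.
  have h1 : itg (-1) 1 (fun t => (b^-1 * W t + w0 t) ^+ 2) <=
     2 * b^-1 ^+ 2 * itg (-1) 1 (fun t => W t ^+ 2) + 2 * itg (-1) 1 (fun t => w0 t ^+ 2).
    rewrite -!itgZ // -itgD; [|exact: L1Z|exact: L1Z].
    apply: itg_le; [|by apply: L1D; exact: L1Z|].
      exact: (L2D (L2Z b^-1 (H1_L2 m11 hW)) (H1_L2 m11 hw)).2.
    by move=> t _; rewrite -mulrA -exprMn; exact: sqrD_le.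
  apply: le_trans h1 _.
  have h2 : b * itg (-1) 1 (fun t => W t ^+ 2) <= Ce * (rho * tau ^+ 4).
    have : 0 <= eps ^+ 2 * itg (-1) 1 (fun t => dW t ^+ 2) by apply: mulr_ge0 => //; exact: sqr_ge0.
    move: he he'; rewrite -/W -/dW; clear -b0 hf hf1 m11; lra.
  have b3 : 0 <= 2 * b^-1 ^+ 3 by apply: mulr_ge0 => //; apply: exprn_ge0; exact: ltW.
  have h3 := ler_wpM2l b3 h2.
  have e3 : 2 * b^-1 ^+ 3 * (b * itg (-1) 1 (fun t => W t ^+ 2)) =
    2 * b^-1 ^+ 2 * itg (-1) 1 (fun t => W t ^+ 2) by field; rewrite gt_eqF.
  have e4 : 2 * b^-1 ^+ 3 * (Ce * (rho * tau ^+ 4)) = (rho * g1) * (kappa / 2 * tau ^+ 4).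
    have -> : rho * g1 * (kappa / 2 * tau ^+ 4) = (g1 * kappa) * (rho * tau ^+ 4) / 2 by ring.
    by rewrite g1E; field; rewrite gt_eqF.
  have rg : rho * g1 <= 1.
    by rewrite -rE ler_pM2l //; move: g10 g20; clear -b0 hf hf1 m11; lra.
  have h4 : (rho * g1) * (kappa / 2 * tau ^+ 4) <= kappa / 2 * tau ^+ 4.
    by rewrite ler_piMl // mulr_ge0 // divr_ge0 // ltW.
  rewrite e3 e4 in h3.
  have -> : kappa * tau ^+ 4 = kappa / 2 * tau ^+ 4 + 2 * (kappa / 4 * tau ^+ 4) by field.
  move: h3 h4 W0; clear -b0 hf hf1 m11; lra.
- have h1 : itg (-1) 1 (fun t => (b^-1 * dW t + g t) ^+ 2) <=
     2 * b^-1 ^+ 2 * itg (-1) 1 (fun t => dW t ^+ 2) + 2 * itg (-1) 1 (fun t => g t ^+ 2).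
    rewrite -!itgZ // -itgD; [|exact: L1Z|exact: L1Z].
    apply: itg_le; [exact: hww.1.2|by apply: L1D; exact: L1Z|].
    by move=> t _; rewrite -mulrA -exprMn; exact: sqrD_le.
  have h1' := ler_wpM2l (sqr_ge0 eps) h1; apply: le_trans h1' _.
  have h2 : eps ^+ 2 * itg (-1) 1 (fun t => dW t ^+ 2) <= Ce * (rho * tau ^+ 4).
    have : 0 <= b * itg (-1) 1 (fun t => W t ^+ 2) by apply: mulr_ge0 => //; exact: ltW.
    move: he he'; rewrite -/W -/dW; clear -b0 hf hf1 m11; lra.
  have h3 : 2 * b^-1 ^+ 2 * (eps ^+ 2 * itg (-1) 1 (fun t => dW t ^+ 2)) <=
      2 * b^-1 ^+ 2 * (Ce * (rho * tau ^+ 4)) by apply: ler_wpM2l => //; exact: mulr_ge0.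
  have e4 : 2 * b^-1 ^+ 2 * (Ce * (rho * tau ^+ 4)) = (rho * g2) * (tau ^+ 4 / 4).
    by rewrite g2E; field; rewrite gt_eqF.
  have rg : rho * g2 <= 1 by rewrite -rE ler_pM2l //; move: g10 g20; clear -b0 hf hf1 m11; lra.
  have h4 : (rho * g2) * (tau ^+ 4 / 4) <= tau ^+ 4 / 4.
    by rewrite ler_piMl // divr_ge0.
  have h5 : eps ^+ 2 * itg (-1) 1 (fun t => g t ^+ 2) <= tau ^+ 2 / 8.
    by apply: le_trans G0; rewrite ler_piMl // exprn_ile1 // ltW.
  have -> : eps ^+ 2 * (2 * b^-1 ^+ 2 * itg (-1) 1 (fun t => dW t ^+ 2) + 2 * itg (-1) 1 (fun t => g t ^+ 2))
    = 2 * b^-1 ^+ 2 * (eps ^+ 2 * itg (-1) 1 (fun t => dW t ^+ 2)) +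
      2 * (eps ^+ 2 * itg (-1) 1 (fun t => g t ^+ 2)) by ring.
  rewrite e4 in h3; move: h3 h4 h5 t42; clear -b0 hf hf1 m11; lra.
Qed.
End Regimes.

(** * From squared errors to the stated rates *)

Section Conclusion.
Variable R : realType.

Lemma approximates_norms (b tau eps : R) (p B : nat) (u : R -> R) :
  0 < b -> 0 < tau <= 1 -> approximates b p B tau eps u ->
  exists Phi : network R, let w := fun x => u x - realization Phi x in
    [/\ net_wf Phi, (width Phi <= 9)%N, (depth Phi <= 36 * (p * B))%N,
        (0 < net_size Phi <= 90 * (36 * (p * B)))%N &
      energy_norm_le eps b w tau /\ L2_norm_le w (tau ^+ 2)].
Proof.
move=> b0 /andP[t0 t1] [Phi [g [wf wd dp sz [hw nw ng]]]].
have m11 : (-1 : R) <= 1 by lra.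
exists Phi; split => //.
have lw := (H1_L2 m11 hw).2.
set w := fun x => u x - realization Phi x in hw lw nw *.
have T4 : 0 <= tau ^+ 4 by apply: exprn_ge0; exact: ltW.
have t42 : tau ^+ 4 <= tau ^+ 2 by apply: ler_wiXn2l => //; exact: ltW.
have k0 := kappa_gt0 b0.
have kE : kappa b * (1 + b) = 2^-1 by rewrite /kappa; field; rewrite gt_eqF //; lra.
have kb : kappa b * b <= 2^-1 by lra.
have k1 : kappa b <= 1.
  have : 0 <= kappa b * b by rewrite mulr_ge0 // ltW.
  by lra.
split.
  exists g; split; first exact: H1_has_weak_deriv.
  rewrite -[leRHS]ger0_norm ?(ltW t0) // -sqrtr_sqr ler_wsqrtr //.
  rewrite -/(itg (-1) 1 (fun x => eps ^+ 2 * g x ^+ 2 + b * w x ^+ 2)).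
  rewrite itgD; [|exact: L1Z hw.1.2|exact: L1Z lw].
  rewrite (itgZ _ hw.1.2) (itgZ _ lw).
  have h1 := ler_wpM2l (ltW b0) nw.
  have h2 : b * (kappa b * tau ^+ 4) <= 2^-1 * tau ^+ 4.
    by rewrite mulrA ler_wpM2r // mulrC.
  lra.
split; first exact: lw.
rewrite -[leRHS]ger0_norm ?sqr_ge0 // -sqrtr_sqr ler_wsqrtr // -exprM.
by apply: le_trans nw _; rewrite ler_piMl.
Qed.

(** Raise the size bound to the power [beta] and solve for [tau]. *)
Lemma size_rate (c M tau beta : R) : 0 < c -> 0 < M -> 0 < tau -> 0 < beta ->
  M <= c * tau `^ (- beta^-1) -> tau <= c `^ beta * M `^ (- beta).
Proof.
move=> c0 M0 t0 be0 h.
have h1 : M `^ beta <= c `^ beta * tau^-1.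
  have -> : c `^ beta * tau^-1 = (c * tau `^ (- beta^-1)) `^ beta.
    rewrite powRM ?powR_ge0 ?(ltW c0) // -powRrM mulNr mulVf ?gt_eqF //.
    by rewrite powRN powRr1 // ltW.
  by apply: ge0_ler_powR; rewrite ?nnegrE ?mulr_ge0 ?powR_ge0 // ltW.
have Mb : 0 < M `^ beta by exact: powR_gt0.
rewrite powRN ler_pdivlMr // -ler_pdivlMl //.
by rewrite mulrC.
Qed.

End Conclusion.
Unset Implicit Arguments.

Theorem theorem4p8 (R : realType) (b : R) (f : R -> R) (delta : R) :
  0 < b -> in_H2 f -> 0 < delta < 1 ->
  exists (C Cd Ctd tau0 : R),
    [/\ 0 < C, 0 < Cd, 0 < Ctd, 0 < tau0 <= 1 &
    forall tau eps : R, 0 < tau <= 1 -> 0 < eps <= 1 ->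
    forall u : R -> R, weak_solution eps b f u ->
    exists Phi : network R,
      let M := net_size Phi in
      let w := fun x => u x - realization Phi x in
      [/\ net_wf Phi,
          (tau <= tau0 -> (width Phi)%:R <= C * `|log2 tau| ^+ 2),
          (depth Phi)%:R <= C * powR tau (- (2 * (1 - delta))^-1),
          M%:R <= Cd * powR tau (- (2 * (1 - delta))^-1) &
          [/\ energy_norm_le eps b w tau,
               tau <= Ctd * powR M%:R (- (2 * (1 - delta))),
               L2_norm_le w (tau ^+ 2) &
               tau ^+ 2 <= Ctd ^+ 2 * powR M%:R (- (4 * (1 - delta)))]]].
Proof.
move=> b0 [f1 [f2 [/has_weak_deriv_H1 hf /has_weak_deriv_H1 hf1]]] /andP[d0 d1].
have [rho [A2 [H2 [r01 small_eps]]]] := unresolved_regime b0 hf hf1.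
have [A1 [H1' large_eps]] := resolved_regime b0 hf hf1 r01.
(* Common constants for both regimes: the mesh parameters are fixed by [tau] alone, before [eps] is
   compared with [tau]. *)
pose A := 1 + `|A1| + `|A2|; pose H := 1 + `|H1'| + `|H2|.
have [a1 a2 a3] : [/\ A1 <= A, A2 <= A & 1 <= A].
  have := ler_norm A1; have := ler_norm A2; have := normr_ge0 A1; have := normr_ge0 A2.
  by rewrite /A; split; lra.
have [h1 h2 h3] : [/\ H1' <= H, H2 <= H & 0 < H].
  have := ler_norm H1'; have := ler_norm H2; have := normr_ge0 H1'; have := normr_ge0 H2.
  by rewrite /H; split; lra.
set beta := 2 * (1 - delta).
have be0 : 0 < beta by rewrite /beta; lra.
(* Here [0 < delta] enters: the exponent exceeds 1/2, which leaves room for the logarithms. *)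
have al : 2^-1 < beta^-1 by rewrite ltf_pV2 ?posrE // /beta; lra.
have [Cn Cn0 par] := mesh_parameters a3 (ltW h3) al.
pose Cd := 90 * (36 * Cn).
have Cd0 : 0 < Cd by rewrite !mulr_gt0.
(* The first constant serves width and depth together. For [tau <= 1/2] the absolute value of
   [log2 tau] is at least 1, so it covers the width 9. *)
exists (9 + 36 * Cn), Cd, (Cd `^ beta), 2^-1; split => //.
- by rewrite addr_gt0 // mulr_gt0.
- exact: powR_gt0.
- by rewrite invr_gt0 ltr0n invf_le1 ?ler1n.
move=> tau eps t01 e01 u ws.
have /andP[t0 t1] := t01.
have [p [B [p2 B0 pA pH pn]]] := par tau t01.
have ap : approximates b p B tau eps u.
  have [le|lt] := leP (rho * tau ^+ 4) eps.
    exact: (large_eps A H).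
  by apply: (small_eps A H) => //; exact: ltW.
have [Phi [wf wd dp /andP[sz0 sz] [en l2]]] := approximates_norms b0 t01 ap.
set P := tau `^ (- beta^-1) in pn *.
have P0 : 0 <= P by exact: powR_ge0.
have dR : (36 * (p * B))%:R <= 36 * Cn * P :> R.
  by rewrite natrM -mulrA ler_pM2l.
have sR : (net_size Phi)%:R <= Cd * P.
  apply: (@le_trans _ _ (90 * (36 * (p * B)))%:R); first by rewrite ler_nat.
  by rewrite natrM /Cd -(mulrA 90) ler_pM2l.
have M0 : 0 < (net_size Phi)%:R :> R by rewrite ltr0n.
have rate : tau <= Cd `^ beta * (net_size Phi)%:R `^ (- beta) by apply: size_rate.
exists Phi; split => //.
- move=> th; have ln2 : 0 < ln 2 :> R by rewrite ln_gt0 // ltr1n.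
  have l1 : 1 <= `|log2 tau| ^+ 2.
    rewrite -[leLHS](expr1n _ 2); apply: lerXn2r; rewrite ?nnegrE //.
    rewrite /log2 normrM normfV (gtr0_norm ln2) ler_pdivlMr // mul1r.
    rewrite ler0_norm ?ln_le0 // lerNr -lnV ?posrE ?ltr0n //.
    by rewrite ler_ln ?posrE ?invr_gt0 ?ltr0n.
  apply: (@le_trans _ _ (9 + 36 * Cn)).
    apply: (@le_trans _ _ 9%:R); first by rewrite ler_nat.
    by rewrite lerDl mulr_ge0 // ltW.
  by rewrite ler_peMr // addr_ge0 // mulr_ge0 // ltW.
- apply: (@le_trans _ _ (36 * (p * B))%:R); first by rewrite ler_nat.
  by apply: le_trans dR _; apply: ler_wpM2r => //; rewrite lerDr.
- split => //.
  have -> : (net_size Phi)%:R `^ (- (4 * (1 - delta))) = ((net_size Phi)%:R `^ (- beta)) ^+ 2.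
    by rewrite -powR_mulrn ?powR_ge0 // -powRrM; congr (_ `^ _); rewrite /beta; ring.
  rewrite -exprMn.
  apply: lerXn2r; rewrite ?nnegrE ?(ltW t0) //.
  by rewrite mulr_ge0 ?powR_ge0.
Qed.
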